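(* Let $X$ and $Y$ be Banach spaces, $\Omega\subset X$, $F:X\rightrightarrows Y$, $\bar x\in\Omega$, $\bar y\in F(\bar x)$, and let $\Xi$ be a nonempty family of subsets of $Y$. Suppose that the sets $\Omega$, $\mathrm{gph}\,F$ and all members of $\Xi$ are closed. If the triple $\{F,\Omega,\Xi\}$ is approximately stationary at $(\bar x,\bar y)$, then one of the following assertions holds true: (i) there is an $M>0$ such that, for any $\varepsilon>0$, there exist $(x_1,y_1)\in\mathrm{gph}\,F\cap B_{\varepsilon}(\bar x,\bar y)$, $x_2\in\Omega\cap B_{\varepsilon}(\bar x)$, $A\in\Xi$, $y_2\in A\cap B_\varepsilon(\bar y)$, and $y^*\in N^C_{A}(y_2)+\varepsilon\mathbb B_{Y^*}$ such that $\|y^*\|=1$ and $$0\in D^{*C}F(x_1,y_1)(y^* )+N^C_\Omega(x_2)\cap(M\mathbb B_{X^*})+\varepsilon\mathbb B_{X^*};$$ (ii) for any $\varepsilon>0$, there exist $(x_1,y_1)\in\mathrm{gph}\,F\cap B_{\varepsilon}(\bar x,\bar y)$, $x_2\in\Omega\cap B_{\varepsilon}(\bar x)$, $x_1^*\in D^{*C}F(x_1,y_1)(\varepsilon\mathbb B_{Y^*})$ and $x_2^*\in N^C_\Omega(x_2)$ such that $\|x_1^*+x_2^*\|<\varepsilon$ and $\|x_1^*\|+\|x_2^*\|=1$. If $X$ and $Y$ are Asplund and the triple $\{F,\Omega,\Xi\}$ is approximately stationary at $(\bar x,\bar y)$, then one of the following assertions holds true: (i$_F$) there is an $M>0$ such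 that, for any $\varepsilon>0$, there exist $(x_1,y_1)\in\mathrm{gph}\,F\cap B_{\varepsilon}(\bar x,\bar y)$, $x_2\in\Omega\cap B_{\varepsilon}(\bar x)$, $A\in\Xi$, $y_2\in A\cap B_\varepsilon(\bar y)$, and $y^*\in N^F_{A}(y_2)+\varepsilon\mathbb B_{Y^*}$ such that $\|y^*\|=1$ and $$0\in D^{*F}F(x_1,y_1)(y^* )+N^F_\Omega(x_2)\cap(M\mathbb B_{X^*})+\varepsilon\mathbb B_{X^*};$$ (ii$_F$) for any $\varepsilon>0$, there exist $(x_1,y_1)\in\mathrm{gph}\,F\cap B_{\varepsilon}(\bar x,\bar y)$, $x_2\in\Omega\cap B_{\varepsilon}(\bar x)$, $x_1^*\in D^{*F}F(x_1,y_1)(\varepsilon\mathbb B_{Y^*})$ and $x_2^*\in N^F_\Omega(x_2)$ such that $\|x_1^*+x_2^*\|<\varepsilon$ and $\|x_1^*\|+\|x_2^*\|=1$.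
   Context: Notation: $B_\delta(x)$ is the open ball; $\mathbb B$ (with a subscript for the space) is the open unit ball; $X\times Y$ carries the maximum norm; $d(x,S)=\inf_{u\in S}\|u-x\|$ with $d(x,\emptyset)=+\infty$; $\mathrm{gph}\,F=\{(x,y)\mid y\in F(x)\}$ for a set-valued mapping $F$ (values may be empty); the image of a set under a set-valued mapping is the union of the images of its points. Normal cones: for a subset $S$ of a normed space $Z$ and $\bar z\in S$, the Fréchet normal cone is $N^F_S(\bar z)=\{z^*\in Z^*\mid \limsup_{S\ni z\to\bar z,\,z\ne\bar z}\langle z^*,z-\bar z\rangle/\|z-\bar z\|\le0\}$; the Clarke tangent cone $T^C_S(\bar z)$ is the set of $w\in Z$ such that for all $z_k\to\bar z$ with $z_k\in S$ and all $t_k\downarrow0$ there are $w_k\to w$ with $z_k+t_kw_k\in S$ for all $k$; the Clarke normal cone is $N^C_S(\bar z)=\{z^*\in Z^*\mid\langle z^*,w\rangle\le0\ \forall w\in T^C_S(\bar z)\}$. Both are empty by convention if $\bar z\notin S$. Coderivatives: for $(x,y)\in\mathrm{gph}\,F$, $D^{*C}F(x,y)(y^* )=\{x^*\in X^*\mid(x^*,-y^* )\in N^C_{\mathrm{gph}\,F}(x,y)\}$, and $D^{*F}F(x,y)$ is defined in the same way with $N^F$ in place of $N^C$. A Banach space is Asplund if the dual of each of its separable subspaces is separable. Approximate stationarity: a collection $\{\Xi_1,\ldots,\Xi_n\}$ of families of subsets of a normed space $Z$ is approximately stationary at $\bar z\in Z$ if, for any $\varepsilon>0$, there exist $\rho\in(0,\varepsilon)$,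 $A_i\in\Xi_i$ and $z_i\in B_\varepsilon(\bar z)$ $(i=1,\ldots,n)$ such that $\max_{1\le i\le n}d(z_i,A_i)<\varepsilon\rho$ and $\bigcap_{i=1}^n(A_i-z_i)\cap(\rho\mathbb B)=\emptyset$. The triple $\{F,\Omega,\Xi\}$ is approximately stationary at $(\bar x,\bar y)$ if the pair of families $\Xi_1:=\{\mathrm{gph}\,F\}$, $\Xi_2:=\{\Omega\times A\mid A\in\Xi\}$ of subsets of $X\times Y$ is approximately stationary at $(\bar x,\bar y)$. *)

(* Defs.v *)
From HB Require Import structures.
From mathcomp Require Import all_boot all_order all_algebra.
From mathcomp Require Import all_classical all_reals all_analysis.

Set Implicit Arguments.
Unset Strict Implicit.
Unset Printing Implicit Defensive.

Import Order.TTheory GRing.Theory Num.Theory.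
Import numFieldNormedType.Exports.

Local Open Scope classical_set_scope.
Local Open Scope ring_scope.

Section dual_type.
Context {R : realType} (V : normedModType R).

Definition dual_pred : {pred V -> R^o} :=
  fun f => `[< linear f /\ continuous f >].

Lemma dual_submod_closed : submod_closed dual_pred.
Proof.
split.
  apply/asboolP; split; last by move=> x; exact: cvg_cst.
  by move=> a x y; rewrite scaler0 addr0.
move=> a f g /asboolP[lf cf] /asboolP[lg cg]; apply/asboolP; split.
  move=> b x y; rewrite !fctE lf lg !scalerDr !scalerA (mulrC a b).
  by rewrite -!addrA; congr (_ + _); rewrite addrCA.
move=> x; apply: cvgD; last exact: cg.
by apply: cvgZl_tmp; exact: cf.
Qed.

HB.instance Definition _ :=
  GRing.isSubmodClosed.Build R (V -> R^o) dual_pred dual_submod_closed.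

Record dual : Type := Dual {
  dual_fun :> V -> R^o;
  _ : dual_fun \in dual_pred }.

HB.instance Definition _ := [isSub for dual_fun].
HB.instance Definition _ := [Choice of dual by <:].
HB.instance Definition _ := [SubChoice_isSubLmodule of dual by <:].

Lemma dual_linear (f : dual) : linear f.
Proof. by have /asboolP[] := valP f. Qed.

Lemma dual_continuous (f : dual) : continuous f.
Proof. by have /asboolP[] := valP f. Qed.

HB.instance Definition _ (f : dual) :=
  GRing.isLinear.Build R V R^o *:%R f (dual_linear f).

Definition mk_dual (f : V -> R^o) (lf : linear f) (cf : continuous f) : dual :=
  Dual (introT (asboolP _) (conj lf cf)).

Lemma dualP (f g : dual) : f =1 g -> f = g.
Proof. by move=> fg; apply/val_inj/funext. Qed.

Lemma dualDE (f g : dual) x : (f + g) x = f x + g x. Proof. by []. Qed.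
Lemma dualZE a (f : dual) x : (a *: f) x = a * f x. Proof. by []. Qed.

Definition dual_norm (f : dual) : R := sup [set `|f x| | x in [set x | `|x| <= 1]].

Lemma dual_norm_has_sup (f : dual) :
  has_sup [set `|f x| | x in [set x | `|x| <= 1]].
Proof.
split; first by exists `|f 0|, 0 => //=; rewrite normr0.
have /linear_bounded_continuous/bounded_funP/(_ 1)[M fM] := @dual_continuous f.
by exists M => _ [x /= x1 <-]; exact: fM.
Qed.

Lemma dual_norm_ub (f : dual) x : `|x| <= 1 -> `|f x| <= dual_norm f.
Proof.
move=> x1; apply: sup_ubound; last by exists x.
by case: (dual_norm_has_sup f).
Qed.

Lemma dual_norm_le (f : dual) c :
  (forall x, `|x| <= 1 -> `|f x| <= c) -> dual_norm f <= c.
Proof.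
move=> fc; apply: ge_sup; first by case: (dual_norm_has_sup f).
by move=> _ [x x1 <-]; exact: fc.
Qed.

Lemma dual_norm_ge0 (f : dual) : 0 <= dual_norm f.
Proof. by apply: le_trans (@dual_norm_ub f 0 _); rewrite ?normr0. Qed.

Lemma dual_normP (f : dual) x : `|f x| <= dual_norm f * `|x|.
Proof.
have [->|x0] := eqVneq x 0; first by rewrite linear0 !normr0 mulr0.
have nx : 0 < `|x| by rewrite normr_gt0.
have := @dual_norm_ub f (`|x|^-1 *: x).
rewrite linearZ !normrZ normfV normr_id mulVf ?gt_eqF// lexx => /(_ isT).
by rewrite mulrC ler_pdivrMr.
Qed.

Lemma dual_ler_normD (f g : dual) : dual_norm (f + g) <= dual_norm f + dual_norm g.
Proof.
apply: dual_norm_le => x x1; rewrite dualDE (le_trans (ler_normD _ _))//.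
by rewrite lerD// dual_norm_ub.
Qed.

Lemma dual_normrZ a (f : dual) : dual_norm (a *: f) = `|a| * dual_norm f.
Proof.
have le_aN b (g : dual) : dual_norm (b *: g) <= `|b| * dual_norm g.
  apply: dual_norm_le => x x1.
  by rewrite dualZE normrM ler_wpM2l// dual_norm_ub.
apply/le_anti; rewrite le_aN/=.
have [->|a0] := eqVneq a 0; first by rewrite normr0 mul0r dual_norm_ge0.
rewrite -ler_pdivlMl ?normr_gt0// -normfV.
by apply: le_trans (le_aN _ _); rewrite scalerA mulVf// scale1r.
Qed.

Lemma dual_normr0_eq0 (f : dual) : dual_norm f = 0 -> f = 0.
Proof.
move=> f0; apply: dualP => x; apply/normr0_eq0/le_anti.
by rewrite normr_ge0 andbT (le_trans (dual_normP f x))// f0 mul0r.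
Qed.

HB.instance Definition _ := @Lmodule_isNormed.Build R dual dual_norm
  dual_ler_normD dual_normrZ dual_normr0_eq0.

Lemma dual_normE (f : dual) :
  `|f| = sup [set `|f x| | x in [set x | `|x| <= 1]].
Proof. by []. Qed.

End dual_type.

Section subspace_type.
Context {R : realType} {V : normedModType R} (L : submodClosed V).

Record subspace_type : Type := Subspace {
  subspace_val :> V;
  _ : subspace_val \in L }.

HB.instance Definition _ := [isSub for subspace_val].
HB.instance Definition _ := [Choice of subspace_type by <:].
HB.instance Definition _ := [SubChoice_isSubLmodule of subspace_type by <:].

Definition subspace_norm (x : subspace_type) : R := `|val x|.

Lemma subspace_ler_normD (x y : subspace_type) :
  subspace_norm (x + y) <= subspace_norm x + subspace_norm y.
Proof. exact: ler_normD. Qed.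

Lemma subspace_normrZ a (x : subspace_type) :
  subspace_norm (a *: x) = `|a| * subspace_norm x.
Proof. exact: normrZ. Qed.

Lemma subspace_normr0_eq0 (x : subspace_type) : subspace_norm x = 0 -> x = 0.
Proof. by move=> /normr0_eq0 x0; exact: val_inj. Qed.

HB.instance Definition _ := @Lmodule_isNormed.Build R subspace_type
  subspace_norm subspace_ler_normD subspace_normrZ subspace_normr0_eq0.

Lemma subspace_normE (x : subspace_type) : `|x| = `|subspace_val x|.
Proof. by []. Qed.

End subspace_type.

Definition separable (T : topologicalType) : Prop :=
  exists2 D : set T, countable D & dense D.

Definition asplund {R : realType} (V : normedModType R) : Prop :=
  forall L : submodClosed V,
    separable (subspace_type L) -> separable (dual (subspace_type L)).

Definition gph (T U : Type) (F : T -> set U) : set (T * U) :=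
  [set p | F p.1 p.2].

Definition sv_image (T U : Type) (F : T -> set U) (S : set T) : set U :=
  \bigcup_(x in S) F x.

Definition set_add (V : zmodType) (A B : set V) : set V :=
  [set a + b | a in A & b in B].

(* The value is [+oo] when [S] is empty. *)
Definition dist (R : realType) (V : normedModType R) (x : V) (S : set V) : \bar R :=
  ereal_inf [set (`|u - x|)%:E | u in S].

Section normal_cones.
Context {R : realType}.

(* At an isolated point of [S] the filter contains the empty set, the upper
   limit is [-oo], and every functional is a normal. *)
Definition frechet_normal (V : normedModType R) (S : set V) (z0 : V) :
    set (dual V) :=
  [set f | S z0 /\
    (limf_esup (fun z => (f (z - z0) / `|z - z0|)%:E) (within S z0^') <= 0)%E].

Definition clarke_tangent (V : normedModType R) (S : set V) (z0 : V) : set V :=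
  [set w | forall (z : nat -> V) (t : nat -> R),
    (forall k, S (z k)) -> z k @[k --> \oo] --> z0 ->
    (forall k, 0 < t k) -> t k @[k --> \oo] --> (0 : R) ->
    exists2 w_ : nat -> V, w_ k @[k --> \oo] --> w &
      forall k, S (z k + t k *: w_ k)].

Definition clarke_normal (V : normedModType R) (S : set V) (z0 : V) :
    set (dual V) :=
  [set f | S z0 /\ forall w, clarke_tangent S z0 w -> f w <= 0].

Section coderivative.
Context {X Y : normedModType R}.

Lemma dual_pair_linear (f : dual X) (g : dual Y) :
  linear (fun p : X * Y => f p.1 + g p.2 : R^o).
Proof. by move=> a x y /=; rewrite !linearP scalerDr addrACA. Qed.

Lemma dual_pair_continuous (f : dual X) (g : dual Y) :
  continuous (fun p : X * Y => f p.1 + g p.2 : R^o).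
Proof.
move=> p; apply: cvgD.
  by apply: (cvg_comp _ _ cvg_fst); exact: dual_continuous.
by apply: (cvg_comp _ _ cvg_snd); exact: dual_continuous.
Qed.

(* The pair (f, g), acting on X * Y by (x, y) |-> f x + g y. *)
Definition dual_pair (f : dual X) (g : dual Y) : dual (X * Y)%type :=
  mk_dual (dual_pair_linear f g) (@dual_pair_continuous f g).

Definition clarke_coderivative (F : X -> set Y) (x : X) (y : Y) (g : dual Y) :
    set (dual X) :=
  [set f | clarke_normal (gph F) (x, y) (dual_pair f (- g))].

Definition frechet_coderivative (F : X -> set Y) (x : X) (y : Y) (g : dual Y) :
    set (dual X) :=
  [set f | frechet_normal (gph F) (x, y) (dual_pair f (- g))].

End coderivative.
End normal_cones.

Section stationarity.
Context {R : realType}.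

Definition approx_stationary_family (Z : normedModType R) (n : nat)
    (Xi : 'I_n -> set (set Z)) (z0 : Z) : Prop :=
  forall eps : R, 0 < eps ->
    exists (rho : R) (A : 'I_n -> set Z) (z : 'I_n -> Z),
      [/\ 0 < rho < eps,
          forall i, Xi i (A i),
          forall i, ball z0 eps (z i),
          (\big[maxe/-oo]_(i < n) dist (z i) (A i) < (eps * rho)%:E)%E &
          \bigcap_i [set a - z i | a in A i] `&` ball 0 rho = set0].

Definition approx_stationary (X Y : normedModType R) (F : X -> set Y)
    (Omega : set X) (Xi : set (set Y)) (x0 : X) (y0 : Y) : Prop :=
  @approx_stationary_family (X * Y)%type 2
    (fun i => if i == ord0 then [set gph F]
              else [set Omega `*` A | A in Xi])
    (x0, y0).

End stationarity.

(* Main.v *)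
From HB Require Import structures.
Require Import Defs.
From mathcomp Require Import all_boot all_order all_algebra ring lra.
From mathcomp Require Import all_classical all_reals all_analysis.

Set Implicit Arguments.
Unset Strict Implicit.
Unset Printing Implicit Defensive.

Import Order.TTheory GRing.Theory Num.Theory.
Import numFieldNormedType.Exports.

Local Open Scope classical_set_scope.
Local Open Scope ring_scope.

(** Both halves rest on a quantitative extremal principle: if closed sets [A1],
    [A2] nearly touch but their translates do not meet in a ball, then nearby
    points carry almost opposite normals of norm bounded below.  Splitting these
    normals on the product and normalizing, alternative (i) holds if the [Y]-parts
    stay away from zero along some sequence, and (ii) holds otherwise.

    For Clarke normals the extremal principle follows from Ekeland's principle:
    the directional derivative of the norm is sublinear and bounded below on the
    product of the tangent cones, which are convex, and Hahn-Banach applies.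

    For Frechet normals in Asplund spaces one reduces to a separable subspace.
    The unit ball of the dual is fragmented by weak* open sets (otherwise a binary
    tree yields a separable subspace with nonseparable dual).  Exhausting the ball
    by fragments turns this into a choice of points of the dual, and closing a
    countable set under all relevant choices produces a separable closed subspace
    [V] and a separable subspace of the dual restricting isometrically onto the
    dual of [V], such that Frechet normals in [V] extend to the whole space.  As
    [V] has a separable dual, it carries an equivalent Frechet smooth norm, and
    the Borwein-Preiss principle yields exact Frechet normals there. *)

(** * Hahn-Banach and weak* compactness *)

(** The obstacle in the Frechet half is that a functional on a subspace has many extensions and no
    canonical one, while countably many functionals must serve the whole dual of the subspace. A
    selector removes it: it looks only at a weak* neighbourhood of the set of extensions in the unit
    ball, not at the functional being extended, and compactness lets this neighbourhood be described
    by finitely many rational data. Likewise, a failure of the Frechet inequality is recorded with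
    rational slope and radii, so that countably many witnesses account for all failures. The
    variational principle takes an abstract penalty: for Clarke normals the norm will do, whereas
    Frechet normals need a differentiable one. Completeness is used only along sequences with
    geometrically decreasing steps. *)

Section hahn_banach.
Context {R : realType} {V : lmodType R}.
Implicit Types (p q : V -> R).

(** One inequality suffices for homogeneity, as [t^-1] yields the other; this weak form passes
    easily to infima. *)
Definition sublinear p :=
  (forall x y, p (x + y) <= p x + p y) /\
  (forall t x, 0 < t -> p (t *: x) <= t * p x).

Lemma sublinear0 p : sublinear p -> p 0 = 0.
Proof.
case=> _ pZ; have := pZ 2 0; have := pZ 2^-1 0; rewrite !scaler0; lra.
Qed.

Lemma sublinear_geN p x : sublinear p -> - p (- x) <= p x.
Proof.
by move=> sp; have := sp.1 x (- x); rewrite subrr (sublinear0 sp); lra.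
Qed.

Lemma sublinearZ p t x : sublinear p -> 0 < t -> p (t *: x) = t * p x.
Proof.
move=> sp t0; apply/le_anti/andP; split; first exact: sp.2.
have := sp.2 t^-1 (t *: x); rewrite invr_gt0 => /(_ t0).
by rewrite scalerA mulVf ?gt_eqF// scale1r ler_pdivlMl.
Qed.

Lemma lb_le_infD (A B : set R) c : A !=set0 -> B !=set0 ->
  (forall a b, A a -> B b -> c <= a + b) -> c <= inf A + inf B.
Proof.
move=> A0 B0 cAB; rewrite -lerBlDr; apply: lb_le_inf => // a Aa.
by rewrite lerBlDr addrC -lerBlDr; apply: lb_le_inf => // b Bb;
  rewrite lerBlDr addrC; exact: cAB.
Qed.

(* Subtracting the slope of [q] along [y] can only lower a sublinear
   functional; a minimal one is therefore additive. *)
Lemma minimal_sublinear_linear q : sublinear q ->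
  (forall r, sublinear r -> (forall x, r x <= q x) -> forall x, r x = q x) ->
  linear (q : V -> R^o).
Proof.
move=> sq qmin.
pose r y x := inf [set q (x + t *: y) - t * q y | t in [set t | 0 <= t]].
have rne x y : [set q (x + t *: y) - t * q y | t in [set t | 0 <= t]] !=set0.
  by exists (q (x + 0 *: y) - 0 * q y), 0 => //=.
have rlb x y : has_lbound [set q (x + t *: y) - t * q y | t in [set t | 0 <= t]].
  exists (- q (- x)) => _ [t /= t0 <-].
  have : t * q y <= q (x + t *: y) + q (- x).
    rewrite -[leLHS]/(t * q y); have [->|tn0] := eqVneq t 0.
      by rewrite mul0r scale0r addr0; have := sublinear_geN x sq; lra.
    rewrite -(sublinearZ _ sq) ?lt_def ?tn0//.
    by apply: le_trans (sq.1 _ _); rewrite addrC addKr.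
  lra.
have rq y x : r y x <= q x.
  apply: ge_inf => //; exists 0; first by rewrite /= lexx.
  by rewrite scale0r addr0 mul0r subr0.
have rs y : sublinear (r y).
  split=> [a b|t a t0].
    apply: lb_le_infD => // _ _ [s s0 <-] [t t0 <-].
    apply: (@le_trans _ _ (q (a + b + (s + t) *: y) - (s + t) * q y)).
      by apply: ge_inf => //; exists (s + t) => //=; exact: addr_ge0.
    have := sq.1 (a + s *: y) (b + t *: y).
    by rewrite addrACA -scalerDl; lra.
  rewrite -ler_pdivrMl//; apply: lb_le_inf => // _ [s s0 <-].
  rewrite ler_pdivrMl//.
  apply: (@le_trans _ _ (q (t *: a + (t * s) *: y) - (t * s) * q y)).
    by apply: ge_inf => //; exists (t * s) => //=; rewrite mulr_ge0// ltW.
  by rewrite -scalerA -scalerDr (sublinearZ _ sq)//; lra.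
(* Minimality turns [r y <= q] into an equality; bounding the infimum by its term at [t = 1] gives
   the missing half of additivity. *)
have qD x y : q (x + y) = q x + q y.
  apply/le_anti/andP; split; first exact: sq.1.
  rewrite -(qmin _ (rs y) (rq y)) -lerBrDr; apply: ge_inf => //.
  by exists 1 => //=; rewrite scale1r mul1r.
have qN x : q (- x) = - q x.
  by apply/eqP; rewrite -addr_eq0 addrC -qD subrr (sublinear0 sq).
have qZ t x : q (t *: x) = t * q x.
  have [t0|t0|->] := ltgtP t 0.
  - rewrite -[t]opprK scaleNr qN (sublinearZ _ sq) ?oppr_gt0//; lra.
  - exact: sublinearZ.
  - by rewrite scale0r mul0r sublinear0.
by move=> t x y; rewrite qD qZ.
Qed.

(** Zorn's lemma provides a minimal sublinear functional below [p]. The infimum of a chain stays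
    finite because every member is at least [- p (- x)] at [x]. *)
Lemma exists_linear_le_sublinear p : sublinear p ->
  exists2 l : V -> R^o, linear l & forall x, l x <= p x.
Proof.
move=> sp.
pose T := {q : V -> R | sublinear q /\ forall x, q x <= p x}.
pose rl (a b : T) := `[< forall x, sval b x <= sval a x >].
have [| | | |q qmin] := @Zorn T rl.
- by move=> a; apply/asboolP.
- move=> a b c /asboolP ab /asboolP bc; apply/asboolP => x.
  exact: le_trans (bc x) (ab x).
- move=> [a Pa] [b Pb] /asboolP ab /asboolP ba.
  have ab' : a = b by apply/funext => x; apply/le_anti; rewrite ba ab.
  by case: _ / ab' in Pb ab ba *; congr exist; exact: Prop_irrelevance.
- move=> A Atot; have [[a0 Aa0]|A0] := pselect (A !=set0); last first.
    exists (exist _ p (conj sp (fun=> lexx _))) => a Aa.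
    by exfalso; apply: A0; exists a.
  pose r x := inf [set sval a x | a in A].
  have ne x : [set sval a x | a in A] !=set0 by exists (sval a0 x), a0.
  have lb x : has_lbound [set sval a x | a in A].
    exists (- p (- x)) => _ [a _ <-].
    apply: le_trans (sublinear_geN _ (svalP a).1).
    by rewrite lerN2; exact: (svalP a).2.
  have ra x a : A a -> r x <= sval a x.
    by move=> Aa; apply: ge_inf => //; exists a.
  have rs : sublinear r.
    split=> [x y|t x t0].
      apply: lb_le_infD => // _ _ [a Aa <-] [b Ab <-].
      have [/asboolP ab|/asboolP ba] := Atot _ _ Aa Ab.
        apply: (le_trans (ra _ _ Ab)); apply: (le_trans ((svalP b).1.1 _ _)).
        by rewrite lerD2r.
      apply: (le_trans (ra _ _ Aa)); apply: (le_trans ((svalP a).1.1 _ _)).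
      by rewrite lerD2l.
    rewrite -ler_pdivrMl//; apply: lb_le_inf => // _ [a Aa <-].
    rewrite ler_pdivrMl//; apply: (le_trans (ra _ _ Aa)).
    exact: (svalP a).1.2.
  have rp x : r x <= p x.
    exact: le_trans (ra _ _ Aa0) ((svalP a0).2 x).
  exists (exist _ r (conj rs rp)) => a Aa; apply/asboolP => x /=.
  exact: ra.
exists (sval q); last exact: (svalP q).2.
apply: minimal_sublinear_linear => [|r rs rq x]; first exact: (svalP q).1.
have rp y : r y <= p y by exact: le_trans (rq y) ((svalP q).2 y).
have := qmin (exist _ r (conj rs rp)).
have -> : rl q (exist _ r (conj rs rp)) by apply/asboolP.
by move=> /(_ isT) <-.
Qed.

(** A sandwich form: [S] is a convex cone of vectors with prescribed lower bounds. With the graph of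
    a functional it gives extensions, with a cone and bounds 0 it gives separation. The infimum [q]
    absorbs the bounds: a linear [l <= q] has [l (- a.1) <= - a.2]. *)
Lemma hahn_banach p (S : set (V * R)) : sublinear p -> S (0, 0) ->
  (forall a b, S a -> S b -> S (a.1 + b.1, a.2 + b.2)) ->
  (forall t a, 0 < t -> S a -> S (t *: a.1, t * a.2)) ->
  (forall a, S a -> a.2 <= p a.1) ->
  exists l : V -> R^o, [/\ linear l, forall x, l x <= p x &
    forall a, S a -> a.2 <= l a.1].
Proof.
move=> sp S0 SD SZ Sp.
pose q x := inf [set p (x + a.1) - a.2 | a in S].
have ne x : [set p (x + a.1) - a.2 | a in S] !=set0.
  by exists (p (x + 0) - 0), (0, 0).
have lb x : has_lbound [set p (x + a.1) - a.2 | a in S].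
  exists (- p (- x)) => _ [a Sa <-].
  have := Sp a Sa; have := sp.1 (x + a.1) (- x).
  by rewrite addrAC subrr add0r; lra.
have qs : sublinear q.
  split=> [x y|t x t0].
    apply: lb_le_infD => // _ _ [a Sa <-] [b Sb <-].
    apply: (@le_trans _ _ (p (x + y + (a.1 + b.1)) - (a.2 + b.2))).
      by apply: ge_inf => //; exists (a.1 + b.1, a.2 + b.2) => //; exact: SD.
    by have := sp.1 (x + a.1) (y + b.1); rewrite addrACA; lra.
  rewrite -ler_pdivrMl//; apply: lb_le_inf => // _ [a Sa <-].
  rewrite ler_pdivrMl//.
  apply: (@le_trans _ _ (p (t *: x + t *: a.1) - t * a.2)).
    by apply: ge_inf => //; exists (t *: a.1, t * a.2) => //; exact: SZ.
  by rewrite -scalerDr (sublinearZ _ sp)//; lra.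
have [l ll lq] := exists_linear_le_sublinear qs.
exists l; split=> // [x|a Sa].
  apply: (le_trans (lq x)); apply: ge_inf => //; exists (0, 0) => //=.
  by rewrite addr0 subr0.
pose L : {linear V -> R^o} := HB.pack l (GRing.isLinear.Build _ _ _ _ l ll).
have lN x : l (- x) = - l x by rewrite -[l]/(L : V -> R^o) linearN.
have : l (- a.1) <= - a.2.
  apply: (le_trans (lq _)); apply: ge_inf => //; exists a => //.
  by rewrite addNr (sublinear0 sp) sub0r.
by rewrite lN lerN2.
Qed.

End hahn_banach.

Section dual_facts.
Context {R : realType} {V : normedModType R}.
Implicit Types f g : dual V.

Lemma exists_dual (l : V -> R^o) (c : R) : linear l -> 0 <= c ->
  (forall x, l x <= c * `|x|) ->
  exists2 f : dual V, (forall x, f x = l x) & `|f| <= c.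
Proof.
move=> ll c0 lc.
pose L : {linear V -> R^o} := HB.pack l (GRing.isLinear.Build _ _ _ _ l ll).
have lN x : l (- x) = - l x by rewrite -[l]/(L : V -> R^o) linearN.
have lc' x : `|l x| <= c * `|x|.
  by rewrite ler_norml lc andbT lerNl -lN -normrN lc.
have cL : continuous (L : V -> R^o).
  apply/linear_bounded_continuous/bounded_funP => r; exists (c * r) => x xr.
  by apply: (le_trans (lc' x)); rewrite ler_wpM2l.
exists (mk_dual ll cL) => //; apply: dual_norm_le => x x1.
by apply: (le_trans (lc' x)); rewrite ler_piMr.
Qed.

Lemma dualNE f x : (- f) x = - f x. Proof. by []. Qed.
Lemma dualBE f g x : (f - g) x = f x - g x. Proof. by []. Qed.

Lemma normr_dual f x : `|f x| <= `|f| * `|x|.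
Proof. exact: dual_normP. Qed.

Lemma le_dual_norm f x : f x <= `|f| * `|x|.
Proof. exact: le_trans (ler_norm _) (dual_normP _ _). Qed.

Lemma ge_dual_norm f x : - (`|f| * `|x|) <= f x.
Proof. by have := dual_normP f x; rewrite ler_norml => /andP[]. Qed.

Lemma dual_norm_le_lin f c : 0 <= c -> (forall x, f x <= c * `|x|) -> `|f| <= c.
Proof.
move=> c0 fc; apply: dual_norm_le => x x1; apply: (@le_trans _ _ (c * `|x|)).
  by rewrite ler_norml fc andbT lerNl -(linearN f) -normrN fc.
by rewrite ler_piMr.
Qed.

End dual_facts.

Section dual_extension.
Context {R : realType} {V : normedModType R}.

Lemma norm_attaining (x : V) : exists2 f : dual V, `|f| <= 1 & f x = `|x|.
Proof.
pose S := [set a : V * R | exists2 t, 0 <= t & a = (t *: x, t * `|x|)].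
have [| | | | |l [ll lp lS]] := @hahn_banach R V (fun x => `|x|) S.
- by split=> [y z|t y t0]; rewrite ?ler_normD// normrZ gtr0_norm.
- by exists 0; rewrite // scale0r mul0r.
- move=> _ _ [s s0 ->] [t t0 ->]; exists (s + t) => /=; first exact: addr_ge0.
  by rewrite scalerDl mulrDl.
- move=> t _ t0 [s s0 ->]; exists (t * s) => /=; first by rewrite mulr_ge0// ltW.
  by rewrite scalerA mulrA.
- by move=> _ [t t0 ->] /=; rewrite normrZ ger0_norm.
have [//|y|f fl f1] := exists_dual ll (c := 1); first by rewrite mul1r.
exists f => //; rewrite fl; apply/le_anti/andP; split=> //.
by apply: (lS (x, `|x|)); exists 1 => //; rewrite scale1r mul1r.
Qed.

Lemma exists_dual_extension (L : submodClosed V) (v : dual (subspace_type L)) :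
  exists2 f : dual V, (forall x, f (val x) = v x) & `|f| <= `|v|.
Proof.
pose S := [set a : V * R | exists x, a = (val x, v x)].
have [| | | | |l [ll lp lS]] := @hahn_banach R V (fun x => `|v| * `|x|) S.
- split=> [y z|t y t0]; first by rewrite -mulrDr ler_wpM2l// ler_normD.
  by rewrite normrZ gtr0_norm// mulrCA.
- by exists 0; congr pair; rewrite linear0.
- by move=> _ _ [s ->] [t ->]; exists (s + t); congr pair; rewrite linearD.
- by move=> t _ t0 [s ->]; exists (t *: s); congr pair; rewrite linearZ.
- by move=> _ [x ->] /=; exact: le_dual_norm.
have [f fl f1] := exists_dual ll (normr_ge0 v) lp.
exists f => // x; apply/le_anti/andP; split.
  rewrite -lerN2 -!linearN/= fl.
  by apply: (lS (- val x, v (- x))); exists (- x).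
by rewrite fl; apply: (lS (val x, v x)); exists x.
Qed.

(* Banach-Alaoglu, phrased with a filter base instead of a topology. *)
Lemma weak_star_cluster (I : Type) (D : set I) (S : I -> set (dual V)) (M : R) :
  D !=set0 ->
  (forall i j, D i -> D j -> exists2 k, D k & S k `<=` S i `&` S j) ->
  (forall i, D i -> S i !=set0) ->
  (forall i f, D i -> S i f -> `|f| <= M) ->
  exists2 f : dual V, `|f| <= M &
    forall (s : seq V) (d : R) i, 0 < d -> D i ->
      exists2 g, S i g & forall x, x \in s -> `|g x - f x| < d.
Proof.
move=> D0 SI S0 SM; set F := filter_from D S.
have FF : ProperFilter F.
  by apply: filter_from_proper => //; exact: filter_from_filter.
have [G [GU FG]] := ultraFilterLemma FF.
have GB : G [set f | `|f| <= M].
  by apply: FG; case: D0 => i Di; exists i => // f; exact: SM.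
have [f0 f0M] := filter_ex GB.
have M0 : 0 <= M by exact: le_trans f0M.
(* Evaluation at [x] sends the ultrafilter into a compact interval, where a cluster point of an
   ultrafilter is a limit. *)
have lim_ex x : exists r : R, forall d, 0 < d -> G [set f | `|f x - r| < d].
  pose Gx := [set A : set R | G [set f : dual V | A (f x)]].
  have GxF : ProperFilter Gx.
    split; first exact: filter_not_empty.
    by split=> [|A B|A B AB]; [exact: filterT|exact: filterI|exact: filterS].
  have := @segment_compact R (- (M * `|x|)) (M * `|x|).
  move=> /(_ Gx GxF)[|r [_ rG]].
    apply: (filterS (F := G) _ GB) => f fM /=; rewrite in_itv/= -ler_norml.
    by apply: (le_trans (dual_normP _ _)); rewrite ler_wpM2r.
  exists r => d d0.
  have [//|Gn] := in_ultra_setVsetC [set f : dual V | `|f x - r| < d] GU.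
  have [y [/= yn]] := rG _ _ (Gn : Gx (~` [set y | `|y - r| < d]))
    (nbhsx_ballx r d d0).
  by rewrite /ball/= distrC.
have [l lG] := choice lim_ex.
have near_l (s : seq V) d : 0 < d ->
    G [set f | forall x, x \in s -> `|f x - l x| < d].
  move=> d0; elim: s => [|a s IH]; first exact: filterS filterT.
  by apply: filterS (filterI (lG a d d0) IH) => f [fa fs] x;
    rewrite inE => /orP[/eqP ->//|]; exact: fs.
have ll : linear (l : V -> R^o).
  move=> a x y; apply/eqP; rewrite -subr_eq0 -normr_le0; apply/ler_addgt0Pl => e e0.
  rewrite addr0; set d := e / (`|a| + 2).
  have a2 : 0 < `|a| + 2 by rewrite ltr_wpDl.
  have d0 : 0 < d by rewrite divr_gt0.
  have [f fl] := filter_ex (near_l [:: a *: x + y; x; y] d d0).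
  have := fl (a *: x + y); have := fl x; have := fl y.
  rewrite !inE !eqxx !orbT => /(_ isT) fy /(_ isT) fx /(_ isT).
  rewrite linearP => fxy.
  have -> : l (a *: x + y) - (a *: l x + l y) =
      - ((a *: f x + f y) - l (a *: x + y)) + a * (f x - l x) + (f y - l y).
    by rewrite /GRing.scale/=; ring.
  rewrite (le_trans (ler_normD _ _))// (le_trans (lerD (ler_normD _ _) (lexx _)))//.
  rewrite normrN normrM.
  have -> : e = d + `|a| * d + d by rewrite /d; field; rewrite gt_eqF.
  by rewrite !lerD// ?ler_wpM2l// ltW.
have lM x : l x <= M * `|x|.
  apply/ler_addgt0Pl => e e0.
  have [f [/= fM]] := filter_ex (filterI GB (lG x e e0)).
  rewrite ltr_norml => /andP[+ _] => fl.
  have := le_dual_norm f x; have : `|f| * `|x| <= M * `|x| by rewrite ler_wpM2r.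
  lra.
have [f fl fM] := exists_dual ll M0 lM.
exists f => // s d i d0 Di.
have Gi : G (S i) by apply: FG; exists i.
have [g [Sg gs]] := filter_ex (filterI Gi (near_l s d d0)).
by exists g => // x xs; rewrite fl; exact: gs.
Qed.

End dual_extension.

(** * The Borwein-Preiss variational principle *)

Section sequences_facts.
Context {R : realType}.
Implicit Types (V : normedModType R).

Lemma half_gt0 : 0 < 2^-1 :> R. Proof. lra. Qed.

Lemma half_exp_gt0 k : 0 < 2^-1 ^+ k :> R.
Proof. by rewrite exprn_gt0// half_gt0. Qed.

Lemma half_exp_lt (a e : R) : 0 < e ->
  exists N, forall n, (N <= n)%N -> a * 2^-1 ^+ n < e.
Proof.
move=> e0; have h1 : `|2^-1 : R| < 1 by rewrite gtr0_norm ?half_gt0//; lra.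
have [N _ Nn] := cvgr0_norm_lt (FF := eventually_filter) _ (cvg_geometric a h1) _ e0.
by exists N => n /Nn /=; apply: le_lt_trans; exact: ler_norm.
Qed.

Lemma sum_half_exp n : \sum_(k < n) 2^-1 ^+ k = 2 - 2 * 2^-1 ^+ n :> R.
Proof.
elim: n => [|n IH]; first by rewrite big_ord0 expr0; lra.
by rewrite big_ord_recr/= IH exprS; lra.
Qed.

Lemma sum_half_exp_le n : \sum_(k < n) 2^-1 ^+ k <= 2 :> R.
Proof. by rewrite sum_half_exp; have := half_exp_gt0 n; lra. Qed.

Lemma geometric_dist V (u : nat -> V) (r : R) :
  (forall k, `|u k.+1 - u k| <= r * 2^-1 ^+ k) ->
  forall k n, (k <= n)%N -> `|u n - u k| <= 2 * r * 2^-1 ^+ k.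
Proof.
move=> ur k n kn.
have r0 : 0 <= r by have := ur 0%N; rewrite expr0 mulr1; apply: le_trans.
(* The tail at [n] is subtracted so that the induction closes. *)
suff : `|u n - u k| <= 2 * r * 2^-1 ^+ k - 2 * r * 2^-1 ^+ n.
  by move/le_trans; apply; rewrite gerBl !mulr_ge0// ltW ?half_exp_gt0.
elim: n kn => [|n IH]; first by rewrite leqn0 => /eqP ->; rewrite !subrr normr0.
rewrite leq_eqVlt => /orP[/eqP ->|]; first by rewrite !subrr normr0.
rewrite ltnS => /IH kn; rewrite -(subrK (u n) (u n.+1)) -addrA.
apply: (le_trans (ler_normD _ _)); rewrite exprS.
by have := ur n; lra.
Qed.

Lemma cvg_le V (u : nat -> V) (x : V) (f : V -> R) (a : R) (N : nat) :
  u n @[n --> \oo] --> x -> {for x, continuous f} ->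
  (forall n, (N <= n)%N -> f (u n) <= a) -> f x <= a.
Proof.
move=> ux fx fa.
apply: (closed_cvg (F := \oo) (u_ := f \o u) [set y | y <= a]).
- exact: closed_le.
- by exists N.
- exact: (cvg_comp _ _ ux fx).
Qed.

Lemma continuous_dist V (a : V) : continuous (fun x => `|x - a|).
Proof.
by move=> x; apply: cvg_norm; apply: cvgB; [exact: cvg_id|exact: cvg_cst].
Qed.

Lemma cvg_near_lt V (u : nat -> V) (x : V) (e : R) : u n @[n --> \oo] --> x ->
  0 < e -> exists N, forall n, (N <= n)%N -> `|u n - x| < e.
Proof.
move=> /cvgrPdist_lt ux e0; have [N _ Nn] := ux e e0.
by exists N => n /Nn /=; rewrite distrC.
Qed.

Lemma geometric_cvg (V : completeNormedModType R) (u : nat -> V) (r : R) :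
  (forall k, `|u k.+1 - u k| <= r * 2^-1 ^+ k) ->
  exists x : V, u n @[n --> \oo] --> x.
Proof.
move=> ur; exists (lim (u n @[n --> \oo])); apply: cauchy_cvg.
apply: cauchy_exP => e e0.
have [N NP] := half_exp_lt (2 * r) e0.
exists (u N); exists N => // n Nn /=.
rewrite -ball_normE/= distrC; apply: le_lt_trans (NP N (leqnn _)).
exact: geometric_dist.
Qed.

End sequences_facts.

Section variational_principle.
Context {R : realType} {E : normedModType R}.
Variables (S : set E) (phi gam : E -> R) (c r : R) (u0 : E).
Hypothesis c0 : 0 < c.
Hypothesis r0 : 0 < r.
Hypothesis Su0 : S u0.
Hypothesis phi_ge0 : forall u, 0 <= phi u.
Hypothesis phi_cont : continuous phi.
Hypothesis gam0 : gam 0 = 0.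
Hypothesis gam_ge0 : forall u, 0 <= gam u.
Hypothesis gam_cont : continuous gam.
Hypothesis gam_modulus : forall d, 0 < d ->
  exists2 m, 0 < m & forall u, gam u <= m -> `|u| <= d.
(** The first step has tolerance [phi u0], which cannot be shrunk, so the bound on its length is a
    hypothesis relating [c], [r] and [phi u0]. *)
Hypothesis gam_first : forall u, c * gam u <= phi u0 -> `|u| <= r.
Hypothesis S_complete : forall u : nat -> E, (forall n, S (u n)) ->
  (forall k, `|u k.+1 - u k| <= r * 2^-1 ^+ k) ->
  exists2 x : E, S x & u n @[n --> \oo] --> x.

(** The demand [psi y <= psi x] makes the values along the iteration decrease, which later carries
    the inequality to the limit point. *)
Let near_minimizer (psi : E -> R) x t : (forall u, 0 <= psi u) -> S x -> 0 < t ->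
  exists y, [/\ S y, psi y <= psi x & forall u, S u -> psi y <= psi u + t].
Proof.
move=> psi0 Sx t0.
have hi : has_inf (psi @` S).
  by split; [exists (psi x), x|exists 0 => _ [u _ <-]].
have [_ [y Sy <-] yt] := inf_adherent t0 hi.
have ymin u : S u -> psi y <= psi u + t.
  move=> Su; apply: (le_trans (ltW yt)); rewrite lerD2r.
  by apply: ge_inf; [case: hi|exists u].
have [yx|xy] := leP (psi y) (psi x); first by exists y.
exists x; split=> // u Su; exact: le_trans (ltW xy) (ymin u Su).
Qed.

(* Perturbing by a series of translates of one function keeps the perturbation
   as smooth as [gam]; only its partial sums appear, up to an error [t]. *)
Lemma borwein_preiss : exists (x : nat -> E) (xbar : E) (t : nat -> R),
  [/\ S xbar, forall k, `|xbar - x k| <= 2 * r, `|xbar - u0| <= 2 * r,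
    forall n, (0 < n)%N -> t n <= 2^-1 ^+ n &
    forall n u, S u -> phi xbar + c * \sum_(k < n) 2^-1 ^+ k * gam (xbar - x k)
      <= phi u + c * (\sum_(k < n) 2^-1 ^+ k * gam (u - x k)) + t n].
Proof.
have /choice[m mP] : forall k, exists m, 0 < m /\
    forall u, gam u <= m -> `|u| <= r * 2^-1 ^+ k.
  move=> k; have [|m m0 mP] := @gam_modulus (r * 2^-1 ^+ k).
    by rewrite mulr_gt0// half_exp_gt0.
  by exists m.
(* Since [phi] is nonnegative, [u0] is a minimizer up to [phi u0]. Afterwards the tolerance
   [c * 2^-1 ^+ k * m k] forces the next step to have length at most [r * 2^-1 ^+ k]. *)
pose t k := if k is 0 then phi u0 else
  Num.min (c * 2^-1 ^+ k * m k) (2^-1 ^+ k).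
have t0 k : (0 < k)%N -> 0 < t k.
  case: k => // k _; rewrite /t lt_min half_exp_gt0 andbT.
  by rewrite !mulr_gt0// ?half_exp_gt0//; case: (mP k.+1).
have /choice[nxt nxtP] : forall a : (E -> R) * E * R, exists y,
    (forall u, 0 <= a.1.1 u) -> S a.1.2 -> 0 < a.2 ->
    [/\ S y, a.1.1 y <= a.1.1 a.1.2 & forall u, S u -> a.1.1 y <= a.1.1 u + a.2].
  move=> [[psi x] s] /=.
  have [[p1 p2 p3]|h] := pselect [/\ forall u, 0 <= psi u, S x & 0 < s].
    by have [y yP] := near_minimizer p1 p2 p3; exists y.
  by exists x => p1 p2 p3; exfalso; apply: h.
pose upd k (a : (E -> R) * E) : (E -> R) :=
  fun u => a.1 u + c * (2^-1 ^+ k * gam (u - a.2)).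
pose st := fix st k : (E -> R) * E := if k is k'.+1 then
   (upd k' (st k'), nxt (upd k' (st k'), (st k').2, t k)) else (phi, u0).
pose x k := (st k).2.
pose psi k := (st k).1.
have psiS k u : psi k.+1 u = psi k u + c * (2^-1 ^+ k * gam (u - x k)) by [].
have psiE k u : psi k u = phi u + c * \sum_(i < k) 2^-1 ^+ i * gam (u - x i).
  elim: k => [|k IH]; first by rewrite big_ord0 mulr0 addr0.
  by rewrite psiS IH big_ord_recr/= mulrDr addrA.
have psi_mono k u : psi k u <= psi k.+1 u.
  by rewrite psiS lerDl !mulr_ge0// ltW// half_exp_gt0.
have psi0 k u : 0 <= psi k u.
  elim: k => [|k IH]; first exact: phi_ge0.
  exact: le_trans IH (psi_mono _ _).
have step k : S (x k) -> [/\ S (x k.+1), psi k.+1 (x k.+1) <= psi k.+1 (x k) &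
    forall u, S u -> psi k.+1 (x k.+1) <= psi k.+1 u + t k.+1].
  move=> Sk; apply: (nxtP (psi k.+1, x k, t k.+1)) => //; last exact: t0.
  exact: psi0.
have Sx k : S (x k) by elim: k => // k /step[].
have xmin k u : S u -> psi k (x k) <= psi k u + t k.
  case: k => [Su|k Su]; first by rewrite /psi /x /= lerDr phi_ge0.
  by have [_ _] := step k (Sx k); apply.
have xdec k : psi k.+1 (x k.+1) <= psi k (x k).
  have [_ + _] := step k (Sx k); move=> /le_trans; apply.
  by rewrite psiS subrr gam0 !mulr0 addr0.
have xstep k : `|x k.+1 - x k| <= r * 2^-1 ^+ k.
  have h : c * (2^-1 ^+ k * gam (x k.+1 - x k)) <= t k.
    have := xdec k; rewrite psiS; have := xmin k _ (Sx k.+1); lra.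
  case: k h => [|k] h; first by rewrite expr0 mulr1; apply: gam_first;
    move: h; rewrite expr0 mul1r.
  apply: (mP k.+1).2; move: h; rewrite /t le_min => /andP[+ _].
  by rewrite -mulrA ler_pM2l// ler_pM2l// half_exp_gt0.
have [xbar Sxbar xcvg] := S_complete Sx xstep.
have psi_cont k : continuous (psi k).
  elim: k => [|k IH] u; first exact: phi_cont.
  apply: cvgD; first exact: IH.
  apply: cvgM; first exact: cvg_cst.
  apply: cvgM; first exact: cvg_cst.
  apply: (@continuous_comp _ _ _ (fun u => u - x k) gam); last exact: gam_cont.
  by apply: cvgB; [exact: cvg_id|exact: cvg_cst].
have xdec' k n : (k <= n)%N -> psi n (x n) <= psi k (x k).
  move=> kn; rewrite -(subnK kn); elim: (n - k)%N => // j IH.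
  by rewrite addSn; exact: le_trans (xdec _) IH.
have psi_mono' k n u : (k <= n)%N -> psi k u <= psi n u.
  move=> kn; rewrite -(subnK kn); elim: (n - k)%N => // j IH.
  by rewrite addSn; exact: le_trans IH (psi_mono _ _).
have dist_bar k : `|xbar - x k| <= 2 * r.
  apply: (@cvg_le _ _ x xbar (fun y => `|y - x k|) _ k) => //.
    exact: continuous_dist.
  move=> n kn; apply: (le_trans (geometric_dist xstep kn)).
  rewrite ler_piMr// ?mulr_ge0// ?(ltW r0)// exprn_ile1// ?(ltW half_gt0)//.
  lra.
exists x, xbar, t; split=> //; first exact: (dist_bar 0%N).
  by case=> // n _; rewrite /t ge_min lexx orbT.
(* For [j >= n] one has [psi n (x j) <= psi j (x j) <= psi n (x n)]; let [j] tend to infinity. *)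
move=> n u Su; rewrite -!psiE; apply: le_trans (xmin n u Su).
apply: (@cvg_le _ _ x xbar (psi n) _ n) => //; first exact: psi_cont.
by move=> j nj; exact: le_trans (psi_mono' _ _ _ nj) (xdec' _ _ nj).
Qed.

End variational_principle.

(** * Separation with Clarke normals *)

Section product_norm.
Context {R : realType} {X Y : normedModType R}.
Implicit Types p : X * Y.

Lemma prod_norm p : `|p| = Num.max `|p.1| `|p.2|. Proof. by []. Qed.

Lemma prod_norm_fst p : `|p.1| <= `|p|.
Proof. by rewrite prod_norm le_max lexx. Qed.

Lemma prod_norm_snd p : `|p.2| <= `|p|.
Proof. by rewrite prod_norm le_max lexx orbT. Qed.

Lemma prod_norm_le p c : `|p.1| <= c -> `|p.2| <= c -> `|p| <= c.
Proof. by move=> h1 h2; rewrite prod_norm ge_max h1. Qed.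

Lemma cvg_prod (u : nat -> X * Y) p :
  (u n).1 @[n --> \oo] --> p.1 -> (u n).2 @[n --> \oo] --> p.2 ->
  u n @[n --> \oo] --> p.
Proof.
move=> u1 u2; have -> : u = fun n => ((u n).1, (u n).2).
  by apply/funext => n; case: (u n).
by case: p u1 u2 => a b; exact: cvg_pair.
Qed.

End product_norm.

Section separation.
Context {R : realType}.

(* Sequential completeness, which also makes sense for products and subspaces,
   where no completeNormedModType instance is available. *)
Definition geometric_complete (Z : normedModType R) :=
  forall (u : nat -> Z) (r : R), (forall k, `|u k.+1 - u k| <= r * 2^-1 ^+ k) ->
  exists x : Z, u n @[n --> \oo] --> x.

Lemma geometric_complete_prod (X Y : normedModType R) :
  geometric_complete X -> geometric_complete Y ->
  geometric_complete (X * Y)%type.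
Proof.
move=> cX cY u r ur.
have [|x xP] := cX (fst \o u) r.
  by move=> k; apply: le_trans (ur k); exact: (prod_norm_fst (u k.+1 - u k)).
have [|y yP] := cY (snd \o u) r.
  by move=> k; apply: le_trans (ur k); exact: (prod_norm_snd (u k.+1 - u k)).
by exists (x, y); exact: cvg_prod.
Qed.

Lemma closed_cvg_seq (Z : normedModType R) (A : set Z) (u : nat -> Z) (x : Z) :
  closed A -> (forall n, A (u n)) -> u n @[n --> \oo] --> x -> A x.
Proof. by move=> cA Au; apply: (closed_cvg A) => //; exists 0%N. Qed.

(* The quantitative core of the extremal principle, for a normal cone [N]. *)
Definition separation_property (Z : normedModType R)
    (N : set Z -> Z -> set (dual Z)) :=
  exists K kappa : R, [/\ 0 < K, 0 < kappa &
    forall (A1 A2 : set Z) (eps rho : R) (z1 z2 a1 a2 : Z),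
      closed A1 -> closed A2 -> 0 < eps < 1/4 -> 0 < rho ->
      A1 a1 -> A2 a2 -> `|a1 - z1| < eps * rho -> `|a2 - z2| < eps * rho ->
      (forall w, `|w| < rho -> A1 (z1 + w) -> A2 (z2 + w) -> False) ->
    exists (u1 u2 : Z) (f1 f2 : dual Z),
      [/\ N A1 u1 f1, N A2 u2 f2, `|u1 - z1| <= rho /\ `|u2 - z2| <= rho,
          `|f1 + f2| <= K * eps & kappa - K * eps <= `|f1|]].

End separation.

(** * The directional derivative of the norm *)

Section norm_slope.
Context {R : realType} {V : normedModType R} (c : V).

Definition norm_quotient (t : R) (h : V) := (`|c + t *: h| - `|c|) / t.

(** The one-sided directional derivative of the norm at [c]. By convexity the difference quotients
    are monotone in [t], so an infimum replaces the limit. *)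
Definition norm_slope h := inf [set norm_quotient t h | t in [set t | 0 < t]].

Lemma norm_quotient_geN t h : 0 < t -> - `|h| <= norm_quotient t h.
Proof.
move=> t0; rewrite /norm_quotient ler_pdivlMr//.
have := ler_normB (c + t *: h) (t *: h).
by rewrite addrK [`|t *: h|]normrZ gtr0_norm//; lra.
Qed.

Lemma norm_quotient_le t h : 0 < t -> norm_quotient t h <= `|h|.
Proof.
move=> t0; rewrite /norm_quotient ler_pdivrMr//.
have := ler_normD c (t *: h); rewrite [`|t *: h|]normrZ gtr0_norm//; lra.
Qed.

Lemma norm_quotientD t h k : 0 < t ->
  norm_quotient t (h + k) <= norm_quotient t h + `|k|.
Proof.
move=> t0; rewrite /norm_quotient ler_pdivrMr// mulrDl divfK ?gt_eqF//.
have := ler_normD (c + t *: h) (t *: k).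
by rewrite scalerDr addrA [`|t *: k|]normrZ gtr0_norm//; lra.
Qed.

(** With step [s * t / (s + t)], the point in direction [h + k] is the convex combination of
    [c + s *: h] and [c + t *: k] with weights [t / (s + t)] and [s / (s + t)]. *)
Lemma norm_quotient_sum s t h k : 0 < s -> 0 < t ->
  norm_quotient (s * t / (s + t)) (h + k) <=
  norm_quotient s h + norm_quotient t k.
Proof.
move=> s0 t0; have st0 : 0 < s + t by exact: addr_gt0.
have stn : s + t != 0 by rewrite gt_eqF.
have -> : norm_quotient s h + norm_quotient t k =
   (t / (s + t) * `|c + s *: h| + s / (s + t) * `|c + t *: k| - `|c|)
     / (s * t / (s + t)).
  rewrite /norm_quotient; field; rewrite stn !gt_eqF//.
rewrite /norm_quotient ler_pM2r ?invr_gt0 ?divr_gt0 ?mulr_gt0//.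
rewrite lerD2r.
have -> : c + (s * t / (s + t)) *: (h + k) =
   (t / (s + t)) *: (c + s *: h) + (s / (s + t)) *: (c + t *: k).
  rewrite !scalerDr !scalerA addrACA -scalerDl.
  have -> : t / (s + t) + s / (s + t) = 1 by field.
  rewrite scale1r; congr (_ + (_ *: _ + _ *: _)); field => //.
apply: (le_trans (ler_normD _ _)).
by rewrite !normrZ !gtr0_norm ?mulr_gt0 ?invr_gt0.
Qed.

(** Triangle inequality in [t *: (c + s *: h) = s *: (c + t *: h) + (t - s) *: c]. *)
Lemma norm_quotient_mono s t h : 0 < s -> s <= t ->
  norm_quotient s h <= norm_quotient t h.
Proof.
move=> s0 st; have t0 : 0 < t by exact: lt_le_trans st.
rewrite /norm_quotient ler_pdivrMr// mulrAC ler_pdivlMr//.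
have -> : t = s + (t - s) by ring.
set d := t - s; have d0 : 0 <= d by rewrite subr_ge0.
have : `|(s + d) *: (c + s *: h)| <= `|s *: (c + (s + d) *: h)| + `|d *: c|.
  apply: le_trans (ler_normD _ _); rewrite le_eqVlt; apply/orP; left.
  apply/eqP; congr `| _ |; rewrite !scalerDr !scalerA scalerDl.
  by rewrite addrAC (mulrC s).
rewrite !normrZ (ger0_norm d0) !gtr0_norm ?ltr_wpDr//; nra.
Qed.

Let ne h : [set norm_quotient t h | t in [set t | 0 < t]] !=set0.
Proof. by exists (norm_quotient 1 h), 1 => //=. Qed.

Let lb h : has_lbound [set norm_quotient t h | t in [set t | 0 < t]].
Proof. by exists (- `|h|) => _ [t t0 <-]; exact: norm_quotient_geN. Qed.

Lemma norm_slope_le t h : 0 < t -> norm_slope h <= norm_quotient t h.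
Proof. by move=> t0; apply: ge_inf => //; exists t. Qed.

Lemma norm_slope_le_norm h : norm_slope h <= `|h|.
Proof.
exact: le_trans (norm_slope_le h ltr01) (norm_quotient_le h ltr01).
Qed.

Lemma norm_slope0 : norm_slope 0 = 0.
Proof.
apply/le_anti/andP; split; first by rewrite -[leRHS](@normr0 _ V) norm_slope_le_norm.
apply: lb_le_inf => // _ [t t0 <-]; rewrite -oppr0 -[X in - X](@normr0 _ V).
exact: norm_quotient_geN.
Qed.

Lemma norm_slopeN : norm_slope (- c) = - `|c|.
Proof.
apply/le_anti/andP; split; last first.
  by apply: lb_le_inf => // _ [t t0 <-]; rewrite -normrN norm_quotient_geN.
apply: (le_trans (norm_slope_le _ (ltr01))).
by rewrite /norm_quotient scale1r subrr normr0 divr1 sub0r.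
Qed.

Lemma norm_slope_sublinear : sublinear norm_slope.
Proof.
split=> [h k|t h t0].
  apply: lb_le_infD => // _ _ [s s0 <-] [t t0 <-].
  apply: le_trans (norm_quotient_sum h k s0 t0).
  by apply: norm_slope_le; rewrite divr_gt0 ?mulr_gt0 ?addr_gt0.
rewrite -ler_pdivrMl//; apply: lb_le_inf => // _ [s s0 <-].
rewrite ler_pdivrMl//; apply: (le_trans (norm_slope_le _ (divr_gt0 s0 t0))).
rewrite /norm_quotient scalerA divfK ?gt_eqF// le_eqVlt; apply/orP; left.
by apply/eqP; field; rewrite !gt_eqF.
Qed.

End norm_slope.

Section clarke_tangent_cone.
Context {R : realType} {V : normedModType R} (S : set V) (z : V).

Lemma clarke_tangent0 : clarke_tangent S z 0.
Proof.
move=> u t Su uz t0 tz; exists (fun=> 0); first exact: cvg_cst.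
by move=> k; rewrite scaler0 addr0.
Qed.

Lemma clarke_tangentZ a w : 0 < a -> clarke_tangent S z w ->
  clarke_tangent S z (a *: w).
Proof.
move=> a0 Tw u t Su uz t0 tz.
have [| |w_ wc ws] := Tw u (fun k => t k * a) Su uz.
- by move=> k; rewrite mulr_gt0.
- by rewrite -(mul0r a); apply: cvgM => //; exact: cvg_cst.
exists (fun k => a *: w_ k); first exact: cvgZl_tmp.
by move=> k; rewrite scalerA; exact: ws.
Qed.

(** Here the moving base points of the Clarke cone matter: after a step along [w1] the points still
    lie in [S] and tend to [z], so the definition for [w2] applies to them. *)
Lemma clarke_tangentD w1 w2 : clarke_tangent S z w1 -> clarke_tangent S z w2 ->
  clarke_tangent S z (w1 + w2).
Proof.
move=> T1 T2 u t Su uz t0 tz.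
have [a ac aS] := T1 u t Su uz t0 tz.
have [|b bc bS] := T2 (fun k => u k + t k *: a k) t aS _ t0 tz.
  rewrite -[z]addr0 -(scale0r w1); apply: cvgD => //; exact: cvgZ.
exists (fun k => a k + b k); first exact: cvgD.
by move=> k; rewrite scalerDr addrA.
Qed.

End clarke_tangent_cone.

Section clarke_separation.
Context {R : realType} {Z : normedModType R}.
Hypothesis Z_complete : geometric_complete Z.

(* Ekeland's principle on [A1 * A2], for a function measuring how far the
   translated sets are from meeting. *)
Lemma ekeland_separation (A1 A2 : set Z) (eps rho : R) (z1 z2 a1 a2 : Z) :
  closed A1 -> closed A2 -> 0 < eps < 1/4 -> 0 < rho ->
  A1 a1 -> A2 a2 -> `|a1 - z1| < eps * rho -> `|a2 - z2| < eps * rho ->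
  (forall w, `|w| < rho -> A1 (z1 + w) -> A2 (z2 + w) -> False) ->
  exists u1 u2, [/\ A1 u1 /\ A2 u2, `|u1 - z1| <= rho /\ `|u2 - z2| <= rho,
    u1 - z1 - (u2 - z2) != 0 &
    forall v1 v2, A1 v1 -> A2 v2 -> `|u1 - z1 - (u2 - z2)| <=
      `|v1 - z1 - (v2 - z2)| + 32 * eps * `|(v1 - u1, v2 - u2)|].
Proof.
move=> cA1 cA2 /andP[e0 e4] r0 Aa1 Aa2 az1 az2 sep.
pose phi (u : Z * Z) := `|u.1 - z1 - (u.2 - z2)|.
(* The initial value of [phi] is below [2 * eps * rho = 16 * eps * r], so with [c = 16 * eps] the
   first step is at most [r]; the total move [2 * r] plus [eps * rho] stays below [rho]. The final
   slope is [32 * eps] as the weights sum to at most 2. *)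
pose r := rho / 8.
have phic : continuous phi.
  move=> u; apply: cvg_norm; apply: cvgB; apply: cvgB; try exact: cvg_cst.
    exact: cvg_fst.
  exact: cvg_snd.
have phi0 : phi (a1, a2) < 2 * eps * rho.
  apply: (le_lt_trans (ler_normB _ _)); lra.
have [|||||||||||x [xbar [t [[S1 S2] xd xd0 t0 xmin]]]] :=
    @borwein_preiss R _ (A1 `*` A2) phi (fun u => `|u|) (16 * eps) r (a1, a2).
- lra.
- by rewrite divr_gt0.
- by [].
- by move=> u; exact: normr_ge0.
- exact: phic.
- exact: normr0.
- by move=> u; exact: normr_ge0.
- exact: norm_continuous.
- by move=> d d0; exists d.
- move=> u h; have : 16 * eps * `|u| < 16 * eps * r.
    by apply: (le_lt_trans h); apply: (lt_le_trans phi0); rewrite /r; lra.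
  by rewrite ltr_pM2l ?mulr_gt0// => /ltW.
- move=> u Su ur.
  have [y uy] := geometric_complete_prod Z_complete Z_complete ur.
  exists y => //; split.
    apply: (@closed_cvg_seq _ _ A1 (fst \o u)) => //; first by move=> n; case: (Su n).
    exact: (cvg_comp _ _ uy cvg_fst).
  apply: (@closed_cvg_seq _ _ A2 (snd \o u)) => //; first by move=> n; case: (Su n).
  exact: (cvg_comp _ _ uy cvg_snd).
move: xbar S1 S2 xd xd0 xmin => [u1 u2] /= S1 S2 xd xd0 xmin.
have erho : eps * rho < rho / 4 by rewrite mulrC ltr_pM2l//; lra.
have near1 : `|u1 - z1| < rho.
  have := ler_normD (u1 - a1) (a1 - z1); rewrite addrA subrK.
  by have := prod_norm_fst ((u1, u2) - (a1, a2)); move: xd0; rewrite /r/=; lra.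
have near2 : `|u2 - z2| < rho.
  have := ler_normD (u2 - a2) (a2 - z2); rewrite addrA subrK.
  by have := prod_norm_snd ((u1, u2) - (a1, a2)); move: xd0; rewrite /r/=; lra.
exists u1, u2; split=> //; first by rewrite !ltW.
  rewrite subr_eq0; apply/eqP => u12; apply: (sep (u1 - z1) near1).
    by rewrite addrC subrK.
  by rewrite u12 addrC subrK.
move=> v1 v2 Av1 Av2; apply/ler_addgt0Pl => e e0'.
have [N NP] := half_exp_lt 1 e0'.
have := xmin N.+1 (v1, v2) (conj Av1 Av2).
have := t0 N.+1 isT; have := NP N.+1 (leqnSn _); rewrite mul1r.
set D := `|(v1 - u1, v2 - u2)|.
suff : \sum_(k < N.+1) 2^-1 ^+ k * `|(v1, v2) - x k| <=
    \sum_(k < N.+1) 2^-1 ^+ k * `|(u1, u2) - x k| + 2 * D.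
  rewrite /phi/= => h; have : 16 * eps * (\sum_(k < N.+1) 2^-1 ^+ k * `|(v1, v2) - x k|) <=
    16 * eps * (\sum_(k < N.+1) 2^-1 ^+ k * `|(u1, u2) - x k| + 2 * D).
    by rewrite ler_wpM2l//; lra.
  lra.
apply: (@le_trans _ _ (\sum_(k < N.+1) (2^-1 ^+ k * `|(u1, u2) - x k| + 2^-1 ^+ k * D))).
  apply: ler_sum => k _; rewrite -mulrDr ler_wpM2l ?(ltW (half_exp_gt0 _))//.
  have -> : (v1, v2) - x k = ((u1, u2) - x k) + (v1 - u1, v2 - u2).
    by case: (x k) => p q; congr pair; rewrite /= [RHS]addrC addrA subrK.
  exact: ler_normD.
rewrite big_split/= lerD2l -mulr_suml; apply: ler_wpM2r.
  exact: normr_ge0.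
exact: sum_half_exp_le.
Qed.

(** First-order optimality: points of the sets realize the tangent vectors along steps tending to 0,
    and monotonicity of the quotients lifts the resulting bound to any fixed [t]. *)
Lemma clarke_descent (A1 A2 : set Z) u1 u2 c m w1 w2 : A1 u1 -> A2 u2 -> 0 <= m ->
  (forall v1 v2, A1 v1 -> A2 v2 ->
     `|c| <= `|c + (v1 - u1) - (v2 - u2)| + m * `|(v1 - u1, v2 - u2)|) ->
  clarke_tangent A1 u1 w1 -> clarke_tangent A2 u2 w2 ->
  0 <= norm_slope c (w1 - w2) + m * `|(w1, w2)|.
Proof.
move=> Au1 Au2 m0 cmin T1 T2.
suff H t : 0 < t -> - (m * `|(w1, w2)|) <= norm_quotient c t (w1 - w2).
  rewrite addrC -[X in _ <= X + _]opprK addrC subr_ge0; apply: lb_le_inf.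
    by exists (norm_quotient c 1 (w1 - w2)), 1 => //=.
  by move=> _ [t t0 <-]; exact: H.
move=> t0; apply/ler_addgt0Pl => e e0.
have h0 := @half_gt0 R.
pose s k : R := t * 2^-1 ^+ k.
have s0 k : 0 < s k by rewrite mulr_gt0// half_exp_gt0.
have sc : s k @[k --> \oo] --> 0.
  by apply: cvg_geometric; rewrite gtr0_norm//; lra.
have [a ac aS] := T1 (fun=> u1) s (fun=> Au1) (cvg_cst _) s0 sc.
have [b bc bS] := T2 (fun=> u2) s (fun=> Au2) (cvg_cst _) s0 sc.
(* Replacing [a k] and [b k] by their limits costs [d] each in the quotient and [m * d] in the
   penalty. *)
pose d := e / (2 + m).
have d0 : 0 < d by rewrite divr_gt0// ltr_wpDr.
have [N1 N1P] := cvg_near_lt ac d0; have [N2 N2P] := cvg_near_lt bc d0.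
set k := maxn N1 N2.
have {N1P} ad : `|a k - w1| < d by apply: N1P; exact: leq_maxl.
have {N2P} bd : `|b k - w2| < d by apply: N2P; exact: leq_maxr.
have := cmin _ _ (aS k) (bS k).
have addK (p q : Z) : p + q - p = q by rewrite addrAC subrr add0r.
rewrite !addK.
have -> : (s k *: a k, s k *: b k) = s k *: (a k, b k) :> Z * Z by [].
rewrite normrZ (gtr0_norm (s0 k)) -addrA -scalerBr => h.
have : - (m * `|(a k, b k)|) <= norm_quotient c (s k) (a k - b k).
  rewrite /norm_quotient ler_pdivlMr//; lra.
have : norm_quotient c (s k) (a k - b k) <=
    norm_quotient c (s k) (w1 - w2) + (d + d).
  have -> : a k - b k = w1 - w2 + ((a k - w1) - (b k - w2)).
    by rewrite opprB addrACA addKr [w1 + _]addrC subrK.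
  apply: (le_trans (norm_quotientD _ _ _ (s0 k))); rewrite lerD2l.
  by apply: (le_trans (ler_normB _ _)); rewrite lerD// ltW.
have : norm_quotient c (s k) (w1 - w2) <= norm_quotient c t (w1 - w2).
  apply: norm_quotient_mono => //; rewrite ger_pMr//.
  by rewrite exprn_ile1//; lra.
have : m * `|(a k, b k)| <= m * `|(w1, w2)| + m * d.
  rewrite -mulrDr ler_wpM2l//.
  have -> : (a k, b k) = (w1, w2) + (a k - w1, b k - w2) :> Z * Z.
    by congr pair; rewrite /= addrC subrK.
  by apply: (le_trans (ler_normD _ _)); rewrite lerD2l prod_norm_le// ltW.
have -> : e = d + d + m * d by rewrite /d; field; rewrite gt_eqF// ltr_wpDr.
lra.
Qed.

(** A linear [L <= P] that is nonnegative on the tangent cones yields the normals [- L (., 0)] and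
    [- L (0, .)]. On diagonal directions the slope vanishes, which makes their sum small; in
    direction [(- c, 0)] the slope is [- |c|], which keeps the first one large. *)
Theorem clarke_separation : separation_property (@clarke_normal R Z).
Proof.
exists 64, 1; split; rewrite ?ltr01//.
move=> A1 A2 eps rho z1 z2 a1 a2 cA1 cA2 eP r0 Aa1 Aa2 az1 az2 sep.
have [u1 [u2 [[Au1 Au2] near cn0 cmin]]] :=
  ekeland_separation cA1 cA2 eP r0 Aa1 Aa2 az1 az2 sep.
have e0 : 0 < eps by case/andP: eP.
set c := u1 - z1 - (u2 - z2) in cn0 cmin.
pose m := 32 * eps.
have m0 : 0 <= m by rewrite mulr_ge0// ltW.
pose P (h : Z * Z) := norm_slope c (h.1 - h.2) + m * `|h|.
pose S := [set a : Z * Z * R |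
  [/\ clarke_tangent A1 u1 a.1.1, clarke_tangent A2 u2 a.1.2 & a.2 = 0]].
have sl := norm_slope_sublinear c.
have [| | | | |L [LL LP LS]] := @hahn_banach R _ P S.
- split=> [p q|t p t0]; rewrite /P.
    have := sl.1 (p.1 - p.2) (q.1 - q.2); have := ler_normD p q.
    rewrite addrACA -opprD -[p.1 + q.1]/((p + q).1) -[p.2 + q.2]/((p + q).2).
    by move=> /(ler_wpM2l m0); lra.
  have := sl.2 t (p.1 - p.2) t0; rewrite scalerBr normrZ gtr0_norm//=; lra.
- by split=> //; exact: clarke_tangent0.
- move=> p q [p1 p2 p3] [q1 q2 q3]; split=> /=; try exact: clarke_tangentD.
  by rewrite p3 q3 addr0.
- move=> t p t0 [p1 p2 p3]; split=> /=; try exact: clarke_tangentZ.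
  by rewrite p3 mulr0.
- move=> [[w1 w2] x] [/= p1 p2 ->]; apply: (clarke_descent Au1 Au2 m0 _ p1 p2).
  move=> v1 v2 Av1 Av2; have := cmin v1 v2 Av1 Av2.
  have sw (p q s : Z) : p - q + (s - p) = s - q by rewrite addrC addrA subrK.
  have -> // : v1 - z1 - (v2 - z2) = c + (v1 - u1) - (v2 - u2).
  by rewrite /c [X in _ = X - _]addrAC (sw u1) -[RHS]addrA -[X in _ = _ + X]opprD (sw u2).
pose LM : {linear (Z * Z)%type -> R^o} := HB.pack L (GRing.isLinear.Build _ _ _ _ L LL).
have Lopp h : L (- h) = - L h by rewrite -[L]/(LM : _ -> _) linearN.
have Ladd h k : L (h + k) = L h + L k by rewrite -[L]/(LM : _ -> _) linearD.
have sN h : norm_slope c h <= `|h| := norm_slope_le_norm c h.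
have m1 : 0 <= 1 + m by rewrite addr_ge0.
have [||f1 f1E f1N] := @exists_dual R Z (fun h => L (- h, 0)) (1 + m) _ m1.
- move=> a x y; rewrite -[RHS]LL; congr (L (_, _)) => /=.
    by rewrite opprD scalerN.
  by rewrite scaler0 addr0.
- move=> x; apply: (le_trans (LP _)); rewrite /P/= subr0 mulrDl mul1r lerD//.
    by rewrite -(normrN x).
  by rewrite ler_wpM2l// prod_norm_le/= ?normrN// normr0.
have [||f2 f2E f2N] := @exists_dual R Z (fun h => L (0, - h)) (1 + m) _ m1.
- move=> a x y; rewrite -[RHS]LL; congr (L (_, _)) => /=.
    by rewrite scaler0 addr0.
  by rewrite opprD scalerN.
- move=> x; apply: (le_trans (LP _)); rewrite /P/= opprK add0r mulrDl mul1r lerD//.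
  by rewrite ler_wpM2l// prod_norm_le/= ?normrN// normr0.
exists u1, u2, f1, f2; split=> //.
- split=> // w Tw; rewrite f1E.
  have := LS (w, 0, 0); rewrite /S/= => /(_ _)/wrap[].
    by split=> //; exact: clarke_tangent0.
  have -> : (- w, 0) = - (w, 0) :> Z * Z by congr pair; rewrite oppr0.
  by rewrite Lopp; lra.
- split=> // w Tw; rewrite f2E.
  have := LS (0, w, 0); rewrite /S/= => /(_ _)/wrap[].
    by split=> //; exact: clarke_tangent0.
  have -> : (0, - w) = - (0, w) :> Z * Z by congr pair; rewrite oppr0.
  by rewrite Lopp; lra.
- apply: dual_norm_le_lin; first by rewrite mulr_ge0// ltW.
  move=> x; rewrite dualDE f1E f2E -Ladd.
  have -> : (- x, 0) + (0, - x) = (- x, - x) :> Z * Z.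
    by congr pair; rewrite /= ?addr0 ?add0r.
  apply: (le_trans (LP _)); rewrite /P/= subrr norm_slope0 add0r /m.
  have : `|(- x, - x)| <= `|x| by rewrite prod_norm_le/= ?normrN.
  move=> /(ler_wpM2l m0) => h; apply: (le_trans h).
  by rewrite ler_wpM2r// /m; lra.
- have : L (- c, 0) <= - `|c| + m * `|c|.
    apply: (le_trans (LP _)); rewrite /P/= subr0 norm_slopeN lerD2l ler_wpM2l//.
    by rewrite prod_norm_le/= ?normrN// normr0.
  rewrite -f1E; have := ge_dual_norm f1 c => h1 h2.
  have : (1 - m) * `|c| <= `|f1| * `|c| by lra.
  rewrite ler_pM2r ?normr_gt0//; rewrite /m; lra.
Qed.

End clarke_separation.

(** * From separation to the two alternatives *)

Section dual_of_product.
Context {R : realType} {X Y : normedModType R}.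
Implicit Types (p : dual X) (q : dual Y).

Lemma dual_pairE p q u : dual_pair p q u = p u.1 + q u.2. Proof. by []. Qed.

Lemma dual_pair_surj (f : dual (X * Y)%type) : exists p q, f = dual_pair p q.
Proof.
have [||p pE _] := @exists_dual R X (fun x => f (x, 0)) `|f| _ (normr_ge0 _).
- by move=> a x y; rewrite -linearP; congr (f (_, _)); rewrite /= scaler0 addr0.
- move=> x; apply: (le_trans (le_dual_norm _ _)).
  by rewrite ler_wpM2l// prod_norm_le/= ?normr0.
have [||q qE _] := @exists_dual R Y (fun y => f (0, y)) `|f| _ (normr_ge0 _).
- by move=> a x y; rewrite -linearP; congr (f (_, _)); rewrite /= scaler0 addr0.
- move=> x; apply: (le_trans (le_dual_norm _ _)).
  by rewrite ler_wpM2l// prod_norm_le/= ?normr0.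
exists p, q; apply: dualP => -[x y]; rewrite dual_pairE pE qE -linearD.
by congr (f (_, _)); rewrite /= ?addr0 ?add0r.
Qed.

Lemma dual_pair_norm_fst p q : `|p| <= `|dual_pair p q|.
Proof.
apply: dual_norm_le_lin => // x.
have := le_dual_norm (dual_pair p q) (x, 0); rewrite dual_pairE/= linear0 addr0.
by move/le_trans; apply; rewrite ler_wpM2l// prod_norm_le/= ?normr0.
Qed.

Lemma dual_pair_norm_snd p q : `|q| <= `|dual_pair p q|.
Proof.
apply: dual_norm_le_lin => // y.
have := le_dual_norm (dual_pair p q) (0, y); rewrite dual_pairE/= linear0 add0r.
by move/le_trans; apply; rewrite ler_wpM2l// prod_norm_le/= ?normr0.
Qed.

Lemma dual_pair_norm_le p q : `|dual_pair p q| <= `|p| + `|q|.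
Proof.
apply: dual_norm_le_lin; first exact: addr_ge0.
move=> u; rewrite dual_pairE mulrDl lerD// (le_trans (le_dual_norm _ _))//.
  by rewrite ler_wpM2l// prod_norm_fst.
by rewrite ler_wpM2l// prod_norm_snd.
Qed.

Lemma dual_pairD p1 p2 q1 q2 :
  dual_pair p1 q1 + dual_pair p2 q2 = dual_pair (p1 + p2) (q1 + q2).
Proof. by apply: dualP => u; rewrite dualDE !dual_pairE !dualDE addrACA. Qed.

Lemma dual_pairZ a p q : a *: dual_pair p q = dual_pair (a *: p) (a *: q).
Proof. by apply: dualP => u; rewrite dualZE !dual_pairE !dualZE mulrDr. Qed.

End dual_of_product.

Lemma closed_setX (X Y : topologicalType) (A : set X) (B : set Y) :
  closed A -> closed B -> closed (A `*` B).
Proof.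
move=> cA cB; have -> : A `*` B = fst @^-1` A `&` snd @^-1` B by [].
by apply: closedI; apply: closed_comp => // p _; [exact: cvg_fst|exact: cvg_snd].
Qed.

Section dichotomy.
Context {R : realType} {X Y : normedModType R}.
(** The cones are parameters so that one argument covers Clarke and Frechet normals; the product
    only has to split in one direction. *)
Variables (NX : set X -> X -> set (dual X)) (NY : set Y -> Y -> set (dual Y)).
Variable NZ : set (X * Y) -> (X * Y)%type -> set (dual (X * Y)%type).
Hypothesis NZ_sub : forall S z f, NZ S z f -> S z.
Hypothesis NZ_cone : forall S z f t, 0 < t -> NZ S z f -> NZ S z (t *: f).
Hypothesis NZ_prod : forall S T x y p q, NZ (S `*` T) (x, y) (dual_pair p q) ->
  NX S x p /\ NY T y q.
Hypothesis NZ_separation : separation_property NZ.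

Variables (Omega : set X) (F : X -> set Y) (xbar : X) (ybar : Y).
Variable Xi : set (set Y).
Hypothesis Omega_closed : closed Omega.
Hypothesis gphF_closed : closed (gph F).
Hypothesis Xi_closed : forall A, Xi A -> closed A.
Hypothesis stationary : approx_stationary F Omega Xi xbar ybar.

(** Almost opposite normals [(p1, q1)] to the graph and [(p2, q2)] to [Omega * A], scaled by the
    norm of the first pair. The second pair is split into normals of the factors only after the
    final rescaling. *)
Let normal_tuple eps x1 y1 x2 A y2 p1 q1 p2 q2 :=
  [/\ (gph F `&` ball (xbar, ybar) eps) (x1, y1),
      (Omega `&` ball xbar eps) x2, Xi A, (A `&` ball ybar eps) y2 &
      [/\ NZ (gph F) (x1, y1) (dual_pair p1 q1),
          NZ (Omega `*` A) (x2, y2) (dual_pair p2 q2),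
          `|p1 + p2| < eps, `|q1 + q2| < eps & `|p1| + `|q1| = 1]].

Let normal_tuple_le e1 e2 x1 y1 x2 A y2 p1 q1 p2 q2 : e1 <= e2 ->
  normal_tuple e1 x1 y1 x2 A y2 p1 q1 p2 q2 ->
  normal_tuple e2 x1 y1 x2 A y2 p1 q1 p2 q2.
Proof.
move=> e12 [[g1 g2] [om1 om2] XA [a1 a2] [n1 n2 n3 n4 n5]].
split=> //; first by split=> //; exact: le_ball g2.
- by split=> //; exact: le_ball om2.
- by split=> //; exact: le_ball a2.
by split=> //; exact: lt_le_trans e12.
Qed.

Let dist_lt (Z : normedModType R) (x : Z) (S : set Z) (r : R) :
  (dist x S < r%:E)%E -> exists2 u, S u & `|u - x| < r.
Proof.
move=> /ereal_inf_lt[_ [u Su <-]]; rewrite lte_fin => ur.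
by exists u.
Qed.

Let normal_tuple_ex eps : 0 < eps ->
  exists x1 y1 x2 A y2 p1 q1 p2 q2, normal_tuple eps x1 y1 x2 A y2 p1 q1 p2 q2.
Proof.
move=> eps0; have [K [kap [K0 kap0 sep]]] := NZ_separation.
(* The bound 1/8 meets the requirement [e < 1/4], and [eps / 4] bounds the distances [rho + e]. The
   last two give [s > kap / 2] and [K * e <= eps * kap / 4 < s * eps], so the sum of the normals is
   still below [eps] after division by [s]. *)
pose e := Num.min (Num.min (1 / 8) (eps / 4)) (Num.min (eps * kap / (4 * K)) (kap / (4 * K))).
have e0 : 0 < e.
  by rewrite !lt_min !divr_gt0 ?mulr_gt0//.
have [e8 e4 eK eK'] : [/\ e <= 1 / 8, e <= eps / 4, e <= eps * kap / (4 * K) & e <= kap / (4 * K)].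
  by split; rewrite /e !ge_min lexx ?orbT.
have [rho [A [z [/andP[rho0 rhoe] XiA zb dz capA]]]] := stationary e0.
pose i0 : 'I_2 := ord0; pose i1 : 'I_2 := ord_max.
have A0 : A i0 = gph F by have := XiA i0.
have [B XB A1] : exists2 B, Xi B & Omega `*` B = A i1 by have := XiA i1.
have dzi i : exists2 u, A i u & `|u - z i| < e * rho.
  apply: dist_lt; apply: le_lt_trans dz.
  exact: (le_bigmax_cond _ (fun i => dist (z i) (A i))).
have [a0 Aa0 za0] := dzi i0; have [a1 Aa1 za1] := dzi i1.
have cA1 : closed (A i1).
  rewrite -A1; apply: closed_setX => //; exact: Xi_closed.
have cA0 : closed (A i0) by rewrite A0.
have [||u0 [u1 [f0 [f1 [N0 N1 [uz0 uz1] f01 fk]]]]] :=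
  sep (A i0) (A i1) e rho (z i0) (z i1) a0 a1 cA0 cA1 _ rho0 Aa0 Aa1 za0 za1.
- by rewrite e0/=; lra.
- move=> w wr Aw0 Aw1; have : set0 w; last by [].
  rewrite -capA; split; last by rewrite -ball_normE/= sub0r normrN.
  move=> i _; have [->|->] : i = i0 \/ i = i1.
    by case: i => -[|[|n]] // ni; [left|right]; exact/val_inj.
  - by exists (z i0 + w) => //; rewrite addrAC subrr add0r.
  - by exists (z i1 + w) => //; rewrite addrAC subrr add0r.
have zb' i : `|z i - (xbar, ybar)| < e.
  by have := zb i; rewrite -ball_normE/= distrC.
have ub0 : ball (xbar, ybar) eps u0.
  rewrite -ball_normE/= distrC; have := ler_normD (u0 - z i0) (z i0 - (xbar, ybar)).
  by rewrite addrA subrK; have := zb' i0; lra.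
have ub1 : ball (xbar, ybar) eps u1.
  rewrite -ball_normE/= distrC; have := ler_normD (u1 - z i1) (z i1 - (xbar, ybar)).
  by rewrite addrA subrK; have := zb' i1; lra.
have S0 := NZ_sub N0; have S1 := NZ_sub N1.
move: N0 N1 S0 S1; rewrite A0 -A1 => N0 N1 S0 [S1 S1'].
have [p0 [q0 f0E]] := dual_pair_surj f0.
have [p1 [q1 f1E]] := dual_pair_surj f1.
pose s := `|p0| + `|q0|.
have Ke : K * e <= kap / 4.
  have -> : kap / 4 = K * (kap / (4 * K)) by field; rewrite gt_eqF.
  by rewrite ler_pM2l.
have Ke' : K * e <= eps * kap / 4.
  have -> : eps * kap / 4 = K * (eps * kap / (4 * K)) by field; rewrite gt_eqF.
  by rewrite ler_pM2l.
have sk : kap / 2 < s.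
  have : `|f0| <= s by rewrite f0E; exact: dual_pair_norm_le.
  by move: fk; lra.
have s0 : 0 < s by lra.
have si0 : 0 < s^-1 by rewrite invr_gt0.
have fs : `|f0 + f1| < s * eps.
  have : kap / 2 * eps < s * eps by rewrite ltr_pM2r.
  have : 0 < kap * eps by rewrite mulr_gt0.
  by move: f01; lra.
move: u0 u1 ub0 ub1 N0 N1 S0 S1 S1' uz0 uz1 => [x0 y0] [x1 y1].
move=> ub0 [ub1 ub1'] N0 N1 S0 S1 S1' _ _.
exists x0, y0, x1, B, y1, (s^-1 *: p0), (s^-1 *: q0), (s^-1 *: p1), (s^-1 *: q1).
split=> //; split.
- by rewrite -dual_pairZ -f0E; exact: NZ_cone.
- by rewrite -dual_pairZ -f1E; exact: NZ_cone.
- rewrite -scalerDr normrZ gtr0_norm// ltr_pdivrMl//.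
  apply: le_lt_trans fs; rewrite f0E f1E dual_pairD; exact: dual_pair_norm_fst.
- rewrite -scalerDr normrZ gtr0_norm// ltr_pdivrMl//.
  apply: le_lt_trans fs; rewrite f0E f1E dual_pairD; exact: dual_pair_norm_snd.
- by rewrite !normrZ gtr0_norm// -mulrDr mulVf// gt_eqF.
Qed.

Theorem stationarity_dichotomy :
    (exists2 M : R, 0 < M & forall eps : R, 0 < eps ->
        exists (x1 : X) (y1 : Y) (x2 : X) (A : set Y) (y2 : Y) (ystar : dual Y),
          [/\ (gph F `&` ball (xbar, ybar) eps) (x1, y1),
              (Omega `&` ball xbar eps) x2,
              Xi A,
              (A `&` ball ybar eps) y2 &
              [/\ set_add (NY A y2) (ball 0 eps) ystar,
                  `|ystar| = 1 &
                  set_add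
                    (set_add [set f | NZ (gph F) (x1, y1) (dual_pair f (- ystar))]
                             (NX Omega x2 `&` ball 0 M))
                    (ball 0 eps) 0]])
     \/
     (forall eps : R, 0 < eps ->
        exists (x1 : X) (y1 : Y) (x2 : X) (x1star x2star : dual X),
          [/\ (gph F `&` ball (xbar, ybar) eps) (x1, y1),
              (Omega `&` ball xbar eps) x2,
              sv_image (fun g => [set f | NZ (gph F) (x1, y1) (dual_pair f (- g))])
                (ball 0 eps) x1star,
              NX Omega x2 x2star &
              `|x1star + x2star| < eps /\ `|x1star| + `|x2star| = 1]).
Proof.
have [[k k0 kP]|noA] := pselect (exists2 k : R, 0 < k & forall eps, 0 < eps ->
    exists x1 y1 x2 A y2 p1 q1 p2 q2,
      normal_tuple eps x1 y1 x2 A y2 p1 q1 p2 q2 /\ k <= `|q1|).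
  (* Division by [|q1| >= k] turns [|p2| <= |p1 + p2| + |p1| < 3] into the bound [3 / k]; the term
     [eps * k] in [e] compensates for the same division of the errors. *)
  left; exists (3 / k) => [|eps eps0]; first by rewrite divr_gt0.
  pose e := Num.min (Num.min eps (eps * k)) 1.
  have e0 : 0 < e by rewrite !lt_min eps0 ltr01 mulr_gt0.
  have [e1 e2 e3] : [/\ e <= eps, e <= eps * k & e <= 1].
    by rewrite /e !ge_min !lexx ?orbT; split.
  have [x1 [y1 [x2 [A [y2 [p1 [q1 [p2 [q2 [T kq]]]]]]]]]] := kP e e0.
  have [gx ox XA ya _] := normal_tuple_le e1 T.
  have [_ _ _ _ [N1 N2 pe qe pq1]] := T.
  have q0 : 0 < `|q1| by exact: lt_le_trans kq.
  have i0 : 0 < `|q1|^-1 by rewrite invr_gt0.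
  have ik : `|q1|^-1 <= k^-1 by rewrite lef_pV2.
  have := NZ_cone i0 N2; rewrite dual_pairZ => /NZ_prod[NX2 NY2].
  have := NZ_cone i0 N1; rewrite dual_pairZ => NF1.
  have scaled_lt (E : normedModType R) (v : E) : `|v| < e -> `|(`|q1|^-1 *: v)| < eps.
    move=> ve; rewrite normrZ gtr0_norm// ltr_pdivrMl//.
    apply: (lt_le_trans ve); apply: (le_trans e2).
    by rewrite mulrC ler_wpM2r// ltW.
  exists x1, y1, x2, A, y2, (- (`|q1|^-1 *: q1)); split=> //; split.
  - exists (`|q1|^-1 *: q2) => //; exists (- (`|q1|^-1 *: (q1 + q2))).
      by rewrite -ball_normE/= sub0r opprK; exact: scaled_lt.
    by rewrite scalerDr opprD addrCA subrr addr0.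
  - by rewrite normrN normrZ gtr0_norm// mulVf// gt_eqF.
  - exists (`|q1|^-1 *: p1 + `|q1|^-1 *: p2).
      exists (`|q1|^-1 *: p1); first by rewrite /= opprK.
      exists (`|q1|^-1 *: p2) => //; split=> //.
      rewrite -ball_normE/= sub0r normrN normrZ gtr0_norm//.
      have p22 : `|p2| < 3.
        have := ler_normB (p1 + p2) p1; rewrite addrAC subrr add0r.
        have := normr_ge0 q1; lra.
      apply: (@lt_le_trans _ _ (`|q1|^-1 * 3)); first by rewrite ltr_pM2l.
      by rewrite mulrC ler_wpM2l.
    exists (- (`|q1|^-1 *: (p1 + p2))).
      by rewrite -ball_normE/= sub0r opprK; exact: scaled_lt.
    by rewrite scalerDr subrr.
right=> eps eps0.
(* From [|q1| < k <= 1/8] follows [|p1| + |p2| > 1/2], so the rescaling at most doubles the errors,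
   which [eps / 4] absorbs. *)
pose k := Num.min (eps / 4) (1 / 8).
have k0 : 0 < k by rewrite lt_min !divr_gt0.
have [k1 k2] : k <= eps / 4 /\ k <= 1 / 8 by rewrite /k !ge_min !lexx orbT; split.
have [e1 e10 e1P] : exists2 e1, 0 < e1 & forall x1 y1 x2 A y2 p1 q1 p2 q2,
    normal_tuple e1 x1 y1 x2 A y2 p1 q1 p2 q2 -> `|q1| < k.
  apply: contrapT => h; apply: noA; exists k => // e1 e10.
  apply: contrapT => h1; apply: h; exists e1 => // x1 y1 x2 A y2 p1 q1 p2 q2 T.
  rewrite ltNge; apply/negP => kq; apply: h1.
  by exists x1, y1, x2, A, y2, p1, q1, p2, q2.
pose e := Num.min e1 k.
have e0 : 0 < e by rewrite lt_min e10.
have [ee1 ek] : e <= e1 /\ e <= k by split; rewrite ge_min lexx ?orbT.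
have [x1 [y1 [x2 [A [y2 [p1 [q1 [p2 [q2 T]]]]]]]]] := normal_tuple_ex e0.
have q1k := e1P _ _ _ _ _ _ _ _ _ (normal_tuple_le ee1 T).
have [gx ox XA ya _] : normal_tuple eps x1 y1 x2 A y2 p1 q1 p2 q2.
  by apply: normal_tuple_le T; lra.
have [_ _ _ _ [N1 N2 pe qe pq1]] := T.
pose s := `|p1| + `|p2|.
have s2 : 1 / 2 < s by have := normr_ge0 p2; rewrite /s; lra.
have s0 : 0 < s by lra.
have i0 : 0 < s^-1 by rewrite invr_gt0.
have := NZ_cone i0 N2; rewrite dual_pairZ => /NZ_prod[NX2 NY2].
have := NZ_cone i0 N1; rewrite dual_pairZ => NF1.
have scaled_lt (E : normedModType R) (v : E) : `|v| < k -> `|s^-1 *: v| < eps.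
  move=> ve; rewrite normrZ gtr0_norm// ltr_pdivrMl//.
  have : 1 / 2 * eps < s * eps by rewrite ltr_pM2r.
  lra.
exists x1, y1, x2, (s^-1 *: p1), (s^-1 *: p2); split=> //.
- exists (- (s^-1 *: q1)); last by rewrite /= opprK.
  by rewrite -ball_normE/= sub0r opprK; exact: scaled_lt.
- split; first by rewrite -scalerDr; apply: scaled_lt; exact: lt_le_trans pe ek.
  by rewrite !normrZ gtr0_norm// -mulrDr mulVf// gt_eqF.
Qed.

End dichotomy.

(** * Normal cones *)

Section clarke_cone.
Context {R : realType}.

Lemma clarke_normal_sub (Z : normedModType R) S (z : Z) f :
  clarke_normal S z f -> S z.
Proof. by case. Qed.

Lemma clarke_normalZ (Z : normedModType R) S (z : Z) f t : 0 < t ->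
  clarke_normal S z f -> clarke_normal S z (t *: f).
Proof.
move=> t0 [Sz fz]; split=> // w Tw.
by rewrite dualZE; have := fz w Tw; rewrite pmulr_rle0.
Qed.

(** A vector tangent to one factor, padded with 0, is tangent to the product: the other components
    stay where they are. *)
Lemma clarke_normal_prod (X Y : normedModType R) (S : set X) (T : set Y) x y p q :
  clarke_normal (S `*` T) (x, y) (dual_pair p q) ->
  clarke_normal S x p /\ clarke_normal T y q.
Proof.
move=> [[/= Sx Ty] pq]; split; split=> // w Tw.
- have := pq (w, 0); rewrite/= linear0 addr0; apply.
  move=> u t STu uz t0 tz.
  have [| |w_ wc wS] := Tw (fst \o u) t _ _ t0 tz.
  + by move=> k; case: (STu k).
  + exact: (cvg_comp _ _ uz cvg_fst).
  exists (fun k => (w_ k, 0)).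
    by apply: cvg_prod => //=; exact: cvg_cst.
  move=> k; split; first exact: wS.
  by rewrite /= scaler0 addr0; case: (STu k).
- have := pq (0, w); rewrite/= linear0 add0r; apply.
  move=> u t STu uz t0 tz.
  have [| |w_ wc wS] := Tw (snd \o u) t _ _ t0 tz.
  + by move=> k; case: (STu k).
  + exact: (cvg_comp _ _ uz cvg_snd).
  exists (fun k => (0, w_ k)).
    by apply: cvg_prod => //=; exact: cvg_cst.
  move=> k; split; last exact: wS.
  by rewrite /= scaler0 addr0; case: (STu k).
Qed.

End clarke_cone.

Section frechet_cone.
Context {R : realType}.

(** The upper limit unfolded. The point [u = z], which the filter excludes, may be included because
    both sides vanish there. *)
Lemma frechet_normalP (Z : normedModType R) S (z : Z) f :
  frechet_normal S z f <-> S z /\ forall e, 0 < e -> exists2 d, 0 < d &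
    forall u, S u -> `|u - z| < d -> f (u - z) <= e * `|u - z|.
Proof.
split=> -[Sz fz]; split=> //.
  move=> e e0; have := le_lt_trans fz (_ : (0 < e%:E)%E); rewrite lte_fin => /(_ e0).
  rewrite limf_esupE => /ereal_inf_lt[_ [V VF <-] Ve].
  have /nbhs_ballP[d /= d0 dV] := VF.
  exists d => // u Su ud; have [->|uz] := eqVneq u z.
    by rewrite subrr linear0 normr0 mulr0.
  have nz : 0 < `|u - z| by rewrite normr_gt0 subr_eq0.
  rewrite -ler_pdivrMr// -lee_fin; apply: le_trans (ltW Ve).
  apply: ereal_sup_ubound; exists u => //; apply: dV => //.
  by rewrite -ball_normE/= distrC.
apply/lee_addgt0Pr => e e0; rewrite add0e limf_esupE.
have [d d0 dP] := fz e e0.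
apply: (@le_trans _ _ (ereal_sup
  [set (f (u - z) / `|u - z|)%:E | u in [set u | [/\ S u, u != z & `|u - z| < d]]])).
  apply: ereal_inf_lbound; eexists; last by [].
  apply/nbhs_ballP; exists d => // u; rewrite -ball_normE/= distrC => ud uz Su.
  by split.
apply: ge_ereal_sup => _ [u [Su uz ud] <-]; rewrite lee_fin ler_pdivrMr.
  exact: dP.
by rewrite normr_gt0 subr_eq0.
Qed.

Lemma frechet_normal_sub (Z : normedModType R) S (z : Z) f :
  frechet_normal S z f -> S z.
Proof. by case. Qed.

Lemma frechet_normalZ (Z : normedModType R) S (z : Z) f t : 0 < t ->
  frechet_normal S z f -> frechet_normal S z (t *: f).
Proof.
move=> t0 /frechet_normalP[Sz fz]; apply/frechet_normalP; split=> // e e0.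
have [d d0 dP] := fz _ (divr_gt0 e0 t0).
exists d => // u Su ud; rewrite dualZE -ler_pdivlMl// mulrA [t^-1 * _]mulrC.
exact: dP.
Qed.

Lemma frechet_normal_prod (X Y : normedModType R) (S : set X) (T : set Y) x y p q :
  frechet_normal (S `*` T) (x, y) (dual_pair p q) ->
  frechet_normal S x p /\ frechet_normal T y q.
Proof.
move=> /frechet_normalP[[/= Sx Ty] pq]; split; apply/frechet_normalP; split=> // e e0;
  have [d d0 dP] := pq e e0; exists d => // u Su ud.
- have := dP (u, y) (conj Su Ty).
  have -> : (u, y) - (x, y) = (u - x, 0) by congr pair; rewrite /= subrr.
  rewrite /= subrr linear0 addr0 prod_norm/= normr0.
  by rewrite (max_idPl (normr_ge0 _)); exact.
- have := dP (x, u) (conj Sx Su).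
  have -> : (x, u) - (x, y) = (0, u - y) by congr pair; rewrite /= subrr.
  rewrite /= subrr linear0 add0r prod_norm/= normr0.
  by rewrite (max_idPr (normr_ge0 _)); exact.
Qed.

End frechet_cone.

(** * Asplund spaces have fragmented duals *)

(* Terms over [init] and [op] form a countable type. *)
Lemma countable_closure (T : Type) (C : countType) (init : nat -> T)
    (op : C -> seq T -> T) :
  exists t : nat -> T, (forall n, exists m, t m = init n) /\
    forall c (s : seq nat), exists m, t m = op c [seq t i | i <- s].
Proof.
pose ev := fix ev (a : GenTree.tree nat) : T := match a with
  | GenTree.Leaf n => init n
  | GenTree.Node n l => if unpickle n is Some c then op c (map ev l) else init 0%N
  end.
pose t n := ev (odflt (GenTree.Leaf 0%N) (unpickle n)).
exists t; split=> [n|c s].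
  by exists (pickle (GenTree.Leaf n)); rewrite /t pickleK.
pose l := [seq odflt (GenTree.Leaf 0%N) (unpickle i) | i <- s].
exists (pickle (GenTree.Node (pickle c) l)).
by rewrite /t pickleK /= pickleK /l -map_comp.
Qed.

(** The enumeration may take the value [t0] outside [D], so an empty or finite [D] needs no separate
    treatment. *)
Lemma countable_enum (T : Type) (t0 : T) (D : set T) : countable D ->
  exists e : nat -> T, forall x, D x -> exists n, e n = x.
Proof.
move=> /countable_injP[f fi].
have /choice[e eP] : forall n, exists x, (exists2 y, D y & f y = n) ->
    D x /\ f x = n.
  move=> n; have [[y Dy yn]|h] := pselect (exists2 y, D y & f y = n).
    by exists y.
  by exists t0 => /h.
exists e => x Dx; exists (f x); have [|De fe] := eP (f x); first by exists x.
by apply: fi => //; rewrite inE.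
Qed.

Section closed_span.
Context {R : realType} {V : normedModType R}.

Lemma closureP (D : set V) x :
  closure D x <-> forall e, 0 < e -> exists2 a, D a & `|a - x| < e.
Proof.
split=> [cx e e0|h B /nbhs_ballP[e /= e0 eB]].
  have [a [Da]] := cx _ (nbhsx_ballx x e e0).
  by rewrite -ball_normE/= distrC => ax; exists a.
by have [a Da ax] := h e e0; exists a; split=> //; apply: eB; rewrite -ball_normE/= distrC.
Qed.

Definition rat_linear_closed (t : nat -> V) :=
  forall (q : rat) i j, exists k, t k = ratr q *: t i + t j.

Lemma rat_near (a e : R) : 0 < e -> exists q : rat, `|a - ratr q| < e.
Proof.
move=> e0; have ae : a - e < a + e by lra.
have [q] := rat_in_itvoo ae.
rewrite in_itv/= => /andP[h1 h2]; exists q; rewrite ltr_norml; lra.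
Qed.

Lemma closure_submod_closed (t : nat -> V) : rat_linear_closed t ->
  submod_closed [pred x | `[< closure (range t) x >]].
Proof.
move=> tL; have [k0 tk0] : exists k, t k = 0.
  have [k kE] := tL (-1)%R 0%N 0%N; exists k.
  by rewrite kE rmorphN1 scaleN1r addNr.
split.
  by apply/asboolP; apply: subset_closure; exists k0.
move=> a x y /asboolP/closureP cx /asboolP/closureP cy.
apply/asboolP/closureP => e e0.
have [_ [j _ <-] yj] := cy _ (divr_gt0 e0 (ltr0Sn _ 2) : 0 < e / 3%:R).
pose d1 := e / 3 / (`|a| + 1).
have a1 : 0 < `|a| + 1 by rewrite ltr_wpDl.
have d10 : 0 < d1 by rewrite !divr_gt0.
have [_ [i _ <-] xi] := cx _ d10.
(* The rational coefficient is chosen after [i], since its precision depends on the norm of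
   [t i]. *)
pose d2 := e / 3 / (`|t i| + 1).
have t1 : 0 < `|t i| + 1 by rewrite ltr_wpDl.
have d20 : 0 < d2 by rewrite !divr_gt0.
have [q aq] := rat_near a d20.
have [k kE] := tL q i j; exists (t k); first by exists k.
have -> : t k - (a *: x + y) = (ratr q - a) *: t i + a *: (t i - x) + (t j - y).
  by rewrite kE scalerBl scalerBr [X in _ = X + _]addrA subrK addrACA -opprD.
apply: (le_lt_trans (ler_normD _ _)).
apply: (le_lt_trans (lerD (ler_normD _ _) (lexx _))).
rewrite !normrZ distrC.
have h1 : `|a - ratr q| * `|t i| <= e / 3.
  apply: (@le_trans _ _ (d2 * (`|t i| + 1))); last by rewrite divfK// gt_eqF.
  by rewrite ler_pM// ?lerDl// ltW.
have h2 : `|a| * `|t i - x| <= e / 3.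
  apply: (@le_trans _ _ ((`|a| + 1) * d1)); last by rewrite mulrC divfK// gt_eqF.
  by rewrite ler_pM// ?lerDl// ltW.
lra.
Qed.

Lemma exists_closed_span (t : nat -> V) : rat_linear_closed t ->
  exists L : submodClosed V, forall x, x \in L <-> closure (range t) x.
Proof.
move=> tL; pose P : {pred V} := [pred x | `[< closure (range t) x >]].
pose L : submodClosed V :=
  HB.pack P (GRing.isSubmodClosed.Build R V P (closure_submod_closed tL)).
by exists L => x; split => [/asboolP//|h]; apply/asboolP.
Qed.

Lemma separable_closed_span (t : nat -> V) (L : submodClosed V) :
  (forall x, x \in L <-> closure (range t) x) -> separable (subspace_type L).
Proof.
move=> LE.
have tL n : t n \in L by apply/LE; apply: subset_closure; exists n.
exists (range (fun n => Subspace (tL n))).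
  exact: card_image_le.
move=> O [y Oy] oO.
have /nbhs_ballP[e /= e0 eO] : nbhs y O by exact: open_nbhs_nbhs.
have /LE/closureP/(_ e e0)[_ [n _ <-] ne] := valP y.
exists (Subspace (tL n)); split; last by exists n.
by apply: eO; rewrite -ball_normE/= distrC.
Qed.

Lemma exists_restriction (L : submodClosed V) (f : dual V) :
  exists2 v : dual (subspace_type L), (forall x, v x = f (val x)) & `|v| <= `|f|.
Proof.
apply: exists_dual => //; first by move=> a x y; rewrite !linearP.
by move=> x; exact: le_dual_norm.
Qed.

End closed_span.

Section weak_star_open.
Context {R : realType} {Z : normedModType R}.
Implicit Types (U O K : set (dual Z)) (f g : dual Z).

(** Stated through basic neighbourhoods, because the topology carried by [dual Z] is that of the
    norm. *)
Definition weak_star_open U := forall f, U f -> exists (s : seq Z) (d : R),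
  0 < d /\ forall g, (forall x, x \in s -> `|g x - f x| < d) -> U g.

Lemma weak_star_openT : weak_star_open setT.
Proof. by move=> f _; exists [::], 1. Qed.

Lemma weak_star_openI U O : weak_star_open U -> weak_star_open O ->
  weak_star_open (U `&` O).
Proof.
move=> oU oO f [/oU[s [d [d0 sU]]] /oO[s' [d' [d'0 sO]]]].
exists (s ++ s'), (Num.min d d'); split; first by rewrite lt_min d0.
move=> g gf; split; [apply: sU|apply: sO] => x xs; have := gf x;
  rewrite mem_cat xs ?orbT lt_min => /(_ isT)/andP[]//.
Qed.

Lemma weak_star_open_bigcup I (D : set I) (U : I -> set (dual Z)) :
  (forall i, D i -> weak_star_open (U i)) -> weak_star_open (\bigcup_(i in D) U i).
Proof.
move=> oU f [i Di /(oU i Di)[s [d [d0 sU]]]].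
by exists s, d; split=> // g /sU Ug; exists i.
Qed.

Lemma weak_star_openU U O : weak_star_open U -> weak_star_open O ->
  weak_star_open (U `|` O).
Proof.
move=> oU oO f [/oU|/oO] [s [d [d0 sU]]]; exists s, d; split=> // g /sU Ug.
  by left.
by right.
Qed.

Lemma weak_star_open_gt x (a : R) : weak_star_open [set f | a < f x].
Proof.
move=> f /= af; exists [:: x], (f x - a); split; first by rewrite subr_gt0.
move=> g /(_ x); rewrite inE eqxx => /(_ isT); rewrite ltr_norml => /andP[+ _].
lra.
Qed.

Lemma weak_star_open_lt x (a : R) : weak_star_open [set f | f x < a].
Proof.
move=> f /= af; exists [:: x], (a - f x); split; first by rewrite subr_gt0.
move=> g /(_ x); rewrite inE eqxx => /(_ isT); rewrite ltr_norml => /andP[_].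
lra.
Qed.

(** The Asplund property enters the remaining proof only in this form, which passes to products by a
    direct argument. *)
Definition fragmented_dual := forall e K, 0 < e -> K !=set0 ->
  (forall f, K f -> `|f| <= 1) ->
  exists U, [/\ weak_star_open U, (K `&` U) !=set0 &
    forall f g, (K `&` U) f -> (K `&` U) g -> `|f - g| <= e].

Lemma exists_norming f e : 0 <= e -> e < `|f| -> exists2 x, `|x| <= 1 & e < f x.
Proof.
move=> e0 ef; apply: contrapT => h; move: ef; apply/negP; rewrite -leNgt.
apply: dual_norm_le => x x1; rewrite ler_norml; apply/andP; split.
  rewrite lerNl -(linearN f) leNgt; apply/negP => ex; apply: h.
  by exists (- x) => //; rewrite normrN.
by rewrite leNgt; apply/negP => ex; apply: h; exists x.
Qed.

End weak_star_open.
Arguments fragmented_dual {R} Z.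

Section asplund_fragmented.
Context {R : realType} {Z : normedModType R}.

(* If every weak* neighbourhood in [K] is large, a binary tree of weak* open
   sets is separated by countably many vectors; along a suitable branch a limit
   functional stays away from any given sequence in the dual of their span. *)
Lemma asplund_fragmented : asplund Z -> fragmented_dual Z.
Proof.
move=> aZ e K e0 K0 K1; apply: contrapT => nofrag.
(* The threshold [a.2] is the mean of the values at [a.1] of two functionals of [K] and [U] that
   differ there by more than [e]. *)
have splitP U : weak_star_open U -> (K `&` U) !=set0 -> exists a : Z * R,
    [/\ `|a.1| <= 1, (K `&` (U `&` [set f | a.2 + e / 4 < f a.1])) !=set0 &
     (K `&` (U `&` [set f | f a.1 < a.2 - e / 4])) !=set0].
  move=> oU U0.
  have [f [g [[Kf Uf] [Kg Ug] fg]]] : exists f g,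
      [/\ (K `&` U) f, (K `&` U) g & e < `|f - g|].
    apply: contrapT => h; apply: nofrag; exists U; split=> // f g Uf Ug.
    by rewrite leNgt; apply/negP => fg; apply: h; exists f, g.
  have [x x1 fgx] := exists_norming (ltW e0) fg.
  rewrite dualBE in fgx.
  exists (x, (f x + g x) / 2); split=> //=.
    by exists f; split=> //; split=> //=; lra.
  by exists g; split=> //; split=> //=; lra.
have /choice[sp spP] : forall U : set (dual Z), exists a : Z * R,
    weak_star_open U -> (K `&` U) !=set0 ->
    [/\ `|a.1| <= 1, (K `&` (U `&` [set f | a.2 + e / 4 < f a.1])) !=set0 &
     (K `&` (U `&` [set f | f a.1 < a.2 - e / 4])) !=set0].
  move=> U; have [[oU U0]|h] := pselect (weak_star_open U /\ (K `&` U) !=set0).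
    by have [a aP] := splitP U oU U0; exists a.
  by exists (0, 0) => oU U0; exfalso; apply: h.
pose child (b : bool) (U : set (dual Z)) := U `&` (if b
  then [set f : dual Z | (sp U).2 + e / 4 < f (sp U).1]
  else [set f : dual Z | f (sp U).1 < (sp U).2 - e / 4]).
pose node (s : seq bool) : set (dual Z) := foldr child setT s.
have nodeP s : weak_star_open (node s) /\ (K `&` node s) !=set0.
  elim: s => [|b s [oS S0]].
    by split; [exact: weak_star_openT|rewrite setIT].
  have [_ h1 h2] := spP _ oS S0; split; last by case: b.
  apply: weak_star_openI => //.
  by case: b; [exact: weak_star_open_gt|exact: weak_star_open_lt].
pose x (s : seq bool) := (sp (node s)).1.
have x1 s : `|x s| <= 1 by have [oS S0] := nodeP s; have [] := spP _ oS S0.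
have [t [tx tL]] := countable_closure
  (fun n => x (odflt [::] (unpickle n)))
  (fun (q : rat) (s : seq Z) => ratr q *: nth 0 s 0 + nth 0 s 1).
have trl : rat_linear_closed t by move=> q i j; have := tL q [:: i; j].
have [L LE] := exists_closed_span trl.
have [E cE dE] := aZ L (separable_closed_span LE).
have [en enP] := countable_enum (0 : dual (subspace_type L)) cE.
have xL s : x s \in L.
  apply/LE; apply: subset_closure.
  by have [m mE] := tx (pickle s); exists m => //; rewrite mE pickleK.
pose xs s := Subspace (xL s).
(* A diagonal choice: step [n] takes the child on which all values at [x (br n)] stay [e / 4] away
   from that of the [n]-th member of the dense sequence. *)
pose br := fix br n : seq bool := if n is n'.+1 then
  (en n' (xs (br n')) <= (sp (node (br n'))).2) :: br n' else [::].
have brS n f : node (br n.+1) f -> e / 4 < `|f (x (br n)) - en n (xs (br n))|.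
  rewrite -[br n.+1]/(_ :: br n) [node _]/=/child; case: (leP (en n (xs (br n))) _) => h [_ /=];
    rewrite -/(x _) => fx; rewrite lter_normr; apply/orP;
    [left|right]; lra.
have node_mono n m : (n <= m)%N -> node (br m) `<=` node (br n).
  move=> nm; rewrite -(subnK nm); elim: (m - n)%N => // j IH.
  by rewrite addSn => f [/IH].
have [||||f f1 fcl] := @weak_star_cluster R Z nat setT (fun n => K `&` node (br n)) 1.
- by exists 0%N.
- move=> i j _ _; exists (maxn i j) => // f [Kf nf]; split; split=> //.
    by apply: node_mono nf; exact: leq_maxl.
  by apply: node_mono nf; exact: leq_maxr.
- by move=> i _; have [] := nodeP (br i).
- by move=> i f _ [/K1].
have [v vE _] := exists_restriction L f.
have far n : e / 4 <= `|v - en n|.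
  apply: (@le_trans _ _ (`|(v - en n) (xs (br n))|)); last first.
    have xs1 : `|xs (br n)| <= 1 by exact: (x1 (br n)).
    by apply: (le_trans (normr_dual _ _)); rewrite ler_piMr.
  apply/ler_addgt0Pl => d d0; rewrite dualBE vE.
  have [g [Kg ng] gf] := fcl [:: x (br n)] d n.+1 d0 I.
  have := gf (x (br n)); rewrite inE eqxx => /(_ isT) => {}gf.
  have := brS n g ng; have := ler_normD (g (x (br n)) - f (x (br n)))
    (f (x (br n)) - en n (xs (br n))).
  by rewrite addrA subrK /=; lra.
have [||w [/= vw Ew]] := dE (ball v (e / 4)).
- by exists v; apply: ballxx; rewrite divr_gt0.
- exact: ball_open.
have [n nE] := enP w Ew.
by move: vw; rewrite -ball_normE/= -nE ltNge far.
Qed.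

End asplund_fragmented.

(** Fragment the first components of [K], then the second components of those pairs whose first
    component lies in the fragment found. *)
Lemma fragmented_dual_prod (R : realType) (X Y : normedModType R) :
  fragmented_dual X -> fragmented_dual Y -> fragmented_dual (X * Y)%type.
Proof.
move=> fX fY e K e0 K0 K1.
have e2 : 0 < e / 2 by rewrite divr_gt0.
have p1 f : K f -> forall p q, f = dual_pair p q -> `|p| <= 1 /\ `|q| <= 1.
  move=> /K1 f1 p q fE; rewrite fE in f1.
  by split; apply: le_trans f1; [exact: dual_pair_norm_fst|exact: dual_pair_norm_snd].
have [||U [oU [p [[q Kpq] Up]] Ud]] := fX (e / 2) [set p | exists q, K (dual_pair p q)] e2.
- case: K0 => f Kf; have [p [q fE]] := dual_pair_surj f.
  by exists p, q; rewrite -fE.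
- by move=> p [q Kpq]; have [] := p1 _ Kpq p q erefl.
have [||O [oO [q' [[p' Kpq' Up'] Oq']] Od]] :=
    fY (e / 2) [set q | exists2 p, K (dual_pair p q) & U p] e2.
- by exists q, p.
- by move=> q' [p' Kpq' _]; have [] := p1 _ Kpq' p' q' erefl.
pose N := [set f : dual (X * Y)%type | exists p q, [/\ f = dual_pair p q, U p & O q]].
have Ndist f g : (K `&` N) f -> (K `&` N) g -> `|f - g| <= e.
  move=> [Kf [pf [qf [fE Uf Of]]]] [Kg [pg [qg [gE Ug Og]]]].
  have -> : f - g = dual_pair (pf - pg) (qf - qg).
    by rewrite fE gE; apply: dualP => u; rewrite !(dualBE, dual_pairE) opprD addrACA.
  apply: (le_trans (dual_pair_norm_le _ _)).
  have : `|pf - pg| <= e / 2.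
    by apply: Ud; split=> //; [exists qf; rewrite -fE|exists qg; rewrite -gE].
  have : `|qf - qg| <= e / 2.
    apply: Od; split=> //; first by exists pf => //; rewrite -fE.
    by exists pg => //; rewrite -gE.
  lra.
exists N; split=> //; last by exists (dual_pair p' q'); split=> //; exists p', q'.
move=> f [pf [qf [fE /oU[s [d [d0 sU]]] /oO[s' [d' [d'0 sO]]]]]].
exists ([seq (x, 0) | x <- s] ++ [seq (0, y) | y <- s']), (Num.min d d').
split; first by rewrite lt_min d0.
move=> g gf; have [pg [qg gE]] := dual_pair_surj g; exists pg, qg; split=> //.
- apply: sU => x xs; have := gf (x, 0).
  rewrite mem_cat map_f// => /(_ isT); rewrite lt_min gE fE => /andP[+ _].
  by rewrite /= !linear0 !addr0.
- apply: sO => y ys; have := gf (0, y).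
  rewrite mem_cat orbC map_f// => /(_ isT); rewrite lt_min gE fE => /andP[_].
  by rewrite /= !linear0 !add0r.
Qed.

(** * Selecting points of the dual from weak* neighbourhoods *)

Section tower.
Context {T : Type} (O : set T -> set T).

(* The transfinite iteration of [U |-> U `|` O U], without ordinals. *)
Inductive tower : set T -> Prop :=
| tower_step U : tower U -> tower (U `|` O U)
| tower_sup (G : set (set T)) : (forall U, G U -> tower U) ->
    tower (\bigcup_(U in G) U).

(** The double induction of the Bourbaki-Witt theorem: in the successor case for [U], an inner
    induction on [W] shows that [W] lies in [U] or contains the successor of [U]. *)
Lemma tower_linear U W : tower U -> tower W -> U `<=` W \/ W `|` O W `<=` U.
Proof.
move=> tU; move: W; elim: tU => {U} [U tU IH W tW|G tG IH W tW].
  suff [WU|UW] : W `<=` U \/ U `|` O U `<=` W.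
  - have [UW|WU'] := IH W tW; last by right=> f /WU' Uf; left.
    by right; rewrite (_ : W = U)// eqEsubset.
  - by left.
  elim: tW => {W} [W tW [WU|UW]|G tG IHG].
  - have [UW|] := IH W tW; last by left.
    by right; rewrite (_ : W = U)// eqEsubset.
  - by right => f /UW Wf; left.
  - have [[W GW UW]|h] := pselect (exists2 W, G W & U `|` O U `<=` W).
      by right => f /UW Wf; exists W.
    left => f [W GW Wf]; have [WU|UW] := IHG W GW; first exact: WU.
    by exfalso; apply: h; exists W.
have [[U GU WU]|h] := pselect (exists2 U, G U & W `|` O W `<=` U).
  by right => f /WU Uf; exists U.
left => f [U GU Uf]; have [UW|WU] := IH U GU W tW; first exact: UW.
by exfalso; apply: h; exists U.
Qed.

End tower.

Section selector.
Context {R : realType} {Z : normedModType R}.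
Hypothesis fragZ : fragmented_dual Z.

Definition ball_fiber (V : set Z) (v : Z -> R) : set (dual Z) :=
  [set f : dual Z | `|f| <= 1 /\ forall x, V x -> f x = v x].

(** The sets [S i] need not lie in the fiber; it is enough that on each vector of [V] they come
    close to [v]. *)
Lemma ball_fiber_cluster V v (I : Type) (D : set I) (S : I -> set (dual Z)) :
  D !=set0 ->
  (forall i j, D i -> D j -> exists2 k, D k & S k `<=` S i `&` S j) ->
  (forall i, D i -> S i !=set0) ->
  (forall i f, D i -> S i f -> `|f| <= 1) ->
  (forall x d, V x -> 0 < d -> exists2 i, D i & forall f, S i f -> `|f x - v x| < d) ->
  exists2 f, ball_fiber V v f & forall i U, D i -> weak_star_open U -> U f ->
    exists2 g, S i g & U g.
Proof.
move=> D0 SI S0 S1 SV.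
have [f f1 fcl] := weak_star_cluster D0 SI S0 S1.
exists f; last first.
  move=> i U Di oU /oU[s [d [d0 sU]]].
  by have [g Sg gs] := fcl s d i d0 Di; exists g => //; apply: sU.
split=> // x Vx; apply/eqP; rewrite -subr_eq0 -normr_le0.
apply/ler_addgt0Pr => e e0; rewrite add0r.
have e2 : 0 < e / 2 by rewrite divr_gt0.
have [i Di iP] := SV x _ Vx e2.
have [g Sg gs] := fcl [:: x] _ i e2 Di.
have := gs x; rewrite inE eqxx => /(_ isT); have := iP g Sg.
rewrite (distrC (g x) (f x)); have := ler_normD (f x - g x) (g x - v x).
rewrite addrA subrK; lra.
Qed.

(** [N] sees the neighbourhood [W] only, not [V] or [v]. Hence countably many sets [W] that
    approximate all fibers yield countably many functionals that come near all of them. *)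
Definition selector e (N : set (dual Z) -> dual Z) := forall V v,
  ball_fiber V v !=set0 -> exists U, [/\ weak_star_open U,
    ball_fiber V v `<=` U & forall W, ball_fiber V v `<=` W ->
      W `&` [set f : dual Z | `|f| <= 1] `<=` U ->
      exists2 f, ball_fiber V v f & `|N W - f| <= e].

(* The last stage of a fragmentation of the unit ball that does not cover the
   fiber is already determined by any small neighbourhood [W] of the fiber. *)
Lemma exists_selector e : 0 < e -> exists N, selector e N.
Proof.
move=> e0; pose B := [set f : dual Z | `|f| <= 1].
have /choice[Q QP] : forall U : set (dual Z), exists Q,
    weak_star_open Q /\ (~ B `<=` U -> ((B `\` U) `&` Q) !=set0 /\
    forall f g, ((B `\` U) `&` Q) f -> ((B `\` U) `&` Q) g -> `|f - g| <= e).
  move=> U; have [BU|BU] := pselect (B `<=` U).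
    by exists set0; split=> // f.
  have [||Q [oQ Q0 Qd]] := fragZ e0 (K := B `\` U).
  - by apply: contrapT => h; apply: BU => f Bf; apply: contrapT => Uf; apply: h; exists f.
  - by move=> f [].
  by exists Q.
have tower_open U : tower Q U -> weak_star_open U.
  elim=> {U} [U _ oU|G _ oG]; first by apply: weak_star_openU => //; exact: (QP U).1.
  exact: weak_star_open_bigcup.
pose last_stage (W : set (dual Z)) :=
  \bigcup_(U in [set U | tower Q U /\ ~ W `<=` U]) U.
have tower_last W : tower Q (last_stage W) by apply: tower_sup => U [].
have /choice[N NP] : forall W : set (dual Z), exists f,
    ((B `\` last_stage (W `&` B)) `&` Q (last_stage (W `&` B))) !=set0 ->
    ((B `\` last_stage (W `&` B)) `&` Q (last_stage (W `&` B))) f.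
  move=> W; have [[f h]|h] := pselect
    (((B `\` last_stage (W `&` B)) `&` Q (last_stage (W `&` B))) !=set0).
    by exists f.
  by exists 0.
exists N => V v; set H := ball_fiber V v => H0.
have HB : H `<=` B by move=> f [].
(* Compactness: the stages that do not cover [H] form a chain of weak* open sets, so if their union
   covered [H] one of them would. *)
have notHlast : ~ H `<=` last_stage H.
  pose D := [set U | tower Q U /\ ~ H `<=` U].
  have [|||||f Hf fcl] := @ball_fiber_cluster V v _ D (fun U => H `\` U).
  - exists (\bigcup_(U in set0) U); split; first exact: tower_sup.
    by rewrite bigcup_set0 => h; case: H0 => f /h.
  - move=> U W DU DW; have [UW|WU] := tower_linear DU.1 DW.1.
      exists W => //; first by move=> f [Hf Wf]; split; split=> // /UW.
    exists U => //; move=> f [Hf Uf]; split; split=> // Wf; apply: Uf.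
    by apply: WU; left.
  - move=> U [_ HU]; apply: contrapT => h; apply: HU => f Hf.
    by apply: contrapT => Uf; apply: h; exists f.
  - by move=> U f _ [[]].
  - move=> x d Vx d0; exists (\bigcup_(U in set0) U).
      split; first exact: tower_sup.
      by rewrite bigcup_set0 => h; case: H0 => f /h.
    by move=> f [[_ fv] _]; rewrite fv// subrr normr0.
  move=> /(_ _ Hf)[U [tU HU] Uf].
  by have [g [_ nUg] Ug] := fcl U U (conj tU HU) (tower_open _ tU) Uf.
set U0 := last_stage H in notHlast.
have BU0 : ~ B `<=` U0 by move=> h; apply: notHlast; exact: subset_trans h.
have [_ /(_ BU0)[[p [[Bp nUp] Op]] Qd]] := QP U0.
have tU1 : tower Q (U0 `|` Q U0) by apply: tower_step; exact: tower_last.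
(* Were [H] not covered by the next stage, that stage would be part of the union [U0], although it
   contains [p] outside [U0]. *)
have HU1 : H `<=` U0 `|` Q U0.
  apply: contrapT => h; apply: nUp; exists (U0 `|` Q U0); first by split.
  by right.
exists (U0 `|` Q U0); split=> //; first exact: tower_open.
move=> W HW WU1.
(* A stage beyond [U0] contains the next one and with it [W] within the ball; so the stages that
   fail to cover [W] there are those inside [U0]. Thus [N W] and a point of [H] lie in the same
   small fragment. *)
have same : last_stage (W `&` B) = U0.
  rewrite eqEsubset; split=> f [U [tU hU] Uf].
    have [UU0|U1U] := tower_linear tU (tower_last H); first exact: UU0.
    by exfalso; apply: hU; exact: subset_trans U1U.
  exists U => //; split=> // h; apply: hU => g Hg; apply: h; split.
    exact: HW.
  exact: HB.
have [f [Hf nU0f]] : exists f, H f /\ ~ U0 f.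
  apply: contrapT => h; apply: notHlast => f Hf.
  by apply: contrapT => nf; apply: h; exists f.
exists f => //; apply: Qd.
  by rewrite -same; apply: NP; rewrite same; exists p.
split; first by split=> //; exact: HB.
by case: (HU1 f Hf).
Qed.

End selector.

(** * Separable reduction *)

Section dual_complete.
Context {R : realType} {Z : normedModType R}.

Lemma dual_geometric_limit (u : nat -> dual Z) (r : R) :
  (forall k, `|u k.+1 - u k| <= r * 2^-1 ^+ k) ->
  exists f : dual Z, forall n, `|u n - f| <= 2 * r * 2^-1 ^+ n.
Proof.
move=> ur; have r0 : 0 <= r.
  by have := ur 0%N; rewrite expr0 mulr1; apply: le_trans.
have urx x k : `|u k.+1 x - u k x| <= r * `|x| * 2^-1 ^+ k.
  rewrite -dualBE; apply: (le_trans (normr_dual _ _)).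
  by rewrite mulrAC ler_wpM2r.
have /choice[l lP] : forall x, exists l : R^o, u n x @[n --> \oo] --> l.
  by move=> x; exact: (@geometric_cvg R R^o _ _ (urx x)).
have ux x n : `|u n x - l x| <= 2 * r * 2^-1 ^+ n * `|x|.
  rewrite distrC; apply: (@cvg_le R R^o (fun n => u n x) _ (fun y => `|y - u n x|) _ n).
  - exact: lP.
  - exact: (@continuous_dist R R^o).
  - move=> m nm; have := @geometric_dist R R^o _ _ (urx x) n m nm; lra.
have ll : linear (l : Z -> R^o).
  move=> a x y; apply: (@norm_cvg_unique R R^o (u n (a *: x + y) @[n --> \oo])); first exact: lP.
  rewrite (_ : (fun n => u n (a *: x + y)) = fun n => a *: (u n x : R^o) + u n y).
    by apply: cvgD; [apply: cvgZl_tmp|]; exact: lP.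
  by apply/funext => n; rewrite linearP.
have [||f fl fM] := @exists_dual R Z l (`|u 0%N| + 2 * r) ll.
- by rewrite addr_ge0// mulr_ge0.
- move=> x; have := ux x 0%N; rewrite expr0 mulr1 ler_norml => /andP[h _].
  by have := le_dual_norm (u 0%N) x; lra.
exists f => n; apply: dual_norm_le_lin.
  by rewrite !mulr_ge0// ltW// half_exp_gt0.
move=> x; rewrite dualBE fl; apply: le_trans (ux x n); exact: ler_norm.
Qed.

End dual_complete.

(* The estimates by which a failure of the Frechet condition at a point
   passes to a nearby point of the skeleton and back. *)
Section steep_estimates.
Context {R : realType}.
Implicit Types e r eta : R.

Lemma steep_window r eta d a b : 0 < r -> eta <= r / 8 ->
  d <= r + eta -> r <= d + eta -> a < 3 * r / 4 -> 5 * r / 4 < b -> a < d < b.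
Proof. by move=> *; apply/andP; split; lra. Qed.

Lemma steep_near r eta b s d D : 0 < r -> eta <= r / 8 -> r < d / 2 ->
  b < 3 * r / 2 -> s < b -> D <= s + eta -> D < d.
Proof. lra. Qed.

Lemma steep_transfer e r eta e' d N yu yp fu : 0 < e -> 0 < r -> 0 < eta ->
  0 <= d -> 0 <= e' -> e' < 3 * e / 4 -> N + e * eta <= e * r / 16 -> d <= r + eta ->
  yp <= N -> yu - yp - fu <= e / 8 * d -> e * r < yu -> e' * d < fu.
Proof.
move=> e0 r0 eta0 d0 e'0 e'e Ner dr yN yf yu_gt.
have : e' * d <= 3 * e / 4 * (r + eta) by rewrite ler_pM// ltW.
have : e / 8 * d <= e / 8 * (r + eta) by rewrite ler_wpM2l// divr_ge0// ltW.
have : 0 < e * eta by rewrite mulr_gt0.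
have : 0 < e * r by rewrite mulr_gt0.
lra.
Qed.

Lemma steep_contradiction e r eta e' s D N yu yp fu : 0 < e -> 0 < r -> 0 < eta ->
  e / 2 < e' -> r / 2 < s -> N + e * eta <= e * r / 16 -> D <= s + eta ->
  - N <= yp -> fu - (yu - yp) <= e / 8 * s -> yu <= e / 4 * D -> e' * s < fu -> False.
Proof.
move=> e0 r0 eta0 ee' rs Ner Ds yN fy yD sf.
have : e / 2 * s <= e' * s by rewrite ler_wpM2r ?ltW// (lt_trans _ rs)// divr_gt0.
have : e / 4 * D <= e / 4 * (s + eta) by rewrite ler_wpM2l// divr_ge0// ltW.
have : e / 8 * (r / 2) <= e / 8 * s by rewrite ler_wpM2l ?divr_ge0// ltW.
have : 0 < e * eta by rewrite mulr_gt0.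
have : 0 < e * r by rewrite mulr_gt0.
lra.
Qed.

End steep_estimates.

Section separable_reduction.
Context {R : realType} {Z : normedModType R}.
Hypothesis fragZ : fragmented_dual Z.
Variables (A : nat -> set Z) (init : nat -> Z).

(** One summand per operation: rational combinations, norming vectors with precision index, selector
    values at coded neighbourhoods, witnesses of steepness. *)
Let code := (rat + nat + (seq rat * rat * nat) + (nat * rat * rat * rat))%type.

Let coded (xs : seq Z) (qs : seq rat) (d : rat) : set (dual Z) :=
  [set f | forall i, (i < size xs)%N ->
    `|f (nth 0 xs i) - ratr (nth 0%Q qs i)| < ratr d].

(** A violation at [p] of the Frechet inequality with slope [e], in the annulus between [a] and [b].
    The point [p] need not belong to [A j]. *)
Let steep j (p : Z) (f : dual Z) (e a b : rat) (u : Z) :=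
  [/\ A j u, ratr e * `|u - p| < f (u - p) & ratr a < `|u - p| < ratr b].

(** The norming vectors make restriction to the subspace isometric, the selector values make it
    onto, and the steep witnesses let Frechet normals extend. Points and functionals share one index
    because each kind generates the other. *)
Definition skeleton (t : nat -> Z * dual Z) :=
  [/\ forall n, exists m, (t m).1 = init n,
      forall (q : rat) i j, exists k,
        t k = (ratr q *: (t i).1 + (t j).1, ratr q *: (t i).2 + (t j).2),
      forall i (e : R), 0 < e ->
        exists k, `|(t k).1| <= 1 /\ `|(t i).2| - e <= (t i).2 (t k).1,
      forall e, 0 < e -> exists2 N : set (dual Z) -> dual Z, selector e N & forall ns qs d,
        exists k, (t k).2 = N (coded [seq (t n).1 | n <- ns] qs d) &
      forall j m n e a b, (exists u, steep j (t m).1 (t n).2 e a b u) ->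
        exists k, steep j (t m).1 (t n).2 e a b (t k).1].

Let inv_succ_le (e : R) : 0 < e -> exists m : nat, m.+1%:R^-1 <= e.
Proof.
move=> e0; exists (Num.bound e^-1); rewrite invf_ple ?posrE//; apply: ltW.
by apply: (lt_le_trans (archi_boundP _)); rewrite ?ler_nat// invr_ge0 ltW.
Qed.

Lemma exists_skeleton : exists t : nat -> Z * dual Z, skeleton t.
Proof.
have inv_gt0 (m : nat) : 0 < m.+1%:R^-1 :> R by rewrite invr_gt0.
have /choice[w wP] : forall a : dual Z * nat, exists x : Z,
    `|x| <= 1 /\ `|a.1| - a.2.+1%:R^-1 <= a.1 x.
  move=> [f m] /=; have [h|h] := leP 0 (`|f| - m.+1%:R^-1).
    have [|x x1 fx] := @exists_norming _ _ f _ h; first by rewrite gtrBl.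
    by exists x; split=> //; exact: ltW.
  by exists 0; rewrite normr0 linear0; split=> //; exact: ltW.
have /choice[N NP] : forall m : nat, exists N : set (dual Z) -> dual Z, selector (m.+1%:R^-1 : R) N.
  by move=> m; exact: exists_selector.
have /choice[st stP] : forall a : (nat * Z * dual Z * rat * rat * rat)%type,
    exists u, let: (j, p, f, e, x, y) := a in
    (exists u, steep j p f e x y u) -> steep j p f e x y u.
  move=> [[[[[j p] f] e] x] y].
  have [[u uP]|h] := pselect (exists u, steep j p f e x y u); first by exists u.
  by exists 0 => /h.
pose op (c : code) (s : seq (Z * dual Z)) : Z * dual Z :=
  let s0 := nth 0 s 0 in let s1 := nth 0 s 1 in
  match c with
  | inl (inl (inl q)) => (ratr q *: s0.1 + s1.1, ratr q *: s0.2 + s1.2)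
  | inl (inl (inr m)) => (w (s0.2, m), 0)
  | inl (inr (qs, d, m)) => (0, N m (coded [seq x.1 | x <- s] qs d))
  | inr (j, e, a, b) => (st (j, s0.1, s1.2, e, a, b), 0)
  end.
have [t [ti top]] := countable_closure (fun n => (init n, 0 : dual Z)) op.
exists t; split.
- by move=> n; have [m mE] := ti n; exists m; rewrite mE.
- by move=> q i j; have [k kE] := top (inl (inl (inl q))) [:: i; j]; exists k.
- move=> i e e0; have [m me] := inv_succ_le e0.
  have [k kE] := top (inl (inl (inr m))) [:: i]; exists k.
  rewrite kE /=; have [h1 h2] := wP ((t i).2, m); split=> //.
  by apply: le_trans h2; rewrite lerD2l lerN2.
- move=> e e0; have [m me] := inv_succ_le e0; exists (N m).
    move=> V v /(NP m V v)[U [oU HU UP]]; exists U; split=> // W HW WU.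
    by have [f Hf fe] := UP W HW WU; exists f => //; exact: le_trans me.
  move=> ns qs d; have [k kE] := top (inl (inr (qs, d, m))) ns; exists k.
  by rewrite kE /= -map_comp.
- move=> j m n e a b h; have [k kE] := top (inr (j, e, a, b)) [:: m; n].
  by exists k; rewrite kE /=; exact: (stP (j, (t m).1, (t n).2, e, a, b)).
Qed.

(** * The subspace and the dual hull generated by a skeleton *)

Section from_skeleton.
Variable t : nat -> Z * dual Z.
Hypothesis tP : skeleton t.
Variable L : submodClosed Z.
Hypothesis LE : forall x, x \in L <-> closure (range (fst \o t)) x.

Let tL n : (t n).1 \in L.
Proof. by apply/LE; apply: subset_closure; exists n. Qed.

Let t_dense x (e : R) : x \in L -> 0 < e -> exists n, `|(t n).1 - x| < e.
Proof. by move=> /LE/closureP h /h[_ [n _ <-] ne]; exists n. Qed.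

Let t_scale (q : rat) i : exists k, (t k).2 = ratr q *: (t i).2.
Proof.
have [_ tlin _ _ _] := tP.
have [k0 k0E] := tlin (-1) i i.
have [k kE] := tlin q i k0; exists k.
by rewrite kE k0E /= rmorphN1 scaleN1r addNr addr0.
Qed.

Let t_sub i j : exists k, (t k).2 = (t i).2 - (t j).2.
Proof.
have [_ tlin _ _ _] := tP; have [k kE] := tlin (-1) j i; exists k.
by rewrite kE /= rmorphN1 scaleN1r addrC.
Qed.

(** Almost norming vectors of each functional of the skeleton lie in [L]. *)
Let t_norm i c : 0 <= c -> (forall x, x \in L -> `|x| <= 1 -> (t i).2 x <= c) ->
  `|(t i).2| <= c.
Proof.
move=> c0 h; apply/ler_addgt0Pr => e e0; have [_ _ tn _ _] := tP.
have [k [k1 ke]] := tn i e e0; have := h _ (tL k) k1; lra.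
Qed.

(** Otherwise functionals of the ball outside [U], arbitrarily close to [f0] on finite sets of
    skeleton points, would cluster at a point of the fiber, which lies in the weak* open set [U]. *)
Let coded_neighbourhood (f0 : dual Z) U : `|f0| <= 1 -> weak_star_open U ->
  ball_fiber (range (fst \o t)) f0 `<=` U -> exists ns qs d,
    ball_fiber (range (fst \o t)) f0 `<=` coded [seq (t n).1 | n <- ns] qs d /\
    coded [seq (t n).1 | n <- ns] qs d `&` [set f : dual Z | `|f| <= 1] `<=` U.
Proof.
move=> f01 oU HU.
pose nb (a : seq nat * R) := [set f : dual Z | [/\ `|f| <= 1,
  forall n, n \in a.1 -> `|f (t n).1 - f0 (t n).1| < a.2 & ~ U f]].
have [[a [a0 nbU]]|noa] := pselect (exists a : seq nat * R, 0 < a.2 /\ ~ (nb a !=set0)).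
  (* Rational centres within [a.2 / 4] and a radius between [a.2 / 4] and [3 * a.2 / 4] give a coded
     set that contains the fiber and allows deviations from [f0] below [a.2] only. *)
  have /choice[q qP] : forall n, exists q : rat, `|f0 (t n).1 - ratr q| < a.2 / 4.
    by move=> n; apply: rat_near; rewrite divr_gt0.
  have [d dP] : exists d : rat, `|a.2 / 2 - ratr d| < a.2 / 4.
    by apply: rat_near; rewrite divr_gt0.
  move: dP; rewrite ltr_norml => /andP[d1 d2].
  exists a.1, [seq q n | n <- a.1], d; split.
    move=> f [_ ff0] i; rewrite size_map => ia.
    rewrite (nth_map 0%N)// (nth_map 0%N)//.
    by rewrite ff0; [have := qP (nth 0%N a.1 i); lra|exists (nth 0%N a.1 i)].
  move=> f [fc f1]; apply: contrapT => nUf; apply: nbU; exists f; split=> // n na.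
  have := fc (index n a.1); rewrite size_map index_mem => /(_ na).
  rewrite (nth_map 0%N) ?index_mem// (nth_map 0%N) ?index_mem// nth_index//.
  have := ler_normB (f (t n).1 - ratr (q n)) (f0 (t n).1 - ratr (q n)).
  by rewrite opprB addrA subrK; have := qP n; lra.
exfalso.
have [|||||f Hf fcl] := @ball_fiber_cluster R Z (range (fst \o t)) f0 _
  [set a : seq nat * R | 0 < a.2] nb.
- by exists ([::], 1) => /=.
- move=> [s d] [s' d'] /= d0 d'0; exists (s ++ s', Num.min d d') => /=.
    by rewrite lt_min d0.
  move=> f [f1 ff nU]; split; split=> // n ns; have := ff n;
    by rewrite mem_cat ns ?orbT lt_min => /(_ isT)/andP[].
- by move=> a a0; apply: contrapT => h; apply: noa; exists a.
- by move=> a f _ [].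
- move=> _ d [n _ <-] d0; exists ([:: n], d) => //= f [_ ff _].
  by apply: ff; rewrite inE.
have [|g [_ _ nUg] Ug] := fcl ([::], 1) U _ oU (HU f Hf); first exact: ltr01.
exact: nUg.
Qed.

(** For a Hahn-Banach extension [f0] of [v], the selector value at a coded neighbourhood of the
    fiber belongs to the skeleton. It is within [e] of a functional that agrees with [v] on a dense
    subset of [L], hence on [L]. *)
Let t_approx1 (v : dual (subspace_type L)) (e : R) : `|v| <= 1 -> 0 < e ->
  exists n, forall x, `|(t n).2 (val x) - v x| <= e * `|x|.
Proof.
move=> v1 e0; have [f0 f0E f0v] := exists_dual_extension v.
have f01 : `|f0| <= 1 by exact: le_trans v1.
have [_ _ _ tsel _] := tP; have [N NP Nt] := tsel e e0.
have [|U [oU HU UP]] := NP (range (fst \o t)) f0; first by exists f0.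
have [ns [qs [d [HW WU]]]] := coded_neighbourhood f01 oU HU.
have [k kE] := Nt ns qs d; exists k => x; rewrite kE.
have [f [_ ff] fN] := UP _ HW WU.
have -> : v x = f (val x).
  rewrite -f0E; apply/eqP; rewrite -subr_eq0 -normr_le0.
  apply/ler_addgt0Pr => r r0; rewrite add0r.
  have r3 : 0 < r / (`|f0| + `|f| + 1) by rewrite divr_gt0// ltr_wpDl// addr_ge0.
  have [n nx] := t_dense (valP x) r3.
  have -> : f0 (val x) - f (val x) = (f - f0) ((t n).1 - val x).
    by rewrite dualBE !linearB/= (ff (t n).1); [ring|exists n].
  apply: (le_trans (normr_dual _ _)).
  have := ler_normB f f0; have := normr_ge0 f0; have := normr_ge0 f => fge f0ge ffo.
  apply: (@le_trans _ _ ((`|f0| + `|f| + 1) * (r / (`|f0| + `|f| + 1)))).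
    by rewrite ler_pM// ?(ltW nx)//; lra.
  by rewrite mulrC divfK// gt_eqF// ltr_wpDl// addr_ge0.
rewrite -dualBE; apply: (le_trans (normr_dual _ _)).
by rewrite ler_wpM2r.
Qed.

Let t_approx (v : dual (subspace_type L)) (e : R) : 0 < e ->
  exists n, forall x, `|(t n).2 (val x) - v x| <= e * `|x|.
Proof.
move=> e0; pose m := (Num.bound `|v|).+1.
have m0 : 0 < m%:R :> R by rewrite ltr0n.
have vm : `|v| <= m%:R.
  apply: (@le_trans _ _ (Num.bound `|v|)%:R); last by rewrite ler_nat.
  by rewrite ltW// archi_boundP.
have [||n nP] := @t_approx1 (m%:R^-1 *: v) (e / m%:R).
- by rewrite normrZ gtr0_norm ?invr_gt0// ler_pdivrMl// mulr1.
- exact: divr_gt0.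
have [k kE] := t_scale m%:R n; exists k => x.
have := nP x; rewrite kE dualZE ratr_nat dualZE mulrAC ler_pdivlMr// => h.
rewrite (_ : _ - _ = ((t n).2 (val x) - m%:R^-1 * v x) * m%:R).
  by rewrite normrM [`|m%:R|]gtr0_norm.
by field; rewrite gt_eqF.
Qed.

Definition dual_hull := [set y : dual Z | forall e, 0 < e ->
  exists n, `|(t n).2 - y| <= e].

Lemma dual_hullD y1 y2 : dual_hull y1 -> dual_hull y2 -> dual_hull (y1 + y2).
Proof.
move=> h1 h2 e e0; have e2 : 0 < e / 2 by rewrite divr_gt0.
have [i ie] := h1 _ e2; have [j je] := h2 _ e2.
have [_ tlin _ _ _] := tP; have [k kE] := tlin 1 i j; exists k.
rewrite kE /= rmorph1 scale1r opprD addrACA.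
by apply: (le_trans (ler_normD _ _)); lra.
Qed.

Lemma dual_hull_norm y c : 0 <= c -> dual_hull y ->
  (forall x : subspace_type L, `|y (val x)| <= c * `|x|) -> `|y| <= c.
Proof.
move=> c0 hy yc; apply/ler_addgt0Pr => e e0.
have e2 : 0 < e / 2 by rewrite divr_gt0.
have [n ne] := hy _ e2.
have : `|(t n).2| <= c + e / 2.
  apply: t_norm => [|x xL x1]; first by rewrite addr_ge0// ltW.
  have := yc (Subspace xL); rewrite subspace_normE/= ler_norml => /andP[_ h1].
  have : c * `|x| <= c by rewrite ler_piMr.
  have := le_dual_norm ((t n).2 - y) x; rewrite dualBE.
  have : `|(t n).2 - y| * `|x| <= e / 2 * 1 by rewrite ler_pM.
  lra.
have := ler_normB (t n).2 ((t n).2 - y); rewrite subKr; lra.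
Qed.

(** Successive approximations are close on [L], hence close in norm by [t_norm], so they converge in
    the whole dual and not merely on [L]. *)
Lemma dual_hull_extension (v : dual (subspace_type L)) :
  exists2 y, dual_hull y & forall x, y (val x) = v x.
Proof.
have /choice[k kP] : forall m : nat, exists n, forall x,
    `|(t n).2 (val x) - v x| <= 2^-1 ^+ m * `|x|.
  by move=> m; apply: t_approx; exact: half_exp_gt0.
have [|y yP] := @dual_geometric_limit _ _ (fun m => (t (k m)).2) 2.
  move=> m; have [i iE] := t_sub (k m.+1) (k m); rewrite -iE.
  have h0 := @half_exp_gt0 R m.
  apply: t_norm => [|x xL x1]; first by rewrite mulr_ge0// ltW.
  rewrite iE dualBE; have := kP m.+1 (Subspace xL); have := kP m (Subspace xL).
  rewrite exprS subspace_normE/= !ler_norml => /andP[h1 _] /andP[_ h2].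
  have : 2^-1 ^+ m * `|x| <= 2^-1 ^+ m by rewrite ler_piMr// ltW.
  lra.
exists y.
  move=> e e0; have [M MP] := half_exp_lt (2 * 2) e0; exists (k M).
  by apply: (le_trans (yP M)); rewrite ltW// MP.
move=> x; apply/eqP; rewrite -subr_eq0 -normr_le0.
apply/ler_addgt0Pr => e e0; rewrite add0r.
have [M /(_ M (leqnn M)) MP] := half_exp_lt (5 * `|x|) e0.
have := kP M x; have := normr_dual ((t (k M)).2 - y) (val x); rewrite dualBE.
have : `|(t (k M)).2 - y| * `|val x| <= 2 * 2 * 2^-1 ^+ M * `|x|.
  by rewrite ler_wpM2r.
have := ler_normB ((t (k M)).2 (val x) - v x) ((t (k M)).2 (val x) - y (val x)).
by rewrite opprB addrC addrA subrK; lra.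
Qed.

(** A violation with slope [e] at some [u] outside [L] survives, with a rational slope in
    [(e / 2, 3 * e / 4)], when [x] and [y] are replaced by members [p] and [f] of the skeleton. The
    skeleton then contains a witness in [L], which contradicts the inequality there with slope
    [e / 4]. *)
Lemma dual_hull_frechet j y (x : subspace_type L) : dual_hull y -> A j (val x) ->
  (forall e, 0 < e -> exists2 d, 0 < d & forall u : subspace_type L,
     A j (val u) -> `|u - x| < d -> y (val u - val x) <= e * `|u - x|) ->
  frechet_normal (A j) (val x) y.
Proof.
move=> hy Ax yx; apply/frechet_normalP; split=> // e e0.
have e4 : 0 < e / 4 by rewrite divr_gt0.
have e_half : e / 2 < 3 * e / 4 by lra.
have [d d0 dP] := yx _ e4; exists (d / 2); first by rewrite divr_gt0.
move=> u Au ud; rewrite leNgt; apply/negP => eu.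
set x0 := val x in Ax dP ud eu.
set r := `|u - x0| in ud eu.
have r0 : 0 < r.
  rewrite lt_def normr_ge0 andbT; apply/eqP => r0; move: eu.
  by move/eqP: (r0); rewrite normr_eq0 => /eqP ->; rewrite r0 linear0 mulr0 ltxx.
have r_half : r / 2 < 3 * r / 4 by lra.
have r_large : 5 * r / 4 < 3 * r / 2 by lra.
have ye0 : 0 < `|y| + e by rewrite ltr_wpDl.
(* The first term keeps distances to [p] within the window from [a] to [b], the second bounds the
   change of the values by [e * r / 16]. *)
pose eta := Num.min (r / 8) (e * r / 16 / (`|y| + e)).
have eta0 : 0 < eta by rewrite lt_min !divr_gt0 ?mulr_gt0.
have eta1 : eta <= r / 8 by rewrite ge_min lexx.
have eta2 : `|y| * eta + e * eta <= e * r / 16.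
  by rewrite -mulrDl mulrC -ler_pdivlMr// ge_min lexx orbT.
have [m mx] := t_dense (valP x) eta0; rewrite -/x0 in mx.
have e8 : 0 < e / 8 by rewrite divr_gt0.
have [n ny] := hy _ e8.
set p := (t m).1 in mx; set f := (t n).2 in ny.
have fy z : f z - y z <= e / 8 * `|z| /\ y z - f z <= e / 8 * `|z|.
  have := normr_dual (f - y) z; rewrite dualBE ler_norml => /andP[h1 h2].
  have : `|f - y| * `|z| <= e / 8 * `|z| by rewrite ler_wpM2r.
  by split; lra.
have px z : y (z - p) = y (z - x0) - y (p - x0).
  by rewrite !linearB/=; ring.
have ypx : `|y (p - x0)| <= `|y| * eta.
  by apply: (le_trans (normr_dual _ _)); rewrite ler_wpM2l// ltW.
have [ypx1 ypx2] : y (p - x0) <= `|y| * eta /\ - (`|y| * eta) <= y (p - x0).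
  by move: ypx; rewrite ler_norml => /andP[].
have dist_p z : `|z - p| <= `|z - x0| + eta /\ `|z - x0| <= `|z - p| + eta.
  have := ler_normB (z - x0) (p - x0); have := ler_normD (z - p) (p - x0).
  rewrite opprB addrA subrK addrA subrK; lra.
have [e'] := rat_in_itvoo e_half; rewrite in_itv/= => /andP[e'1 e'2].
have [a] := rat_in_itvoo r_half; rewrite in_itv/= => /andP[a1 a2].
have [b] := rat_in_itvoo r_large; rewrite in_itv/= => /andP[b1 b2].
have e'0 : 0 <= ratr e' :> R by rewrite ltW// (lt_trans _ e'1)// divr_gt0.
have [_ _ _ _ twit] := tP.
have [|k [Ak fk /andP[ak bk]]] := twit j m n e' a b.
  have [up1 up2] := dist_p u; rewrite -/r in up1 up2.
  exists u; rewrite -/p -/f; split=> //; last exact: (steep_window r0 eta1 up1 up2 a2 b1).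
  apply: (steep_transfer e0 r0 eta0 _ e'0 e'2 eta2 up1 ypx1 _ eu) => //.
  by rewrite -px; exact: (fy (u - p)).2.
have [s1 s2] := dist_p (t k).1.
have := dP (Subspace (tL k)) Ak; rewrite !subspace_normE/= -/x0.
move=> /(_ _)/wrap[].
  exact: (steep_near r0 eta1 ud b2 bk s2).
move=> yk; apply: (steep_contradiction e0 r0 eta0 e'1 (lt_trans a1 ak) eta2 s2 ypx2 _ yk fk).
by rewrite -px; exact: (fy ((t k).1 - p)).1.
Qed.

End from_skeleton.
End separable_reduction.

(** * A smooth norm on a space with separable dual *)

Section weak_star_lsc.
Context {R : realType} {E : normedModType R}.
Implicit Types (p q : dual E -> R) (f : dual E).

Definition weak_star_lsc p := forall c, weak_star_open [set f | c < p f].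

Lemma weak_star_lscD p q : weak_star_lsc p -> weak_star_lsc q ->
  weak_star_lsc (fun f => p f + q f).
Proof.
move=> lp lq c f /= cf; pose s := (p f + q f - c) / 2.
have s0 : 0 < s by rewrite divr_gt0// subr_gt0.
have := weak_star_openI (lp (p f - s)) (lq (q f - s)).
case/(_ f) => [|t [d [d0 tP]]]; first by split=> /=; lra.
by exists t, d; split=> // g /tP[/=]; rewrite /s; lra.
Qed.

Lemma weak_star_lscZ a p : 0 < a -> weak_star_lsc p ->
  weak_star_lsc (fun f => a * p f).
Proof.
move=> a0 lp c; rewrite (_ : [set f | _] = [set f | a^-1 * c < p f]); first exact: lp.
by apply/seteqP; split=> f /=; rewrite ltr_pdivrMl.
Qed.

Lemma weak_star_lsc_sqr p : (forall f, 0 <= p f) -> weak_star_lsc p ->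
  weak_star_lsc (fun f => p f ^+ 2).
Proof.
move=> p0 lp c; have [c0|c0] := ltP c 0.
  rewrite (_ : [set f | _] = setT); first exact: weak_star_openT.
  by apply/seteqP; split=> f //= _; apply: lt_le_trans c0 _; exact: sqr_ge0.
rewrite (_ : [set f | _] = [set f | Num.sqrt c < p f]); first exact: lp.
have sqE f : (c < p f ^+ 2) = (Num.sqrt c < p f).
  by rewrite -[in LHS](sqr_sqrtr c0) ltr_sqr ?nnegrE ?sqrtr_ge0.
by apply/seteqP; split=> f /=; rewrite sqE.
Qed.

Lemma weak_star_lsc_sum n (p : nat -> dual E -> R) :
  (forall k, weak_star_lsc (p k)) -> weak_star_lsc (fun f => \sum_(k < n) p k f).
Proof.
move=> lp; elim: n => [|n IH] c f /= cf.
  exists [::], 1; split=> // g _ /=; move: cf; by rewrite !big_ord0.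
have := weak_star_lscD IH (lp n) (c := c); case/(_ f) => [|t [d [d0 tP]]].
  by move: cf; rewrite /= big_ord_recr.
by exists t, d; split=> // g /tP /=; rewrite big_ord_recr.
Qed.

End weak_star_lsc.

Section sup_seminorm.
Context {R : realType} {E : normedModType R} (C : set E).
Hypothesis C1 : forall x, C x -> `|x| <= 1.
Hypothesis C0 : C 0.
Implicit Types f g : dual E.

Definition sup_on f := sup [set `|f x| | x in C].

Let hs f : has_sup [set `|f x| | x in C].
Proof.
split; first by exists `|f 0|, 0.
exists `|f| => _ [x Cx <-]; apply: (le_trans (normr_dual _ _)).
by rewrite ler_piMr// C1.
Qed.

Lemma sup_on_ub f x : C x -> `|f x| <= sup_on f.
Proof. by move=> Cx; apply: sup_upper_bound => //; exists x. Qed.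

Lemma sup_on_le f c : (forall x, C x -> `|f x| <= c) -> sup_on f <= c.
Proof. by move=> h; apply: ge_sup; [case: (hs f)|move=> _ [x Cx <-]; exact: h]. Qed.

Lemma sup_on_ge0 f : 0 <= sup_on f.
Proof. by apply: le_trans (sup_on_ub f C0). Qed.

Lemma sup_on_le_norm f : sup_on f <= `|f|.
Proof.
apply: sup_on_le => x Cx; apply: (le_trans (normr_dual _ _)).
by rewrite ler_piMr// C1.
Qed.

Lemma sup_on_mid f g : sup_on (2^-1 *: (f + g)) <= (sup_on f + sup_on g) / 2.
Proof.
apply: sup_on_le => x Cx; rewrite dualZE dualDE normrM ger0_norm ?(ltW half_gt0)//.
have := ler_normD (f x) (g x); have := sup_on_ub f Cx; have := sup_on_ub g Cx.
lra.
Qed.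

Lemma sup_on_lsc : weak_star_lsc sup_on.
Proof.
move=> c f /= cf; have c0 : 0 < sup_on f - c by rewrite subr_gt0.
have [_ [x Cx <-]] := sup_adherent c0 (hs f).
rewrite -/(sup_on f) subKr => cx.
exists [:: x], (`|f x| - c); split; first by rewrite subr_gt0.
move=> g /(_ x); rewrite inE eqxx => /(_ isT) gx.
apply: lt_le_trans (sup_on_ub g Cx).
by have := ler_normB (g x) (g x - f x); rewrite subKr; lra.
Qed.

End sup_seminorm.

Section total_boundedness.
Context {R : realType} {E : normedModType R} (u : nat -> dual E) (eta : R).
Hypothesis eta0 : 0 < eta.

(** Induction on the number of functionals: [u n] is bounded on [S], so it sorts [S] into finitely
    many bins of width [eta], each with a net for the earlier functionals. *)
Lemma finite_net n (S : set E) : (forall x, S x -> `|x| <= 1) ->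
  exists ys : seq E, (forall y, y \in ys -> S y) /\
    forall x, S x -> exists2 y, y \in ys &
      forall i, (i < n)%N -> `|u i x - u i y| <= eta.
Proof.
elim: n S => [|n IH] S S1.
  have [[x0 Sx0]|h] := pselect (S !=set0); last first.
    by exists [::]; split=> // x Sx; exfalso; apply: h; exists x.
  exists [:: x0]; split=> [y|x Sx]; first by rewrite inE => /eqP ->.
  by exists x0; rewrite ?inE.
pose bin (x : E) := Num.truncn ((u n x + `|u n|) / eta).
have /choice[ys ysP] : forall j, exists ys : seq E,
    (forall y, y \in ys -> S y /\ bin y = j) /\
    forall x, S x /\ bin x = j -> exists2 y, y \in ys &
      forall i, (i < n)%N -> `|u i x - u i y| <= eta.
  by move=> j; apply: (IH [set x | S x /\ bin x = j]) => x [Sx _]; exact: S1.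
pose K := (Num.truncn (2 * `|u n| / eta)).+1.
exists (flatten [seq ys j | j <- iota 0 K]); split.
  by move=> y /flatten_mapP[j _ /(ysP j).1[]].
move=> x Sx; have [_ /(_ x)] := ysP (bin x); case=> // y yx yn.
have un z : S z -> 0 <= u n z + `|u n| <= 2 * `|u n|.
  move=> Sz; have := le_trans (normr_dual (u n) z) (ler_piMr (normr_ge0 _) (S1 z Sz)).
  by rewrite ler_norml => /andP[h1 h2]; apply/andP; split; lra.
have bin_bound z : S z -> (bin z)%:R * eta <= u n z + `|u n| < (bin z).+1%:R * eta.
  move=> Sz; have /andP[h1 _] := un z Sz.
  have := truncn_itv (divr_ge0 h1 (ltW eta0)).
  by rewrite ler_pdivlMr// ltr_pdivrMr.
exists y.
  apply/flatten_mapP; exists (bin x) => //; rewrite mem_iota add0n leq0n /= ltnS.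
  apply: le_truncn; rewrite ler_pM2r ?invr_gt0//.
  by case/andP: (un x Sx).
have [Sy yb] := (ysP (bin x)).1 y yx.
move=> i; rewrite ltnS leq_eqVlt => /orP[/eqP ->|]; last exact: yn.
have := bin_bound x Sx; have := bin_bound y Sy; rewrite yb.
rewrite -[(bin x).+1]addn1 natrD mulrDl mul1r => /andP[h1 h2] /andP[h3 h4].
by rewrite ler_norml; apply/andP; split; lra.
Qed.

End total_boundedness.

Section smooth_square.
Context {R : realType} {E : normedModType R}.
Variables (xs : nat -> E) (es : nat -> dual E).
Hypothesis xs_dense : forall x e, 0 < e -> exists n, `|xs n - x| < e.
Hypothesis es_dense : forall f e, 0 < e -> exists n, `|es n - f| < e.
Implicit Types f g : dual E.

(** Two points of the unit ball with nearly equal values of [es 0], ..., [es n] differ by an element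
    of twice [C n]. So [q n] controls a functional up to its values on a finite net, while [q n f]
    is small for suitable [n]. *)
Let C n := [set x : E | `|x| <= 1 /\ forall i, (i <= n)%N -> `|es i x| <= 2^-1 ^+ n].

Let C1 n x : C n x -> `|x| <= 1. Proof. by case. Qed.

Let C0 n : C n 0.
Proof.
by split=> [|i _]; rewrite ?linear0 normr0// ltW// half_exp_gt0.
Qed.

Let q n := sup_on (C n).

Let q_small f e : 0 < e -> exists n, q n f <= e.
Proof.
move=> e0; have e2 : 0 < e / 2 by rewrite divr_gt0.
have [i ie] := es_dense f e2.
have [N NP] := half_exp_lt 1 e2.
exists (maxn i N); apply: sup_on_le; [exact: C1|exact: C0|move=> x [x1 xe]].
have := NP _ (leq_maxr i N); have := xe i (leq_maxl i N).
have := normr_dual (es i - f) x; rewrite dualBE mul1r.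
have : `|es i - f| * `|x| <= e / 2 * 1 by rewrite ler_pM// ltW.
have := ler_normB (es i x) (es i x - f x); rewrite subKr; lra.
Qed.

Let y n := (1 + `|xs n|)^-1 *: xs n.

Let xs1 n : 0 < 1 + `|xs n|. Proof. by rewrite ltr_pwDl. Qed.

Let y1 n : `|y n| <= 1.
Proof.
by rewrite normrZ gtr0_norm ?invr_gt0// ler_pdivrMl// mulr1 lerDr.
Qed.

Let Q k f := q k f ^+ 2 + `|f (y k)| ^+ 2.

Let Q_ge0 k f : 0 <= Q k f. Proof. by rewrite addr_ge0 ?sqr_ge0. Qed.

Let Q_le k f : Q k f <= 2 * `|f| ^+ 2.
Proof.
rewrite /Q mulr_natl mulr2n lerD// ler_sqr ?nnegrE//.
- exact: sup_on_le_norm (@C1 k) (C0 k) _.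
- exact: sup_on_ge0 (@C1 k) (C0 k) _.
- by apply: (le_trans (normr_dual _ _)); rewrite ler_piMr.
Qed.

Let mid f g : dual E := 2^-1 *: (f + g).

Let sqr_mid (a b m : R) : 0 <= m -> m <= (a + b) / 2 ->
  m ^+ 2 + (a - b) ^+ 2 / 4 <= (a ^+ 2 + b ^+ 2) / 2.
Proof.
move=> m0 mab; have : m ^+ 2 <= ((a + b) / 2) ^+ 2.
  by rewrite ler_sqr// nnegrE// (le_trans m0).
by rewrite !expr2; lra.
Qed.

Let Q_mid k f g :
  Q k (mid f g) + ((q k f - q k g) ^+ 2 + (f (y k) - g (y k)) ^+ 2) / 4 <=
  (Q k f + Q k g) / 2.
Proof.
have h1 := sqr_mid (sup_on_ge0 (@C1 k) (C0 k) (mid f g))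
  (sup_on_mid (@C1 k) (C0 k) f g).
have : `|mid f g (y k)| ^+ 2 + (f (y k) - g (y k)) ^+ 2 / 4 =
    (`|f (y k)| ^+ 2 + `|g (y k)| ^+ 2) / 2.
  by rewrite !real_normK ?num_real// dualZE dualDE !expr2; field.
by rewrite /Q -/(q k) in h1 *; lra.
Qed.

Let S m f := `|f| ^+ 2 + \sum_(k < m) 2^-1 ^+ k * Q k f.

Let S_mono m n f : (m <= n)%N -> S m f <= S n f.
Proof.
move=> mn; rewrite -(subnK mn) lerD2l; elim: (n - m)%N => // j IH.
rewrite addSn big_ord_recr/=; apply: le_trans IH _; rewrite lerDl.
by rewrite mulr_ge0 ?Q_ge0// ltW// half_exp_gt0.
Qed.

Let S_le m f : S m f <= 5 * `|f| ^+ 2.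
Proof.
have : \sum_(k < m) 2^-1 ^+ k * Q k f <= \sum_(k < m) 2^-1 ^+ k * (2 * `|f| ^+ 2).
  by apply: ler_sum => k _; rewrite ler_wpM2l// ltW// half_exp_gt0.
rewrite -mulr_suml => h; rewrite /S.
have : (\sum_(k < m) 2^-1 ^+ k) * (2 * `|f| ^+ 2) <= 2 * (2 * `|f| ^+ 2).
  by rewrite ler_wpM2r ?sum_half_exp_le// mulr_ge0// sqr_ge0.
lra.
Qed.

Let S_mid m k f g : (k < m)%N -> S m (mid f g) +
  2^-1 ^+ k * (((q k f - q k g) ^+ 2 + (f (y k) - g (y k)) ^+ 2) / 4) <=
  (S m f + S m g) / 2.
Proof.
move=> km; have nf : `|mid f g| ^+ 2 <= (`|f| ^+ 2 + `|g| ^+ 2) / 2.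
  have := @sqr_mid `|f| `|g| `|mid f g| (normr_ge0 _).
  have := sqr_ge0 (`|f| - `|g|).
  have : `|mid f g| <= (`|f| + `|g|) / 2.
    rewrite normrZ gtr0_norm ?half_gt0//; have := ler_normD f g; lra.
  by move=> h1 h2 /(_ h1); lra.
have -> : (S m f + S m g) / 2 = (`|f| ^+ 2 + `|g| ^+ 2) / 2 +
    \sum_(k < m) 2^-1 ^+ k * ((Q k f + Q k g) / 2).
  rewrite /S addrACA mulrDl -big_split/= mulr_suml; congr (_ + _).
  by apply: eq_bigr => i _; rewrite -mulrDr mulrA.
rewrite /S -addrA lerD// (bigD1 (Ordinal km))//= [leRHS](bigD1 (Ordinal km))//=.
rewrite addrAC -mulrDr lerD//.
  by rewrite ler_wpM2l ?Q_mid// ltW// half_exp_gt0.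
apply: ler_sum => i _; rewrite ler_wpM2l ?(ltW (half_exp_gt0 _))//.
by apply: le_trans (Q_mid i f g); rewrite lerDl divr_ge0// addr_ge0 ?sqr_ge0.
Qed.

Let S_lsc m : weak_star_lsc (S m).
Proof.
apply: weak_star_lscD.
  apply: weak_star_lsc_sqr => [f|]; first exact: normr_ge0.
  apply: (@sup_on_lsc R E [set x | `|x| <= 1]) => //=.
  by rewrite normr0.
apply: (@weak_star_lsc_sum _ _ m (fun k f => 2^-1 ^+ k * Q k f)) => k.
apply: weak_star_lscZ; first exact: half_exp_gt0.
apply: weak_star_lscD.
  apply: weak_star_lsc_sqr => [f|]; first exact: sup_on_ge0 (@C1 k) (C0 k) _.
  exact: sup_on_lsc (@C1 k) (C0 k).
apply: (@weak_star_lsc_sqr _ _ (fun f => `|f (y k)|)) => // c f /= cf.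
exists [:: y k], (`|f (y k)| - c); split; first by rewrite subr_gt0.
move=> g /(_ (y k)); rewrite inE eqxx => /(_ isT) gx.
by have := ler_normB (g (y k)) (g (y k) - f (y k)); rewrite subKr; lra.
Qed.

(* A weak* lower semicontinuous square norm on the dual which is locally
   uniformly convex thanks to the seminorms [q k]: they vanish asymptotically on
   each functional of the dense sequence [es]. *)
Let G f := sup [set S m f | m in setT].

Let hsG f : has_sup [set S m f | m in setT].
Proof.
split; first by exists (S 0 f), 0%N.
by exists (5 * `|f| ^+ 2) => _ [m _ <-]; exact: S_le.
Qed.

Let S_G m f : S m f <= G f.
Proof. by apply: sup_upper_bound => //; exists m. Qed.

Let G_le f c : (forall m, S m f <= c) -> G f <= c.
Proof. by move=> h; apply: ge_sup; [case: (hsG f)|move=> _ [m _ <-]]. Qed.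

Let G_ge f : `|f| ^+ 2 <= G f.
Proof. by apply: le_trans (S_G 0 f); rewrite /S big_ord0 addr0. Qed.

Let G_le5 f : G f <= 5 * `|f| ^+ 2. Proof. by apply: G_le => m; exact: S_le. Qed.

(** The convexity defect of a square at a midpoint survives in the [k]-th term; the stage is raised
    beyond [k] so that this term is present. *)
Let G_mid k f g : G (mid f g) +
  2^-1 ^+ k * (((q k f - q k g) ^+ 2 + (f (y k) - g (y k)) ^+ 2) / 4) <=
  (G f + G g) / 2.
Proof.
rewrite -lerBrDr; apply: G_le => m.
apply: le_trans (S_mono _ (leq_maxl m k.+1)) _.
have := S_mid f g (leq_maxr m k.+1).
have := S_G (maxn m k.+1) f; have := S_G (maxn m k.+1) g; lra.
Qed.

Let G_lsc : weak_star_lsc G.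
Proof.
move=> c f /= cf; have c0 : 0 < G f - c by rewrite subr_gt0.
have [_ [m _ <-]] := sup_adherent c0 (hsG f); rewrite -/(G f) subKr => cS.
have [s [d [d0 sP]]] := @S_lsc m c f cS.
by exists s, d; split=> // g /sP /= /lt_le_trans; apply.
Qed.

Let gf x f := f x - G f.
(** The Fenchel conjugate of [G]: local uniform convexity of [G] becomes Frechet smoothness of [g],
    and the bounds 1 and 5 for [G] become 1/4 and 1/20. *)
Let g x := sup [set gf x f | f in setT].

Let gf_le x f : gf x f <= `|x| ^+ 2 / 4.
Proof.
have := le_dual_norm f x; have := G_ge f; have := sqr_ge0 (`|f| - `|x| / 2).
by rewrite /gf !expr2; lra.
Qed.

Let hsg x : has_sup [set gf x f | f in setT].
Proof.
split; first by exists (gf x 0), 0.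
by exists (`|x| ^+ 2 / 4) => _ [f _ <-].
Qed.

Let gf_g x f : gf x f <= g x.
Proof. by apply: sup_upper_bound => //; exists f. Qed.

Let g_le x : g x <= `|x| ^+ 2 / 4.
Proof. by apply: ge_sup; [case: (hsg x)|move=> _ [f _ <-]]. Qed.

Let g_ge x : `|x| ^+ 2 / 20 <= g x.
Proof.
(* The factor [|x| / 10] maximizes [s * |x| - 5 * s ^+ 2]. *)
have [f f1 fx] := norm_attaining x.
apply: le_trans (gf_g x ((`|x| / 10) *: f)); rewrite /gf dualZE fx.
have := G_le5 ((`|x| / 10) *: f); rewrite normrZ ger0_norm ?divr_ge0// => h.
have : (`|x| / 10 * `|f|) ^+ 2 <= (`|x| / 10) ^+ 2.
  by rewrite ler_sqr ?nnegrE ?mulr_ge0 ?divr_ge0// ler_piMr// divr_ge0.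
by rewrite !expr2 in h *; lra.
Qed.

Let g_ge0 x : 0 <= g x.
Proof. by apply: le_trans (g_ge x); rewrite divr_ge0// sqr_ge0. Qed.

Let near_max_bound x f d : d <= 1 -> g x - d < gf x f -> `|f| <= `|x| + 1.
Proof.
move=> d1 h; rewrite leNgt; apply/negP => xf.
have := le_dual_norm f x; have := G_ge f; have := g_ge0 x; rewrite /gf in h.
have : 0 <= `|x| by [].
rewrite expr2; nra.
Qed.

(** Almost maximizers are bounded and [f x - G f] is weak* upper semicontinuous in [f], so a weak*
    cluster point attains the supremum. *)
Let exists_max x : exists f, gf x f = g x.
Proof.
have [||||f _ fcl] := @weak_star_cluster R E R [set d | 0 < d <= 1]
  (fun d => [set f | g x - d < gf x f]) (`|x| + 1).
- by exists 1; rewrite /= ltr01 lexx.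
- move=> d d' /andP[d0 d1] /andP[d'0 d'1]; exists (Num.min d d').
    by rewrite /= lt_min d0 d'0 ge_min d1.
  move=> f /= h; split; apply: le_lt_trans h; rewrite lerD2l lerN2 ge_min lexx//.
  by rewrite orbT.
- by move=> d /andP[d0 _]; have [_ [f _ <-] fd] := sup_adherent d0 (hsg x); exists f.
- by move=> d f /andP[_ d1]; exact: near_max_bound.
exists f; apply/le_anti; rewrite gf_g/= leNgt; apply/negP => h.
pose s := g x - gf x f; have s0 : 0 < s by rewrite subr_gt0.
have oU := weak_star_openI (@G_lsc (G f - s / 2)) (@weak_star_open_lt _ _ x (f x + s / 4)).
have [|t [d [d0 tP]]] := oU f.
  by split=> /=; lra.
pose dl := Num.min (s / 4) 1.
have dl0 : 0 < dl by rewrite lt_min ltr01 divr_gt0.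
have [|f' /= hf' /tP[/= h1 h2]] := fcl t d dl d0.
  by rewrite /= dl0 ge_min lexx orbT.
have : dl <= s / 4 by rewrite ge_min lexx.
have sE : s = g x - (f x - G f) by [].
rewrite /gf in hf'; lra.
Qed.

Let sqr_le (a b : R) : 0 <= b -> a ^+ 2 <= b ^+ 2 -> `|a| <= b.
Proof. by move=> b0 ab; rewrite -ler_sqr ?nnegrE// real_normK// num_real. Qed.

Let finite_min (s : seq E) (p : E -> R) : (forall z, 0 < p z) ->
  exists2 d, 0 < d & forall z, z \in s -> d <= p z.
Proof.
move=> p0; elim: s => [|z s [d d0 IH]]; first by exists 1.
exists (Num.min (p z) d); first by rewrite lt_min p0.
move=> w; rewrite inE => /orP[/eqP ->|/IH]; first by rewrite ge_min lexx.
by rewrite ge_min orbC => ->.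
Qed.

(** The midpoint of [f'] and [f] cannot beat the maximum, so all convexity defects are at most of
    order [d]. This brings [q n f'] close to the small number [q n f], and the values of [f'] close
    to those of [f] at finitely many vectors near the net. *)
Let strong_max x f e : gf x f = g x -> 0 < e ->
  exists2 d, 0 < d & forall f', g x - d < gf x f' -> `|f' - f| <= e.
Proof.
move=> fmax e0.
have e32 : 0 < e / 32 by rewrite divr_gt0.
have [n qn] := q_small f e32.
have [ys [ys1 ysP]] := @finite_net R E es (2^-1 ^+ n) (half_exp_gt0 n) n.+1
  [set z | `|z| <= 1] (fun z h => h).
pose M := 2 * `|x| + 2.
have M0 : 0 < M by rewrite ltr_wpDl// mulr_ge0.
have eM : 0 < e / 8 / M by rewrite !divr_gt0.
have /choice[ky kyP] : forall z, exists k, `|xs k - z| < e / 8 / M.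
  by move=> z; exact: xs_dense.
(* For [d <= p z] the defect at index [ky z] forces a difference of at most [e / 8] at [xs (ky z)],
   once the scaling of [y] is undone. *)
pose p z := 2^-1 ^+ ky z * (e / 8) ^+ 2 / (2 * (1 + `|xs (ky z)|) ^+ 2).
have p0 z : 0 < p z.
  by rewrite divr_gt0// mulr_gt0 ?half_exp_gt0 ?exprn_gt0 ?divr_gt0.
have [d1 d10 d1P] := finite_min ys p0.
pose d := Num.min (Num.min 1 d1) (2^-1 ^+ n * (e / 32) ^+ 2 / 2).
have d0 : 0 < d.
  by rewrite !lt_min ltr01 d10 divr_gt0// mulr_gt0 ?half_exp_gt0// exprn_gt0.
have [dle1 dled1 dlen] : [/\ d <= 1, d <= d1 & d <= 2^-1 ^+ n * (e / 32) ^+ 2 / 2].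
  by split; rewrite !ge_min lexx ?orbT.
exists d => // f' f'd.
have fM : `|f' - f| <= M.
  have hf : g x - d < gf x f by rewrite fmax; lra.
  have := near_max_bound dle1 hf; have := near_max_bound dle1 f'd.
  by have := ler_normB f' f; rewrite /M; lra.
have deficit k : 2^-1 ^+ k * ((q k f' - q k f) ^+ 2 + (f' (y k) - f (y k)) ^+ 2) <= 2 * d.
  have := G_mid k f' f; have := gf_g x (mid f' f).
  rewrite /gf dualZE dualDE in fmax f'd *; lra.
have qf' : q n f' <= e / 16.
  have : `|q n f' - q n f| <= e / 32.
    apply: sqr_le; first exact: ltW.
    rewrite -(ler_pM2l (half_exp_gt0 n)).
    apply: (@le_trans _ _ (2 * d)); last by lra.
    by apply: le_trans (deficit n); rewrite ler_wpM2l ?(ltW (half_exp_gt0 _))// lerDl sqr_ge0.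
  by rewrite ler_norml => /andP[_]; lra.
have fxs z : z \in ys -> `|(f' - f) (xs (ky z))| <= e / 8.
  move=> zys; set k := ky z.
  have xsE : xs k = (1 + `|xs k|) *: y k.
    by rewrite scalerA mulfV ?scale1r// gt_eqF.
  apply: sqr_le; first by rewrite divr_ge0// ltW.
  rewrite xsE linearZ/= exprMn -(ler_pM2l (half_exp_gt0 k)).
  rewrite mulrCA.
  apply: (@le_trans _ _ ((1 + `|xs k|) ^+ 2 * (2 * d))).
    rewrite ler_wpM2l ?sqr_ge0//; apply: le_trans (deficit k).
    by rewrite ler_wpM2l ?(ltW (half_exp_gt0 _))// lerDr sqr_ge0.
  have := le_trans dled1 (d1P z zys); rewrite /p -/k ler_pdivlMr; last first.
    by rewrite mulr_gt0// exprn_gt0.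
  lra.
apply: dual_norm_le => z z1.
have [w wys zw] := ysP z z1.
have w1 : `|w| <= 1 := ys1 w wys.
have Cn : C n (2^-1 *: (z - w)).
  split=> [|i ni].
    rewrite normrZ gtr0_norm ?half_gt0//; have := ler_normB z w; lra.
  rewrite linearZ/= normrM gtr0_norm ?half_gt0// linearB/=.
  by have := zw i ni; have := @half_exp_gt0 R n; lra.
have h1 := sup_on_ub (@C1 n) (C0 n) f Cn; have h2 := sup_on_ub (@C1 n) (C0 n) f' Cn.
have h3 : `|(f' - f) (z - w)| <= 2 * (e / 16 + e / 32).
  rewrite (_ : z - w = 2 *: (2^-1 *: (z - w))); last first.
    by rewrite scalerA mulfV ?scale1r// gt_eqF.
  rewrite linearZ/= normrM [`|2|]gtr0_norm// ler_pM2l//.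
  by apply: (le_trans (ler_normB _ _)); rewrite -/(q n) in h1 h2; lra.
have h4 : `|(f' - f) (w - xs (ky w))| <= e / 8.
  apply: (le_trans (normr_dual _ _)); rewrite [`|w - _|]distrC.
  apply: (@le_trans _ _ (M * (e / 8 / M))).
    by rewrite ler_pM// ltW.
  by rewrite mulrC divfK// gt_eqF.
(* The first summand is controlled by [q n], the second by the bound [M] on [f' - f], the third by
   the defects at the net. *)
rewrite (_ : z = (z - w) + (w - xs (ky w)) + xs (ky w)); last first.
  by rewrite addrA !subrK.
move: (f' - f) (fxs w wys) h3 h4 => k k1 k2 k3.
rewrite (linearD k (_ + _)) (linearD k (z - w)); apply: (le_trans (ler_normD _ _)).
have := ler_normD (k (z - w)) (k (w - xs (ky w))); lra.
Qed.

(** [D x] is the maximizer at [x]. Smoothness is Smulian's argument: a maximizer at [x + h] up to an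
    error proportional to [|h|] almost maximizes at [x], so it is norm close to [D x], and this
    distance is the error of the slope. *)
Theorem exists_smooth_square : exists (sq : E -> R) (D : E -> dual E),
  [/\ forall x, `|x| ^+ 2 / 20 <= sq x, forall x, sq x <= `|x| ^+ 2,
      forall x, `|D x| <= `|x|, forall x z, sq x + D x (z - x) <= sq z &
      forall x e, 0 < e -> exists2 d, 0 < d & forall h, `|h| < d ->
        sq (x + h) <= sq x + D x h + e * `|h|].
Proof.
have [D DP] := choice exists_max.
exists g, D; split=> [|x|x|x z|x e e0].
- exact: g_ge.
- by apply: (le_trans (g_le x)); have := sqr_ge0 `|x|; lra.
- have := DP x; have := g_ge0 x; have := G_ge (D x); have := le_dual_norm (D x) x.
  rewrite /gf => h1 h2 h3 h4.
  have [->|D0] := eqVneq `|D x| 0; first exact: normr_ge0.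
  have {}D0 : 0 < `|D x| by rewrite lt_def D0 /=.
  by rewrite -(ler_pM2l D0) -expr2; lra.
- by apply: le_trans (gf_g z (D x)); rewrite -(DP x) /gf linearB/=; lra.
have e2 : 0 < e / 2 by rewrite divr_gt0.
have [d d0 dP] := strong_max (DP x) e2.
(* Passing from [x + h] to [x] costs at most [M * |h|], by the bounds [|x| + 1] on [D x] and
   [|x| + 2] on [f]. *)
pose M := 2 * `|x| + 3 + e.
have M0 : 0 < M by rewrite ltr_wpDl// addr_ge0// mulr_ge0.
pose r := Num.min (Num.min 1 (1 / e)) (d / M).
have r0 : 0 < r by rewrite !lt_min ltr01 !divr_gt0.
have [r1 re rd] : [/\ r <= 1, r <= 1 / e & r <= d / M].
  by split; rewrite !ge_min lexx ?orbT.
exists r => // h hr.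
have [->|h0] := eqVneq h 0.
  by rewrite addr0 linear0 normr0 mulr0 !addr0.
have {}h0 : 0 < `|h| by rewrite normr_gt0.
pose s := e / 2 * `|h|; have s0 : 0 < s by rewrite mulr_gt0.
have s1 : s <= 1.
  have : `|h| <= 1 / e by rewrite ltW// (lt_le_trans hr).
  by rewrite ler_pdivlMr// /s; lra.
have [_ [f _ <-] fs] := sup_adherent s0 (hsg (x + h)).
rewrite -/(g _) in fs.
have f1 : `|f| <= `|x| + 2.
  have := near_max_bound s1 fs; have := ler_normD x h; have := ltW hr; lra.
have Dx : `|D x| <= `|x| + 1.
  by apply: (near_max_bound (lexx 1)); rewrite DP; lra.
have gxh : g x + D x h <= g (x + h).
  by apply: le_trans (gf_g (x + h) (D x)); rewrite -(DP x) /gf linearD/=; lra.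
have bnd (k : dual E) c : `|k| <= c -> - (c * `|h|) <= k h <= c * `|h|.
  move=> kc; rewrite -ler_norml; apply: (le_trans (normr_dual _ _)).
  by rewrite ler_wpM2r.
have /andP[D1 D2] := bnd _ _ Dx; have /andP[f2 f3] := bnd _ _ f1.
have fd : `|f - D x| <= e / 2.
  apply: dP; have : M * `|h| < d.
    by rewrite mulrC -ltr_pdivlMr// (lt_le_trans hr).
  have sE : s = e / 2 * `|h| by [].
  move: fs; rewrite /M /gf linearD/=; lra.
have /andP[_ fDh] := bnd _ _ fd; rewrite dualBE in fDh.
have := gf_g x f; move: fs; rewrite /s /gf linearD/=; lra.
Qed.

End smooth_square.

(** * Separation with Frechet normals *)

Section subspace_complete.
Context {R : realType} {Z : normedModType R} (L : submodClosed Z).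

Lemma cvg_subspace (u : nat -> subspace_type L) (x : subspace_type L) :
  val (u n) @[n --> \oo] --> val x -> u n @[n --> \oo] --> x.
Proof. by move=> /cvgrPdist_lt h; apply/cvgrPdist_lt. Qed.

Lemma geometric_complete_subspace : closed [set x | x \in L] ->
  geometric_complete Z -> geometric_complete (subspace_type L).
Proof.
move=> cL cZ u r ur; have [x ux] := cZ (val \o u) r ur.
have xL : x \in L.
  by apply: (closed_cvg_seq cL _ ux) => n; exact: valP.
by exists (Subspace xL); exact: cvg_subspace.
Qed.

End subspace_complete.

Section smooth_perturbation.
Context {R : realType} {E : normedModType R}.
Variables (sq : E -> R) (D : E -> dual E).
Hypothesis D_le : forall x, `|D x| <= `|x|.
Hypothesis sq_convex : forall x z, sq x + D x (z - x) <= sq z.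
Hypothesis sq_smooth : forall x e, 0 < e -> exists2 d, 0 < d & forall h, `|h| < d ->
  sq (x + h) <= sq x + D x h + e * `|h|.

Lemma smooth_square_continuous : continuous sq.
Proof.
move=> x; apply/cvgrPdist_lt => e e0; have [d d0 dP] := sq_smooth x ltr01.
have x1 : 0 < `|x| + 1 by rewrite ltr_wpDl.
apply/nbhs_ballP; exists (Num.min d (e / (`|x| + 1))) => /=.
  by rewrite lt_min d0 divr_gt0.
move=> y; rewrite -ball_normE/= distrC lt_min => /andP[yd ye].
have := dP (y - x) yd; rewrite addrC subrK mul1r.
have := sq_convex x y; have := normr_dual (D x) (y - x).
have : `|D x| * `|y - x| <= `|x| * `|y - x| by rewrite ler_wpM2r.
move: ye; rewrite ltr_pdivlMr// ler_norml => h1 h2 /andP[h3 h4] h5 h6.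
by rewrite ltr_norml; apply/andP; split; have := normr_ge0 (y - x); lra.
Qed.

Let h : R := 2^-1.

(** The series is differentiated by hand: finitely many terms one by one, the tail by a Lipschitz
    bound that follows from convexity and [|D x| <= |x|]. The errors of [psi], of the first terms
    and of the tail take [e / 4] each. *)
Lemma smooth_perturbation_normal (B : set E) (u : E) (w : nat -> E) (psi : E -> R)
    (v F : dual E) (c r : R) (t : nat -> R) :
  0 < c -> 0 < r -> (forall k, `|u - w k| <= r) ->
  (forall n, `|\sum_(k < n) h ^+ k *: D (u - w k) - F| <= 2 * r * h ^+ n) ->
  (forall n, (0 < n)%N -> t n <= h ^+ n) ->
  (forall n x, B x -> psi u + c * \sum_(k < n) h ^+ k * sq (u - w k) <=
     psi x + c * (\sum_(k < n) h ^+ k * sq (x - w k)) + t n) ->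
  (forall e, 0 < e -> exists2 d, 0 < d & forall x, `|x - u| < d ->
     psi x <= psi u + v (x - u) + e * `|x - u|) ->
  forall e, 0 < e -> exists2 d, 0 < d & forall x, B x -> `|x - u| < d ->
    - (v + c *: F) (x - u) <= e * `|x - u|.
Proof.
move=> c0 r0 uw Flim th umin smooth e e0.
have hk k : 0 < h ^+ k := half_exp_gt0 k.
have [d0 d00 d0P] := smooth (e / 4) (divr_gt0 e0 (ltr0Sn R 3)).
have e8 : 0 < e / (8 * c) by rewrite divr_gt0// mulr_gt0.
(* Beyond index [K] the Lipschitz constants [2 * r + 1], weighted and multiplied by [c], sum to less
   than [e / 4]. *)
have [K /(_ K (leqnn K)) KP] := half_exp_lt (2 * c * (2 * r + 1))
  (divr_gt0 e0 (ltr0Sn R 3)).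
have /choice[dk dkP] : forall k, exists d, 0 < d /\ forall x, `|x| < d ->
    sq (u - w k + x) <= sq (u - w k) + D (u - w k) x + e / (8 * c) * `|x|.
  by move=> k; have [d d1 dP] := sq_smooth (u - w k) e8; exists d.
have [d1 d10 d1P] : exists2 d, 0 < d & forall k, (k < K)%N -> d <= dk k.
  elim: (K) => [|j [d jd0 jd]]; first by exists 1.
  exists (Num.min (dk j) d); first by rewrite lt_min (dkP j).1.
  move=> k; rewrite ltnS leq_eqVlt => /orP[/eqP ->|/jd]; first by rewrite ge_min lexx.
  by rewrite ge_min orbC => ->.
exists (Num.min (Num.min d0 d1) 1); first by rewrite !lt_min d00 d10 ltr01.
move=> x Bx; rewrite !lt_min => /andP[/andP[xd0 xd1] x1].
set a := x - u in xd0 xd1 x1 *.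
have xE k : x - w k = u - w k + a by rewrite /a [RHS]addrC addrA subrK.
pose T n := \sum_(k < n) h ^+ k * (sq (x - w k) - sq (u - w k) - D (u - w k) a).
have T_small n : (n <= K)%N -> T n <= e / (4 * c) * `|a|.
  move=> nK; apply: (@le_trans _ _ (\sum_(k < n) h ^+ k * (e / (8 * c) * `|a|))).
    apply: ler_sum => k _; rewrite ler_pM2l// xE.
    have kK : (k < K)%N by exact: leq_trans nK.
    by have := (dkP k).2 a (lt_le_trans xd1 (d1P k kK)); lra.
  rewrite -mulr_suml; have := @sum_half_exp_le R n => s2.
  apply: (@le_trans _ _ (2 * (e / (8 * c) * `|a|))).
    by rewrite ler_wpM2r// mulr_ge0// ltW.
  by rewrite le_eqVlt; apply/orP; left; apply/eqP; field; rewrite gt_eqF.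
have T_tail j : T (K + j)%N <=
    e / (4 * c) * `|a| + (2 * r + 1) * (2 * h ^+ K - 2 * h ^+ (K + j)) * `|a|.
  elim: j => [|j IH].
    by rewrite addn0 subrr mulr0 mul0r addr0; exact: T_small.
  rewrite addnS /T big_ord_recr/= -/(T _); set k := (K + j)%N in IH *.
  have : sq (x - w k) - sq (u - w k) - D (u - w k) a <= (2 * r + 1) * `|a|.
    have := sq_convex (x - w k) (u - w k).
    rewrite (_ : u - w k - (x - w k) = - a); last first.
      by rewrite /a !opprB addrA subrK.
    rewrite linearN/=; have := le_dual_norm (D (x - w k)) a.
    have := ge_dual_norm (D (u - w k)) a.
    have : `|D (u - w k)| * `|a| <= r * `|a|.
      by rewrite ler_wpM2r// (le_trans (D_le _)).
    have : `|D (x - w k)| * `|a| <= (r + 1) * `|a|.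
      rewrite ler_wpM2r// (le_trans (D_le _))// xE (le_trans (ler_normD _ _))//.
      by rewrite lerD// ltW.
    lra.
  move=> /(ler_wpM2l (ltW (hk k))) hT.
  have -> : h ^+ k.+1 = h ^+ k / 2 by rewrite exprS mulrC.
  lra.
rewrite -lerN2 -[leRHS]/(- - _) opprK; apply/ler_addgt0Pr => s s0.
(* Only now, with [x] fixed, is the stage sent to infinity to remove [t n] and the distance from the
   partial sums to [F]. *)
have [N NP] := half_exp_lt (2 * c * r * `|a| + 1) s0.
set n := (K + N.+1)%N.
have hn : (2 * c * r * `|a| + 1) * h ^+ n < s.
  by apply: NP; rewrite /n addnS ltnW// ltnS leq_addl.
have n0 : (0 < n)%N by rewrite /n addnS.
have tn := th n n0.
have mn := umin n x Bx.
pose Fn := \sum_(k < n) h ^+ k *: D (u - w k).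
have FnE : Fn a = \sum_(k < n) h ^+ k * D (u - w k) a.
  rewrite /Fn; elim: (n) => [|j IH]; first by rewrite !big_ord0.
  by rewrite !big_ord_recr dualDE dualZE IH.
have TE : T n = \sum_(k < n) h ^+ k * sq (x - w k) -
    \sum_(k < n) h ^+ k * sq (u - w k) - Fn a.
  rewrite FnE -!sumrB; apply: eq_bigr => k _; ring.
have Fa : Fn a <= F a + 2 * r * h ^+ n * `|a|.
  have := le_dual_norm (Fn - F) a; rewrite dualBE.
  have : `|Fn - F| * `|a| <= 2 * r * h ^+ n * `|a| by rewrite ler_wpM2r// Flim.
  lra.
have {T_tail} Tn := T_tail N.+1; rewrite -/n in Tn.
have cT : c * T n <= e / 4 * `|a| + e / 4 * `|a|.
  have hn0 := hk n.
  apply: (@le_trans _ _ (c * (e / (4 * c) * `|a| + (2 * r + 1) * (2 * h ^+ K) * `|a|))).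
    rewrite ler_pM2l//; apply: (le_trans Tn); rewrite lerD2l ler_wpM2r//.
    by rewrite ler_wpM2l//; lra.
  rewrite mulrDr; apply: lerD.
    by rewrite le_eqVlt; apply/orP; left; apply/eqP; field; rewrite gt_eqF.
  rewrite mulrA ler_wpM2r//; move: KP; rewrite -/h; lra.
have := d0P x xd0; rewrite -/a.
have cFa := ler_wpM2l (ltW c0) Fa.
rewrite dualDE dualZE; move: mn; rewrite TE in cT.
have := normr_ge0 a; have ea : 0 <= e * `|a| by rewrite mulr_ge0// ltW.
lra.
Qed.

End smooth_perturbation.

Section smooth_separation.
Context {R : realType} {E : normedModType R}.
Variables (sq : E -> R) (D : E -> dual E).
Hypothesis sq_ge : forall x, `|x| ^+ 2 / 20 <= sq x.
Hypothesis sq_le : forall x, sq x <= `|x| ^+ 2.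
Hypothesis D_le : forall x, `|D x| <= `|x|.
Hypothesis sq_convex : forall x z, sq x + D x (z - x) <= sq z.
Hypothesis sq_smooth : forall x e, 0 < e -> exists2 d, 0 < d & forall h, `|h| < d ->
  sq (x + h) <= sq x + D x h + e * `|h|.
Hypothesis E_complete : geometric_complete E.

Let sq0 : sq 0 = 0.
Proof.
apply/le_anti/andP; split.
  by have := sq_le 0; rewrite normr0 expr0n.
by have := sq_ge 0; rewrite normr0 expr0n mul0r.
Qed.

Let sq_ge0 x : 0 <= sq x.
Proof. by apply: le_trans (sq_ge x); rewrite divr_ge0// sqr_ge0. Qed.

Let sqrt_le x : Num.sqrt (sq x) <= `|x|.
Proof. by rewrite -[leRHS]ger0_norm// -sqrtr_sqr ler_wsqrtr. Qed.

Let sqrt_ge x : `|x| / 5 <= Num.sqrt (sq x).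
Proof.
rewrite -[leLHS]ger0_norm ?divr_ge0// -sqrtr_sqr ler_wsqrtr//.
apply: le_trans (sq_ge x); rewrite !expr2; have := sqr_ge0 `|x|.
rewrite expr2; lra.
Qed.

Let sqrt_gt0 x : x != 0 -> 0 < Num.sqrt (sq x).
Proof.
by move=> x0; apply: lt_le_trans (sqrt_ge x); rewrite divr_gt0// normr_gt0.
Qed.

(* The gradient of the smooth norm [Num.sqrt \o sq]. *)
Let N (x : E) : dual E := (2 * Num.sqrt (sq x))^-1 *: D x.

(* By concavity of the square root, an upper estimate for [sq] is enough. *)
Let sqrt_smooth x e : x != 0 -> 0 < e -> exists2 d, 0 < d & forall h, `|h| < d ->
  Num.sqrt (sq (x + h)) <= Num.sqrt (sq x) + N x h + e * `|h|.
Proof.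
move=> x0 e0; have s0 := sqrt_gt0 x0; set s := Num.sqrt (sq x) in s0 *.
have se0 : 0 < 2 * s * e by rewrite !mulr_gt0.
have [d d0 dP] := sq_smooth x se0; exists d => // h /dP.
rewrite /N -/s dualZE; set b := Num.sqrt (sq (x + h)) => hb.
have sb : sq (x + h) = b * b by rewrite -expr2 sqr_sqrtr.
have ss : sq x = s * s by rewrite -expr2 sqr_sqrtr.
rewrite sb ss in hb.
rewrite -(ler_pM2l (mulr_gt0 (ltr0Sn R 1) s0)).
have := sqr_ge0 (b - s).
have -> : 2 * s * (s + (2 * s)^-1 * D x h + e * `|h|) =
    2 * s * s + D x h + 2 * s * e * `|h|.
  by field; rewrite gt_eqF.
rewrite expr2; lra.
Qed.

(** Convexity between [x] and 0 gives [sq x <= D x x], so the gradient has norm at least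
    [Num.sqrt (sq x) / (2 * |x|)], and [sqrt_ge] applies. *)
Let N_ge x : x != 0 -> 1 / 10 <= `|N x|.
Proof.
move=> x0; have s0 := sqrt_gt0 x0; have nx : 0 < `|x| by rewrite normr_gt0.
have h1 := sq_convex x 0; rewrite sq0 sub0r linearN in h1.
have h2 := le_dual_norm (D x) x.
rewrite /N normrZ gtr0_norm ?invr_gt0 ?mulr_gt0//.
rewrite ler_pdivlMl ?mulr_gt0// -(ler_pM2r nx).
apply: (@le_trans _ _ (sq x)); last by lra.
rewrite -[leRHS]sqr_sqrtr// expr2.
have -> : 2 * Num.sqrt (sq x) * (1 / 10) * `|x| = Num.sqrt (sq x) * (`|x| / 5).
  by field.
by rewrite ler_pM2l.
Qed.

(** At the minimizer the smooth norm is evaluated at [b != 0], so its gradient [N b] enters both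
    normals with opposite signs and cancels in the sum; only the gradients of the penalties
    remain. *)
Lemma smooth_separation (B1 B2 : set E) (eps rho : R) (z1 z2 a1 a2 : E) :
  closed B1 -> closed B2 -> 0 < eps < 1/4 -> 0 < rho ->
  B1 a1 -> B2 a2 -> `|a1 - z1| < eps * rho -> `|a2 - z2| < eps * rho ->
  (forall w, `|w| < rho -> B1 (z1 + w) -> B2 (z2 + w) -> False) ->
  exists (u1 u2 : E) (f1 f2 : dual E),
    [/\ B1 u1 /\ B2 u2, `|u1 - z1| <= rho /\ `|u2 - z2| <= rho,
      forall e, 0 < e -> exists2 d, 0 < d & forall x, B1 x -> `|x - u1| < d ->
        f1 (x - u1) <= e * `|x - u1|,
      forall e, 0 < e -> exists2 d, 0 < d & forall x, B2 x -> `|x - u2| < d ->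
        f2 (x - u2) <= e * `|x - u2| &
      `|f1 + f2| <= 64 * 40 * eps /\ 1 / 10 - 64 * 40 * eps <= `|f1|].
Proof.
move=> cB1 cB2 /andP[e0 e4] r0 Ba1 Ba2 az1 az2 sep.
pose phi (u : E * E) := Num.sqrt (sq (u.1 - z1 - (u.2 - z2))).
pose gam (u : E * E) := sq u.1 + sq u.2.
pose r := rho / 8; have rr0 : 0 < r by rewrite divr_gt0.
(* Chosen so that [c * (r ^+ 2 / 20) = 2 * eps * rho] exceeds the initial value of [phi]; then the
   gradients of the penalties, of norm at most [4 * r], contribute [32 * 40 * eps] each. *)
pose c := 40 * eps * rho / r ^+ 2.
have c0 : 0 < c by rewrite divr_gt0 ?exprn_gt0// !mulr_gt0.
have sqc := smooth_square_continuous D_le sq_convex sq_smooth.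
have phic : continuous phi.
  move=> u; apply: (@continuous_comp _ _ _ (fun u => sq (u.1 - z1 - (u.2 - z2)))
    Num.sqrt); last exact: sqrt_continuous.
  apply: (@continuous_comp _ _ _ (fun u => u.1 - z1 - (u.2 - z2)) sq); last exact: sqc.
  apply: cvgB; apply: cvgB; try exact: cvg_cst.
    exact: cvg_fst.
  exact: cvg_snd.
have gamc : continuous gam.
  move=> u; apply: cvgD.
    apply: (@continuous_comp _ _ _ fst sq); last exact: sqc.
    exact: cvg_fst.
  apply: (@continuous_comp _ _ _ snd sq); last exact: sqc.
  exact: cvg_snd.
have phi0 : phi (a1, a2) < 2 * eps * rho.
  by apply: (le_lt_trans (sqrt_le _)); apply: (le_lt_trans (ler_normB _ _)); lra.
have gam_norm d u : 0 <= d -> gam u <= d ^+ 2 / 20 -> `|u| <= d.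
  move=> d0 h; have := sq_ge u.1; have := sq_ge u.2; have := sq_ge0 u.1.
  have := sq_ge0 u.2; rewrite /gam in h => h1 h2 h3 h4.
  by apply: prod_norm_le; rewrite -ler_sqr ?nnegrE//; lra.
have [|||||||||||x [xbar [t [[S1 S2] xd xd0 t0 xmin]]]] :=
    @borwein_preiss R _ (B1 `*` B2) phi gam c r (a1, a2).
- by [].
- by [].
- by [].
- by move=> u; exact: sqrtr_ge0.
- exact: phic.
- by rewrite /gam/= sq0 addr0.
- by move=> u; rewrite /gam addr_ge0.
- exact: gamc.
- move=> d d0; exists (d ^+ 2 / 20); first by rewrite divr_gt0// exprn_gt0.
  by move=> u; apply: gam_norm; exact: ltW.
- move=> u h; apply: gam_norm; first exact: ltW.
  rewrite -(ler_pM2l c0); apply: (le_trans h); apply: (le_trans (ltW phi0)).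
  by rewrite le_eqVlt; apply/orP; left; apply/eqP; rewrite /c; field; rewrite gt_eqF.
- move=> u Su ur.
  have [y uy] := geometric_complete_prod E_complete E_complete ur.
  exists y => //; split.
    apply: (@closed_cvg_seq _ _ B1 (fst \o u)) => //; first by move=> n; case: (Su n).
    exact: (cvg_comp _ _ uy cvg_fst).
  apply: (@closed_cvg_seq _ _ B2 (snd \o u)) => //; first by move=> n; case: (Su n).
  exact: (cvg_comp _ _ uy cvg_snd).
move: xbar S1 S2 xd xd0 xmin => [u1 u2] /= S1 S2 xd xd0 xmin.
have erho : eps * rho < rho / 4 by rewrite mulrC ltr_pM2l//; lra.
have near1 : `|u1 - z1| < rho.
  have := ler_normD (u1 - a1) (a1 - z1); rewrite addrA subrK.
  by have := prod_norm_fst ((u1, u2) - (a1, a2)); move: xd0; rewrite /r/=; lra.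
have near2 : `|u2 - z2| < rho.
  have := ler_normD (u2 - a2) (a2 - z2); rewrite addrA subrK.
  by have := prod_norm_snd ((u1, u2) - (a1, a2)); move: xd0; rewrite /r/=; lra.
pose b := u1 - z1 - (u2 - z2).
have b0 : b != 0.
  rewrite subr_eq0; apply/eqP => u12; apply: (sep (u1 - z1) near1).
    by rewrite addrC subrK.
  by rewrite u12 addrC subrK.
have r2 : 0 < 2 * r by rewrite mulr_gt0.
have limit (u : E) (w : nat -> E) : (forall k, `|u - w k| <= 2 * r) ->
    exists F : dual E, forall n,
      `|\sum_(k < n) 2^-1 ^+ k *: D (u - w k) - F| <= 2 * (2 * r) * 2^-1 ^+ n.
  move=> uw; apply: dual_geometric_limit => k.
  rewrite big_ord_recr/= addrAC subrr add0r normrZ gtr0_norm ?half_exp_gt0// mulrC.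
  by rewrite ler_wpM2r ?(ltW (half_exp_gt0 _))// (le_trans (D_le _)).
have xd1 k : `|u1 - (x k).1| <= 2 * r.
  exact: le_trans (prod_norm_fst ((u1, u2) - x k)) (xd k).
have xd2 k : `|u2 - (x k).2| <= 2 * r.
  exact: le_trans (prod_norm_snd ((u1, u2) - x k)) (xd k).
have [F1 F1P] := limit u1 _ xd1; have [F2 F2P] := limit u2 _ xd2.
have Fle (F : dual E) (w : nat -> dual E) :
    (forall n, `|\sum_(k < n) w k - F| <= 2 * (2 * r) * 2^-1 ^+ n) -> `|F| <= 4 * r.
  by move=> /(_ 0%N); rewrite big_ord0 sub0r normrN expr0; lra.
have F1le := Fle _ (fun k => 2^-1 ^+ k *: D (u1 - (x k).1)) F1P.
have F2le := Fle _ (fun k => 2^-1 ^+ k *: D (u2 - (x k).2)) F2P.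
have cr : c * (4 * r) = 32 * 40 * eps by rewrite /c /r; field; rewrite gt_eqF.
have sumE (n : nat) (p q : E) : \sum_(k < n) 2^-1 ^+ k * gam ((p, q) - x k) =
    \sum_(k < n) 2^-1 ^+ k * sq (p - (x k).1) + \sum_(k < n) 2^-1 ^+ k * sq (q - (x k).2).
  by rewrite -big_split/=; apply: eq_bigr => k _; rewrite -mulrDr.
exists u1, u2, (- (N b + c *: F1)), (- (- N b + c *: F2)); split=> //.
- by rewrite !ltW.
- apply: (@smooth_perturbation_normal R E sq D D_le sq_convex sq_smooth B1 u1
    (fun k => (x k).1) (fun y => phi (y, u2)) (N b) F1 c (2 * r) t) => //.
    move=> n y By; have := xmin n (y, u2) (conj By S2).
    by rewrite !sumE !mulrDr; lra.
  move=> e ee0; have [d d0 dP] := sqrt_smooth b0 ee0; exists d => // y yd.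
  have -> : phi (y, u2) = Num.sqrt (sq (b + (y - u1))).
    by rewrite /phi/= /b [in RHS]addrAC [u1 - z1 + _]addrC addrA subrK.
  exact: dP.
- apply: (@smooth_perturbation_normal R E sq D D_le sq_convex sq_smooth B2 u2
    (fun k => (x k).2) (fun y => phi (u1, y)) (- N b) F2 c (2 * r) t) => //.
    move=> n y By; have := xmin n (u1, y) (conj S1 By).
    by rewrite !sumE !mulrDr; lra.
  move=> e ee0; have [d d0 dP] := sqrt_smooth b0 ee0; exists d => // y yd.
  have -> : phi (u1, y) = Num.sqrt (sq (b + - (y - u2))).
    rewrite /phi/= /b; congr (Num.sqrt (sq _)).
    by rewrite -[RHS]addrA -opprD [u2 - z2 + _]addrC addrA subrK.
  have := dP (- (y - u2)); rewrite normrN linearN dualNE; exact.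
have cF (F : dual E) : `|F| <= 4 * r -> `|c *: F| <= 32 * 40 * eps.
  by move=> FF; rewrite normrZ gtr0_norm// -cr ler_pM2l.
have cF1 := cF _ F1le; have cF2 := cF _ F2le; split.
  rewrite -opprD addrACA subrr add0r normrN.
  by apply: (le_trans (ler_normD _ _)); lra.
rewrite normrN; have := ler_normB (N b + c *: F1) (c *: F1); rewrite addrK.
have := N_ge b0; lra.
Qed.

End smooth_separation.

Section frechet_separation.
Context {R : realType} {Z : normedModType R}.
Hypothesis fragZ : fragmented_dual Z.
Hypothesis Z_complete : geometric_complete Z.

(** The sum of the extended normals stays small because restriction is isometric on the hull; the
    first one stays large because an extension has at least the norm of its restriction. *)
Theorem frechet_separation : separation_property (@frechet_normal R Z).
Proof.
exists (64 * 40), (1 / 10); split; [by rewrite mulr_gt0|by rewrite divr_gt0|].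
move=> A1 A2 eps rho z1 z2 a1 a2 cA1 cA2 eP r0 Aa1 Aa2 az1 az2 sep.
pose A j := if j is 0%N then A1 else A2.
(* The four points must lie in the subspace for the extremal situation to be visible there. *)
pose init n := nth 0 [:: z1; z2; a1; a2] n.
have [t tP] := exists_skeleton fragZ A init.
have [tinit tlin _ _ _] := tP.
have trl : rat_linear_closed (fst \o t).
  by move=> q i j; have [k kE] := tlin q i j; exists k; rewrite /= kE.
have [L LE] := exists_closed_span trl.
have cL : closed [set x | x \in L].
  rewrite (_ : [set x | _] = closure (range (fst \o t))); first exact: closed_closure.
  by apply/seteqP; split=> x /=; rewrite LE.
have initL n : init n \in L.
  by apply/LE; apply: subset_closure; have [m mE] := tinit n; exists m.
have tL n : (t n).1 \in L by apply/LE; apply: subset_closure; exists n.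
have xs_dense (x : subspace_type L) e : 0 < e -> exists n, `|Subspace (tL n) - x| < e.
  by move=> e0; have /LE/closureP/(_ e e0)[_ [n _ <-] ne] := valP x; exists n.
have /choice[es esP] : forall n, exists v : dual (subspace_type L),
    forall x, v x = (t n).2 (val x).
  by move=> n; have [v vE _] := exists_restriction L (t n).2; exists v.
have es_dense (f : dual (subspace_type L)) e : 0 < e -> exists n, `|es n - f| < e.
  move=> e0; have [y hy yE] := dual_hull_extension tP LE f.
  have e2 : 0 < e / 2 by rewrite divr_gt0.
  have [n ne] := hy _ e2; exists n; apply: (@le_lt_trans _ _ (e / 2)); last by lra.
  apply: dual_norm_le_lin; first exact: ltW.
  move=> x; rewrite dualBE esP -yE -dualBE; apply: (le_trans (le_dual_norm _ _)).
  by rewrite ler_wpM2r.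
have [sq [D [h1 h2 h3 h4 h5]]] := exists_smooth_square xs_dense es_dense.
pose B j := [set x : subspace_type L | A j (val x)].
have cB j : closed (A j) -> closed (B j).
  apply: closed_comp => x _ V /nbhs_ballP[e /= e0 eV].
  by apply/nbhs_ballP; exists e => // y; rewrite -ball_normE => xy; apply: eV;
    rewrite -ball_normE.
have [|||||||u1 [u2 [f1 [f2 [[Bu1 Bu2] [uz1 uz2] n1 n2 [f12 fk]]]]]] :=
  smooth_separation h1 h2 h3 h4 h5 (geometric_complete_subspace cL Z_complete)
    (B1 := B 0%N) (B2 := B 1%N) (z1 := Subspace (initL 0%N)) (z2 := Subspace (initL 1%N))
    (a1 := Subspace (initL 2%N)) (a2 := Subspace (initL 3%N)) _ _ eP r0.
- exact: cB.
- exact: cB.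
- by [].
- by [].
- by [].
- by [].
- by move=> w wr; exact: sep.
have [y1 hy1 y1E] := dual_hull_extension tP LE f1.
have [y2 hy2 y2E] := dual_hull_extension tP LE f2.
exists (val u1), (val u2), y1, y2; split=> //.
- apply: (dual_hull_frechet tP LE (j := 0%N)) => // e /n1[d d0 dP].
  by exists d => // u; rewrite -[val u - _]/(val (u - u1)) y1E; exact: dP.
- apply: (dual_hull_frechet tP LE (j := 1%N)) => // e /n2[d d0 dP].
  by exists d => // u; rewrite -[val u - _]/(val (u - u2)) y2E; exact: dP.
- have h12 := dual_hullD tP hy1 hy2; apply: (dual_hull_norm tP LE _ h12).
    by case/andP: eP => eps0 _; rewrite !mulr_ge0// ltW.
  move=> x; rewrite dualDE y1E y2E -dualDE; apply: (le_trans (normr_dual _ _)).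
  by rewrite ler_wpM2r.
- apply: (le_trans fk); apply: dual_norm_le_lin => // x.
  by rewrite -y1E; exact: le_dual_norm.
Qed.

End frechet_separation.

Lemma geometric_complete_banach (R : realType) (X : completeNormedModType R) :
  geometric_complete X.
Proof. by move=> u r; exact: geometric_cvg. Qed.

Theorem corollary3p1 (R : realType) (X Y : completeNormedModType R)
    (Omega : set X) (F : X -> set Y) (xbar : X) (ybar : Y) (Xi : set (set Y))
    (Omega_xbar : Omega xbar) (F_ybar : F xbar ybar) (Xi_neq0 : Xi !=set0)
    (Omega_closed : closed Omega) (gphF_closed : closed (gph F))
    (Xi_closed : forall A, Xi A -> closed A)
    (stationary : approx_stationary F Omega Xi xbar ybar) :
    ((exists2 M : R, 0 < M & forall eps : R, 0 < eps ->
        exists (x1 : X) (y1 : Y) (x2 : X) (A : set Y) (y2 : Y) (ystar : dual Y),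
          [/\ (gph F `&` ball (xbar, ybar) eps) (x1, y1),
              (Omega `&` ball xbar eps) x2,
              Xi A,
              (A `&` ball ybar eps) y2 &
              [/\ set_add (clarke_normal A y2) (ball 0 eps) ystar,
                  `|ystar| = 1 &
                  set_add
                    (set_add (clarke_coderivative F x1 y1 ystar)
                             (clarke_normal Omega x2 `&` ball 0 M))
                    (ball 0 eps) 0]])
     \/
     (forall eps : R, 0 < eps ->
        exists (x1 : X) (y1 : Y) (x2 : X) (x1star x2star : dual X),
          [/\ (gph F `&` ball (xbar, ybar) eps) (x1, y1),
              (Omega `&` ball xbar eps) x2,
              sv_image (clarke_coderivative F x1 y1) (ball 0 eps) x1star,
              clarke_normal Omega x2 x2star &
              `|x1star + x2star| < eps /\ `|x1star| + `|x2star| = 1]))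
    /\
    (asplund X -> asplund Y ->
    ((exists2 M : R, 0 < M & forall eps : R, 0 < eps ->
        exists (x1 : X) (y1 : Y) (x2 : X) (A : set Y) (y2 : Y) (ystar : dual Y),
          [/\ (gph F `&` ball (xbar, ybar) eps) (x1, y1),
              (Omega `&` ball xbar eps) x2,
              Xi A,
              (A `&` ball ybar eps) y2 &
              [/\ set_add (frechet_normal A y2) (ball 0 eps) ystar,
                  `|ystar| = 1 &
                  set_add
                    (set_add (frechet_coderivative F x1 y1 ystar)
                             (frechet_normal Omega x2 `&` ball 0 M))
                    (ball 0 eps) 0]])
     \/
     (forall eps : R, 0 < eps ->
        exists (x1 : X) (y1 : Y) (x2 : X) (x1star x2star : dual X),
          [/\ (gph F `&` ball (xbar, ybar) eps) (x1, y1),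
              (Omega `&` ball xbar eps) x2,
              sv_image (frechet_coderivative F x1 y1) (ball 0 eps) x1star,
              frechet_normal Omega x2 x2star &
              `|x1star + x2star| < eps /\ `|x1star| + `|x2star| = 1]))).
Proof.
have Zc : geometric_complete (X * Y)%type.
  by apply: geometric_complete_prod; exact: geometric_complete_banach.
split=> [|aX aY].
  exact: (stationarity_dichotomy (@clarke_normal_sub R _) (@clarke_normalZ R _)
    (@clarke_normal_prod R X Y) (clarke_separation Zc)
    Omega_closed gphF_closed Xi_closed stationary).
have Zf : fragmented_dual (X * Y)%type.
  by apply: fragmented_dual_prod; exact: asplund_fragmented.
exact: (stationarity_dichotomy (@frechet_normal_sub R _) (@frechet_normalZ R _)
  (@frechet_normal_prod R X Y) (frechet_separation Zf Zc)
  Omega_closed gphF_closed Xi_closed stationary).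
Qed.
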